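(* Let $\alpha>0$. Viewed locally, the level curves $\Gamma$ of maps $F\in C^{1,\alpha}_H(\mathbb H^1,\mathbb R^2)$ with $D_hF$ surjective are exactly the vertical lifts of curves $\gamma\in H^{\frac{1+\alpha}2}([0,T],\mathbb R^2)$. That is: (i) if $F\in C^{1,\alpha}_H(\mathbb H^1,\mathbb R^2)$ and $D_hF(p)$ is surjective, then for a sufficiently small neighbourhood of $p$ the level curve $\Gamma$ of $F$ through $p$ in this neighbourhood is, up to parametrization, a vertical lift of a curve $\gamma\in H^{\frac{1+\alpha}2}([0,T],\mathbb R^2)$ for some $T>0$; (ii) conversely, if $\gamma\in H^{\frac{1+\alpha}2}([0,T],\mathbb R^2)$, then the restriction of any vertical lift of $\gamma$ to every sufficiently short subinterval of $[0,T]$ is contained in a level set $F^{-1}(0)$ of some $F\in C^{1,\alpha}_H(\mathbb H^1,\mathbb R^2)$ with $D_hF$ surjective at every point of the restricted lift.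
   Context: The Heisenberg group $\mathbb H^1$ is $\mathbb R^3$ with the law $(x,y,z)(x',y',z')=(x+x',y+y',z+z'+2x'y-2xy')$ and dilations $\delta_t(x,y,z)=(tx,ty,t^2z)$. Put $\rho_\infty(x,y,z)=\max\{\sqrt{x^2+y^2},|z|^{1/2}\}$ and $d_\infty(A,B)=\rho_\infty(B^{-1}A)$ (a left-invariant metric). A map $F:\mathbb H^1\to\mathbb R^2$ is horizontally differentiable at $A$ if there is a continuous group homomorphism $L:\mathbb H^1\to\mathbb R^2$ with $L(\delta_tB)=tL(B)$ ($t>0$) and $\|F(AB)-F(A)-L(B)\|=o(\rho_\infty(B))$ as $B\to0$; then $D_hF(A):=L$. $F\in C^1_H$ if this holds at every $A$ and $A\mapsto D_hF(A)$ is continuous. The class $C^{1,\alpha}_H$ (defined for $0<\alpha<1$) consists of $F\in C^1_H$ with $\|D_hF(A)-D_hF(B)\|\le Md_\infty(A,B)^\alpha$ for some $M$ and all $A,B\in\mathbb H^1$. If $D_hF(p)$ is surjective, the level set of $F$ through $p$ is, in a suitable small compact neighbourhood of $p$, a simple arc; this is the level curve in (i). $H^\beta([0,T],\mathbb R^2)$ is the space of $\beta$-Hölder curves: $\sup_{t\ne s}\|\gamma(t)-\gamma(s)\||t-s|^{-\beta}<\infty$. For continuous $x,y:[0,T]\to\mathbb R$ put $\operatorname{Z}_{x,y}(t)=2\int_0^t(x\,dy-y\,dx)$, where $\int_0^t(x\,dy-y\,dx):=\lim_{\|\sigma\|\to0}\sum_{i=0}^N(x(t_i)y(t_{i+1})-y(t_i)x(t_{i+1}))$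 over subdivisions $\sigma=\{0=t_0<\dots<t_{N+1}=t\}$, when this limit exists and is finite (it does when $x,y$ are Hölder of exponent $>\frac12$). A vertical lift of $\gamma=(x,y)$ is a curve $[0,T]\ni t\mapsto(x(t),y(t),z_0-\operatorname{Z}_{x,y}(t)+t)$ with $z_0\in\mathbb R$. *)

(* Defs.v *)
From HB Require Import structures.
From mathcomp Require Import all_boot all_order all_algebra.
From mathcomp Require Import all_classical all_reals all_analysis.
Import Order.TTheory GRing.Theory Num.Theory.
Import numFieldNormedType.Exports.

Set Implicit Arguments.
Unset Strict Implicit.
Unset Printing Implicit Defensive.

Local Open Scope classical_set_scope.
Local Open Scope ring_scope.

(* The underlying space R^3 with its Euclidean (product) topology, which is
   also the topology of the metric [heis_dist]; its origin 0 is the neutral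
   element of [heis_mul]. The additive group structure of the product type is
   not the group law of the Heisenberg group. *)
Notation heis R := (R * R * R)%type.

Section Heisenberg.
Context {R : realType}.
Implicit Types (A B : heis R) (L : heis R -> R * R) (F : heis R -> R * R).

Definition heis_mul A B : heis R :=
  (A.1.1 + B.1.1, A.1.2 + B.1.2,
   A.2 + B.2 + 2 * B.1.1 * A.1.2 - 2 * A.1.1 * B.1.2).

Definition heis_inv A : heis R := (- A.1.1, - A.1.2, - A.2).

Definition heis_dil (t : R) A : heis R := (t * A.1.1, t * A.1.2, t ^+ 2 * A.2).

(* Euclidean norm; the norm [`| v |] of the product type is the max norm. *)
Definition enorm2 (v : R * R) : R := Num.sqrt (v.1 ^+ 2 + v.2 ^+ 2).

Definition rho_oo A : R := Num.max (enorm2 A.1) (Num.sqrt `|A.2|).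

Definition heis_dist A B : R := rho_oo (heis_mul (heis_inv B) A).

Definition horizontal_hom L : Prop :=
  [/\ continuous L,
      forall A B, L (heis_mul A B) = L A + L B &
      forall t A, 0 < t -> L (heis_dil t A) = t *: L A].

Definition is_hdiff F A L : Prop :=
  horizontal_hom L /\
  forall e : R, 0 < e ->
    \forall B \near (0 : heis R),
      enorm2 (F (heis_mul A B) - F A - L B) <= e * rho_oo B.

Definition hdifferentiable F A : Prop := exists L, is_hdiff F A L.

(* The horizontal differential, equal to 0 where F is not differentiable. *)
Definition Dh F A : heis R -> R * R := xget (fun=> 0) [set L | is_hdiff F A L].

(* The operator norm; the set is bounded when L is a difference of
   horizontal homomorphisms. *)
Definition hom_norm L : R := sup [set enorm2 (L B) | B in [set B | rho_oo B <= 1]].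

Definition hom_dist L1 L2 : R := hom_norm (fun B => L1 B - L2 B).

Definition C1H F : Prop :=
  (forall A, hdifferentiable F A) /\
  (forall A, hom_dist (Dh F B) (Dh F A) @[B --> A] --> (0 : R)).

Definition C1H_holder (alpha : R) F : Prop :=
  C1H F /\
  exists M : R, forall A B,
    hom_dist (Dh F A) (Dh F B) <= M * heis_dist A B `^ alpha.

Definition holder_curve (beta T : R) (g : R -> R * R) : Prop :=
  exists C : R, forall s t, s \in `[0, T] -> t \in `[0, T] ->
    enorm2 (g t - g s) <= C * `|t - s| `^ beta.

(* As for [variation], a subdivision a = t_0 < ... < t_n = b is given by the
   list [:: t_1; ...; t_n]. *)
Definition mesh (a b : R) (s : seq R) : R :=
  \big[Num.max/0]_(0 <= i < size s) (nth b (a :: s) i.+1 - nth b (a :: s) i).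

Definition area_sum (g : R -> R * R) (a b : R) (s : seq R) : R :=
  let G := g \o nth b (a :: s) in
  \sum_(0 <= i < size s) ((G i).1 * (G i.+1).2 - (G i).2 * (G i.+1).1).

Definition is_area_integral (g : R -> R * R) (t I : R) : Prop :=
  forall e : R, 0 < e -> exists2 d : R, 0 < d &
    forall s, itv_partition 0 t s -> mesh 0 t s < d ->
      `|area_sum g 0 t s - I| < e.

(* Z is meaningful only when the limit exists, as it does for Hoelder curves
   of exponent > 1/2. *)
Definition Zarea (g : R -> R * R) (t : R) : R :=
  2 * get [set I | is_area_integral g t I].

Definition vertical_lift (g : R -> R * R) (z0 t : R) : heis R :=
  ((g t).1, (g t).2, z0 - Zarea g t + t).

Definition arc_param (a b : R) (c : R -> heis R) (S : set (heis R)) : Prop :=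
  [/\ {within `[a, b], continuous c},
      {in `[a, b] &, injective c} &
      c @` `[a, b] = S].

Definition simple_arc (S : set (heis R)) : Prop :=
  exists c : R -> heis R, arc_param 0 1 c S.

(* The part in K of the level set of F through p. *)
Definition level_in F (p : heis R) (K : set (heis R)) : set (heis R) :=
  F @^-1` [set F p] `&` K.

End Heisenberg.

(* Main.v *)
(** Write [zeta A B] for the vertical coordinate of [A^-1 B].  It is antisymmetric and additive up to
    [2 |b - a| |c - b|], so along curves whose horizontal part is Hoelder of exponent [(1 + alpha) / 2 > 1 / 2]
    it can be sewn into an additive function, which is the parameter of the vertical lift.

    (i) After composing with the inverse of the horizontal differential at [p], a map [F] with a Hoelder
    differential becomes [Phi] with [|Phi B - Phi A - (b - a)| <= |b - a| / 4 + C |zeta A B|^((1 + alpha) / 2)]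
    near [p].  Hence on the level set [|b - a|] is at most a multiple of [|zeta A B|^((1 + alpha) / 2)], and
    two points of it with [zeta A B = 0] coincide.  Newton's method produces chains of almost-zeros of [Phi]
    with constant vertical step; their limit along an ultrafilter is a curve [c] in the level set with
    [zeta (c s) (c t) = t - s + O(|t - s|^(1 + alpha))].  A point [B] of the level set near [p] lies on [c],
    because [t |-> zeta (c t) B] changes sign, and summing the estimate over subdivisions identifies [c] with
    a vertical lift.

    (ii) A vertical lift [c] of [gamma] satisfies [d(c s, c t)^2 ~ |t - s|], so that
    [|gamma t - gamma s| <= C d(c s, c t)^(1 + alpha)]: the values [gamma] and the horizontal gradient [0] form
    a Whitney jet on the curve.  They are extended to [phi], the sum over the scales [2^-n] of differences of
    consecutive averages of [gamma] against partitions of unity, and [F (x, y, z) = (x, y) - phi (x, y, z)]. *)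

Require Import Defs.
From HB Require Import structures.
From mathcomp Require Import all_boot all_order all_algebra.
From mathcomp Require Import all_classical all_reals all_analysis.
From mathcomp Require Import ring lra zify.
Import Order.TTheory GRing.Theory Num.Theory.
Import numFieldNormedType.Exports.

Set Implicit Arguments.
Unset Strict Implicit.
Unset Printing Implicit Defensive.

Local Open Scope classical_set_scope.
Local Open Scope ring_scope.

(** In (i), a map of the class considered is in general only Hoelder of exponent
    [(1 + alpha) / 2 < 1] in the vertical direction, the very direction along which its level sets
    run. There is no vertical derivative, hence neither an implicit function theorem nor a
    differential equation to integrate. A bootstrap replaces them: straightness bounds the
    horizontal displacement of a piece of chain by a power of its [zeta], and sewing bounds [zeta]
    by the horizontal displacements of strictly shorter pieces. The loop closes because the defect
    of additivity has order [1 + alpha > 1]. The same estimate on [zeta] proves that the area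
    integral exists, so no theory of Young integrals enters. In (ii), no decomposition of the
    complement of the curve is made: the partition functions live in small balls centred on the
    curve and sum to one on the curve only. The series converges because [1 < 1 + alpha < 2]: a term
    of scale [r] has size [r ^ (1 + alpha)], and its Taylor remainder over a distance [d] is bounded
    both linearly and quadratically in [d / r]. Limits along an ultrafilter exist for all parameters
    or points at once, which spares any extraction of subsequences. *)

Section Plane.
Context {R : realType}.
Implicit Types (a b u v w : R * R).

Definition dot a b : R := a.1 * b.1 + a.2 * b.2.

Definition wedge a b : R := a.1 * b.2 - a.2 * b.1.

Lemma enorm2_ge0 v : 0 <= enorm2 v.
Proof. exact: sqrtr_ge0. Qed.

Lemma enorm2_sqr v : enorm2 v ^+ 2 = v.1 ^+ 2 + v.2 ^+ 2.
Proof. by rewrite sqr_sqrtr// addr_ge0// sqr_ge0. Qed.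

Lemma enorm2_le v (x : R) : 0 <= x -> v.1 ^+ 2 + v.2 ^+ 2 <= x ^+ 2 -> enorm2 v <= x.
Proof. by move=> x0 h; rewrite -(ler_pXn2r (ltn0Sn 1)) ?nnegrE ?enorm2_ge0// enorm2_sqr. Qed.

Lemma enorm20 : enorm2 (0 : R * R) = 0.
Proof. by rewrite /enorm2 /= expr0n addr0 sqrtr0. Qed.

Lemma enorm2_eq0 v : enorm2 v <= 0 -> v = 0.
Proof.
move=> v0; have /eqP e0 : enorm2 v == 0 by rewrite eq_le v0 enorm2_ge0.
have := enorm2_sqr v; rewrite e0 expr0n /= => /esym/eqP.
rewrite paddr_eq0 ?sqr_ge0// !sqrf_eq0 => /andP[/eqP v1 /eqP v2].
by case: v v1 v2 {v0 e0} => x y /= -> ->.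
Qed.

Lemma enorm2N v : enorm2 (- v) = enorm2 v.
Proof. by rewrite /enorm2 /= !sqrrN. Qed.

Lemma enorm2Z (k : R) v : enorm2 (k *: v) = `|k| * enorm2 v.
Proof.
by rewrite /enorm2 /= !exprMn -mulrDr sqrtrM ?sqr_ge0// sqrtr_sqr.
Qed.

(** Lagrange's identity gives the Cauchy-Schwarz bound for [dot] and the one for [wedge] alike, each
    by dropping the other square. *)
Lemma lagrange_plane u v :
  dot u v ^+ 2 + wedge u v ^+ 2 = (enorm2 u * enorm2 v) ^+ 2.
Proof. by rewrite exprMn !enorm2_sqr /dot /wedge; ring. Qed.

Lemma dot_le u v : `|dot u v| <= enorm2 u * enorm2 v.
Proof.
rewrite -(ler_pXn2r (ltn0Sn 1)) ?nnegrE ?mulr_ge0 ?enorm2_ge0//.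
by rewrite -lagrange_plane real_normK ?num_real// lerDl sqr_ge0.
Qed.

Lemma wedge_le u v : `|wedge u v| <= enorm2 u * enorm2 v.
Proof.
rewrite -(ler_pXn2r (ltn0Sn 1)) ?nnegrE ?mulr_ge0 ?enorm2_ge0//.
by rewrite -lagrange_plane real_normK ?num_real// lerDr sqr_ge0.
Qed.

Lemma dotvv v : dot v v = enorm2 v ^+ 2.
Proof. by rewrite enorm2_sqr /dot; ring. Qed.

Lemma enorm2D u v : enorm2 (u + v) <= enorm2 u + enorm2 v.
Proof.
apply: enorm2_le; first by rewrite addr_ge0// enorm2_ge0.
have := ler_normlW (dot_le u v); have := enorm2_sqr u; have := enorm2_sqr v.
rewrite /dot /=; lra.
Qed.

Lemma enorm2B u v : enorm2 (u - v) <= enorm2 u + enorm2 v.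
Proof. by rewrite -(enorm2N v) enorm2D. Qed.

Lemma enorm2_subC u v : enorm2 (u - v) = enorm2 (v - u).
Proof. by rewrite -enorm2N opprB. Qed.

Lemma enorm2_ge1 v : `|v.1| <= enorm2 v.
Proof.
by rewrite -(ler_pXn2r (ltn0Sn 1)) ?nnegrE ?enorm2_ge0// enorm2_sqr real_normK ?num_real// lerDl sqr_ge0.
Qed.

Lemma enorm2_ge2 v : `|v.2| <= enorm2 v.
Proof.
by rewrite -(ler_pXn2r (ltn0Sn 1)) ?nnegrE ?enorm2_ge0// enorm2_sqr real_normK ?num_real// lerDr sqr_ge0.
Qed.

Lemma enorm2_le_norms v : enorm2 v <= `|v.1| + `|v.2|.
Proof.
apply: enorm2_le; first by rewrite addr_ge0.
rewrite sqrrD !real_normK ?num_real// lerD2r lerDl mulrn_wge0// mulr_ge0//.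
Qed.

End Plane.

(** * Metric geometry of the Heisenberg group *)

Section HeisenbergMetric.
Context {R : realType}.
Implicit Types (A B C : heis R).

(* The vertical coordinate of [A^-1 B]. *)
Definition zeta A B : R := B.2 - A.2 + 2 * wedge A.1 B.1.

Lemma zetaC A B : zeta B A = - zeta A B.
Proof. by rewrite /zeta /wedge; ring. Qed.

(** The defect of additivity is four times the signed area of the triangle formed by the three
    horizontal projections. *)
Lemma zeta_split A B C :
  zeta A C = zeta A B + zeta B C - 2 * wedge (B.1 - A.1) (C.1 - B.1).
Proof. by rewrite /zeta /wedge /=; ring. Qed.

Lemma zeta_split_le A B C :
  `|zeta A C - zeta A B - zeta B C| <= 2 * (enorm2 (B.1 - A.1) * enorm2 (C.1 - B.1)).
Proof.
have -> : zeta A C - zeta A B - zeta B C = - (2 * wedge (B.1 - A.1) (C.1 - B.1)).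
  by rewrite (zeta_split A B C); ring.
by rewrite normrN normrM (ger0_norm (ler0n _ 2)) ler_pM2l ?ltr0n// wedge_le.
Qed.

Lemma zeta_mul A B : zeta A (heis_mul A B) = B.2.
Proof. by rewrite /zeta /wedge /heis_mul /=; ring. Qed.

Lemma heis_mul_fst A B : (heis_mul A B).1 = A.1 + B.1.
Proof. by []. Qed.

Lemma heis_mulA A B C : heis_mul A (heis_mul B C) = heis_mul (heis_mul A B) C.
Proof. by rewrite /heis_mul /=; congr (_, _, _); ring. Qed.

Lemma heis_invM A B : heis_mul (heis_inv A) B = (B.1 - A.1, zeta A B).
Proof.
case: A B => [[x y] z] [[x' y'] z'].
rewrite /heis_mul /heis_inv /zeta /wedge /=; congr (_, _); last by ring.
by rewrite -[LHS]/(- (x,y) + (x',y')) addrC.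
Qed.

Lemma heis_distE A B : heis_dist A B = Num.max (enorm2 (B.1 - A.1)) (Num.sqrt `|zeta A B|).
Proof. by rewrite /heis_dist heis_invM /rho_oo /= enorm2_subC zetaC normrN. Qed.

Lemma heis_distC A B : heis_dist A B = heis_dist B A.
Proof. by rewrite !heis_distE enorm2_subC zetaC normrN. Qed.

Lemma heis_dist_ge0 A B : 0 <= heis_dist A B.
Proof. by rewrite heis_distE le_max enorm2_ge0. Qed.

Lemma heis_dist_hor A B : enorm2 (B.1 - A.1) <= heis_dist A B.
Proof. by rewrite heis_distE le_max lexx. Qed.

Lemma heis_dist_ver A B : `|zeta A B| <= heis_dist A B ^+ 2.
Proof.
rewrite -[leLHS]sqr_sqrtr// ler_pXn2r// ?nnegrE ?sqrtr_ge0 ?heis_dist_ge0//.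
by rewrite heis_distE le_max lexx orbT.
Qed.

Lemma heis_dist_le A B (x : R) : 0 <= x -> enorm2 (B.1 - A.1) <= x ->
  `|zeta A B| <= x ^+ 2 -> heis_dist A B <= x.
Proof.
move=> x0 h v; rewrite heis_distE ge_max h/=.
by rewrite -(ler_pXn2r (ltn0Sn 1)) ?nnegrE ?sqrtr_ge0// sqr_sqrtr.
Qed.

(** The defect [2 |b - a| |c - b|] of [zeta] is absorbed exactly by the double product in the square
    of the sum of the two distances. *)
Lemma heis_dist_triangle B A C : heis_dist A C <= heis_dist A B + heis_dist B C.
Proof.
have hAB := heis_dist_hor A B; have hBC := heis_dist_hor B C.
have vAB := heis_dist_ver A B; have vBC := heis_dist_ver B C.
have p := heis_dist_ge0 A B; have q := heis_dist_ge0 B C.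
apply: heis_dist_le; first by rewrite addr_ge0.
  have -> : C.1 - A.1 = (B.1 - A.1) + (C.1 - B.1) by rewrite [RHS]addrC subrKA.
  by rewrite (le_trans (enorm2D _ _))// lerD.
have -> : zeta A C = (zeta A C - zeta A B - zeta B C) + (zeta A B + zeta B C) by ring.
rewrite (le_trans (ler_normD _ _))// (le_trans (lerD (zeta_split_le A B C) (ler_normD _ _)))//.
have : enorm2 (B.1 - A.1) * enorm2 (C.1 - B.1) <= heis_dist A B * heis_dist B C.
  by rewrite ler_pM ?enorm2_ge0.
lra.
Qed.

Lemma heis_dist_eq0 A B : heis_dist A B <= 0 -> A = B.
Proof.
move=> d0; have := le_trans (heis_dist_hor A B) d0 => /enorm2_eq0 e.
have := heis_dist_ver A B; have -> : heis_dist A B = 0 by apply/eqP; rewrite eq_le d0 heis_dist_ge0.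
rewrite expr0n /= normr_le0 /zeta => /eqP.
have -> : B.1 = A.1 by apply/eqP; rewrite -subr_eq0 e.
have -> : wedge A.1 A.1 = 0 by rewrite /wedge; ring.
rewrite mulr0 addr0 => /eqP; rewrite subr_eq0 => /eqP.
move/eqP: e; rewrite subr_eq0; case: A B {d0} => [a z] [b w] /= /eqP -> -> //.
Qed.

Lemma heis_dist_mul_hor A (u : R * R) : heis_dist A (heis_mul A (u, 0)) = enorm2 u.
Proof.
apply/eqP; rewrite eq_le; apply/andP; split.
  apply: heis_dist_le; rewrite ?enorm2_ge0//; first by rewrite heis_mul_fst addrC addKr.
  by rewrite zeta_mul normr0 sqr_ge0.
by rewrite (le_trans _ (heis_dist_hor _ _))// heis_mul_fst addrC addKr.
Qed.

Lemma heis_distxx A : heis_dist A A = 0.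
Proof.
apply/eqP; rewrite eq_le heis_dist_ge0 andbT heis_dist_le// ?subrr ?enorm20//.
by rewrite /zeta /wedge subrr mulrC (mulrC A.1.2) subrr mul0r addr0 normr0 expr0n.
Qed.

End HeisenbergMetric.

(** * Inequalities for real powers *)

Section RealPowers.
Context {R : realType}.
Implicit Types (a x y : R).

Lemma powR1D a x : 0 < a -> 0 <= x -> x `^ (1 + a) = x * x `^ a.
Proof.
move=> a0 x0; rewrite powRD ?powRr1//.
by rewrite gt_eqF// ltr_pwDl// ltW.
Qed.

Lemma powR_half_mul a x : 0 < a -> 0 <= x ->
  x `^ ((1 + a) / 2) * x `^ ((1 + a) / 2) = x `^ (1 + a).
Proof.
move=> a0 x0; rewrite -powRD; first by rewrite -splitr.
by rewrite gt_eqF// -splitr ltr_pwDl// ltW.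
Qed.

Lemma le_powR a x y : 0 <= a -> 0 <= x -> x <= y -> x `^ a <= y `^ a.
Proof.
by move=> a0 x0 xy; apply: ge0_ler_powR; rewrite ?nnegrE// (le_trans x0).
Qed.

Lemma lt_powR a x y : 0 < a -> 0 <= x -> x < y -> x `^ a < y `^ a.
Proof.
by move=> a0 x0 xy; apply: gt0_ltr_powR; rewrite ?nnegrE// (le_trans x0)// ltW.
Qed.

Lemma powR_lt1 a x : 0 < a -> 0 <= x -> x < 1 -> x `^ a < 1.
Proof. move=> a0 x0 x1; have <- : (1 : R) `^ a = 1 by rewrite powR1.
exact: lt_powR. Qed.

Lemma powRMl_le (k b x : R) : 1 <= k -> 0 <= b -> b <= 1 -> 0 <= x ->
  (k * x) `^ b <= k * x `^ b.
Proof.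
move=> k1 b0 b1 x0; have k0 : 0 <= k by rewrite (le_trans ler01).
rewrite powRM// ler_wpM2r ?powR_ge0//.
by rewrite -[leRHS]powRr1// ler_powR.
Qed.

Lemma powR_small a (k e : R) : 0 < a -> 0 <= k -> 0 < e ->
  exists2 d : R, 0 < d & forall x, 0 <= x -> x <= d -> k * x `^ a <= e.
Proof.
move=> a0 k0 e0; have k1 : 0 < k + 1 by rewrite ltr_wpDl.
exists ((e / (k + 1)) `^ a^-1); first by rewrite powR_gt0// divr_gt0.
move=> x x0 xd; rewrite (@le_trans _ _ ((k + 1) * x `^ a))//.
  by rewrite ler_wpM2r ?powR_ge0// lerDl.
rewrite mulrC -ler_pdivlMr// (le_trans (le_powR (ltW a0) x0 xd))//.
by rewrite -powRrM mulVf ?gt_eqF// powRr1// ltW// divr_gt0.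
Qed.

(** In [x * x]^ a[the second factor is at most](2 / 3) [^ a] times the power of the total. This
    gain, strictly below one, is what makes the sewing recursion contract. *)
Lemma powR1D_split a x y : 0 < a -> 0 <= x -> 0 <= y ->
  x <= 2 / 3 * (x + y) -> y <= 2 / 3 * (x + y) ->
  x `^ (1 + a) + y `^ (1 + a) <= (2 / 3) `^ a * (x + y) `^ (1 + a).
Proof.
move=> a0 x0 y0 hx hy.
have s0 : 0 <= x + y by rewrite addr_ge0.
have t0 : (0 : R) <= 2 / 3 by lra.
rewrite !powR1D//.
have -> : (2 / 3) `^ a * ((x + y) * (x + y) `^ a) =
  x * (2 / 3 * (x + y)) `^ a + y * (2 / 3 * (x + y)) `^ a.
  by rewrite (powRM _ t0 s0); ring.
by rewrite lerD// ler_wpM2l// le_powR// ltW.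
Qed.

End RealPowers.

(** * Sewing chains of points *)

Section DiscreteSewing.
Context {R : realType}.

Definition sewing_cst (a C : R) : R := 2 * C ^+ 2 / (1 - (2 / 3) `^ a).

Lemma sewing_cst_denom (a : R) : 0 < a -> 0 < 1 - (2 / 3 : R) `^ a.
Proof. by move=> a0; rewrite subr_gt0 powR_lt1//; lra. Qed.

Lemma sewing_cst_ge0 (a C : R) : 0 < a -> 0 <= sewing_cst a C.
Proof.
by move=> a0; apply: divr_ge0; [rewrite mulr_ge0// sqr_ge0|exact/ltW/sewing_cst_denom].
Qed.

(* Cutting a chain in the middle costs [2 C^2 (m h)^(1+a)] by [zeta_split_le], which the constant absorbs
   because [x^(1+a) + y^(1+a)] is at most [(2/3)^a (x+y)^(1+a)]. *)
Lemma discrete_sewing (a s h C : R) (n m0 : nat) (A : nat -> heis R) :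
  0 < a -> 0 <= h -> 0 <= C ->
  (forall k, (k < n)%N -> zeta (A k) (A k.+1) = s * h) ->
  (forall i m, (0 < m < m0)%N -> (i + m <= n)%N ->
     enorm2 ((A (i + m)%N).1 - (A i).1) <= C * (m%:R * h) `^ ((1 + a) / 2)) ->
  forall m i, (0 < m <= m0)%N -> (i + m <= n)%N ->
    `|zeta (A i) (A (i + m)%N) - s * (m%:R * h)| <= sewing_cst a C * (m%:R * h) `^ (1 + a).
Proof.
move=> a0 h0 C0 step hor; set K := sewing_cst a C.
have K0 : 0 <= K by exact: sewing_cst_ge0.
(* Both halves of a piece are strictly shorter than it, so horizontal bounds below [m0] control
   [zeta] up to [m0] included. [chain_hor] lives on this lead of one step. *)
elim/ltn_ind => m IH i /andP[m_gt0 mm0] imn.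
have [m1|m2] : m = 1%N \/ (1 < m)%N by case: m m_gt0 {IH mm0 imn} => [|[|m]]//; [left|right].
  have i_n : (i < n)%N by lia.
  rewrite m1 addn1 mul1r step// subrr normr0.
  by rewrite mulr_ge0// powR_ge0.
(* The most unequal splitting is 3 = 1 + 2, which is where the proportion 2/3 comes from. *)
pose u := (m./2)%N; pose v := (m - u)%N.
have mE := odd_double_half m; rewrite -/u -muln2 in mE.
have uv : (u + v = m)%N by rewrite /v; lia.
have u0 : (0 < u)%N by rewrite /u half_gt0.
have u3 : (3 * u <= 2 * m)%N.
  by lia.
have v3 : (3 * v <= 2 * m)%N.
  by move: uv mE m2; case: (odd m) => /=; clear; lia.
have um : (u < m)%N by lia.
have vm : (v < m)%N by lia.
have v0 : (0 < v)%N by lia.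
have u_m0 : (0 < u <= m0)%N by lia.
have v_m0 : (0 < v <= m0)%N by lia.
have u_lt : (0 < u < m0)%N by lia.
have v_lt : (0 < v < m0)%N by lia.
have iu_n : (i + u <= n)%N by lia.
have iuv_n : (i + u + v <= n)%N by lia.
have mE' : m%:R = u%:R + v%:R :> R by rewrite -natrD uv.
set x := u%:R * h; set y := v%:R * h.
have xyE : m%:R * h = x + y by rewrite mE' mulrDl.
have x0 : 0 <= x by rewrite mulr_ge0.
have y0 : 0 <= y by rewrite mulr_ge0.
have hx : x <= 2 / 3 * (x + y).
  have : x * 3 <= (x + y) * 2.
    by rewrite -xyE /x -mulrAC -[leRHS]mulrAC ler_wpM2r// -!natrM ler_nat mulnC (mulnC m).
  lra.
have hy : y <= 2 / 3 * (x + y).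
  have : y * 3 <= (x + y) * 2.
    by rewrite -xyE /y -mulrAC -[leRHS]mulrAC ler_wpM2r// -!natrM ler_nat mulnC (mulnC m).
  lra.
have b0 : 0 <= (1 + a) / 2 by rewrite divr_ge0// addr_ge0// ltW.
have iuv : (i + m = (i + u) + v)%N by rewrite -addnA uv.
have Hu : `|zeta (A i) (A (i + u)%N) - s * x| <= K * x `^ (1 + a).
  exact: IH.
have Hv : `|zeta (A (i + u)%N) (A (i + m)%N) - s * y| <= K * y `^ (1 + a).
  by rewrite iuv; exact: IH.
have Hs : `|zeta (A i) (A (i + m)%N) - zeta (A i) (A (i + u)%N) - zeta (A (i + u)%N) (A (i + m)%N)| <= 2 * C ^+ 2 * (x + y) `^ (1 + a).
  rewrite (le_trans (zeta_split_le _ _ _))// -mulrA ler_pM2l ?ltr0n//.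
  have h1 : enorm2 ((A (i + u)%N).1 - (A i).1) <= C * (x + y) `^ ((1 + a) / 2).
    apply: (le_trans (hor _ _ _ _)) => //.
    by rewrite ler_wpM2l// le_powR// lerDl.
  have h2 : enorm2 ((A (i + m)%N).1 - (A (i + u)%N).1) <= C * (x + y) `^ ((1 + a) / 2).
    rewrite iuv; apply: (le_trans (hor _ _ _ _)) => //.
    by rewrite ler_wpM2l// le_powR// lerDr.
  apply: (le_trans (ler_pM (enorm2_ge0 _) (enorm2_ge0 _) h1 h2)).
  by rewrite mulrACA powR_half_mul ?addr_ge0.
have HK : K * x `^ (1 + a) + K * y `^ (1 + a) + 2 * C ^+ 2 * (x + y) `^ (1 + a) <= K * (x + y) `^ (1 + a).
  rewrite -mulrDr.
  apply: (@le_trans _ _ (K * ((2 / 3) `^ a * (x + y) `^ (1 + a)) + 2 * C ^+ 2 * (x + y) `^ (1 + a))).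
    by rewrite lerD2r ler_wpM2l// powR1D_split.
  have -> : 2 * C ^+ 2 = K * (1 - (2 / 3) `^ a).
    by rewrite /K /sewing_cst divfK// gt_eqF// sewing_cst_denom.
  rewrite le_eqVlt; apply/orP; left; apply/eqP; ring.
rewrite xyE; apply: le_trans HK.
have -> : zeta (A i) (A (i + m)%N) - s * (x + y) =
 (zeta (A i) (A (i + u)%N) - s * x) + (zeta (A (i + u)%N) (A (i + m)%N) - s * y) +
 (zeta (A i) (A (i + m)%N) - zeta (A i) (A (i + u)%N) - zeta (A (i + u)%N) (A (i + m)%N)) by ring.
apply: (le_trans (ler_normD _ _)); apply: lerD => //.
by apply: (le_trans (ler_normD _ _)); apply: lerD.
Qed.

End DiscreteSewing.

(** * Limits of chains along an ultrafilter *)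

Section Ultralimits.
Context {R : realType}.

(** Every bounded real sequence converges along one and the same ultrafilter. A whole curve or
    function can thus be obtained as a pointwise limit in one stroke, with no diagonal extraction
    and no proof of ordinary convergence. *)
Lemma nat_ultrafilter : exists U : set_system nat,
  UltraFilter U /\ (forall P, (\forall n \near \oo, P n) -> U P).
Proof.
have [U [UU sub]] := ultraFilterLemma (@eventually_filter).
by exists U; split=> // P; exact: sub.
Qed.

Lemma natSinv_small (e : R) : 0 < e -> \forall n \near \oo, n.+1%:R^-1 <= e.
Proof.
by move=> e0; apply: filterS (near_infty_natSinv_lt (PosNum e0)) => n /ltW.
Qed.

Lemma ultra_bounded_cvg (U : set_system nat) (UU : UltraFilter U) (u : nat -> R) (M : R) :
  (forall n, `|u n| <= M) -> exists l : R, u n @[n --> U] --> l.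
Proof.
move=> uM; pose G := u @ U.
have GI : G `[- M, M]%classic.
  apply: (@filterE _ U) => n /=; rewrite in_itv/=.
  by have := uM n; rewrite ler_norml.
have PG : ProperFilter G by exact: fmap_proper_filter.
have [l [_ cl]] := @segment_compact R (- M) M G PG GI.
exists l => V Vl; have [//|UC] := in_ultra_setVsetC (u @^-1` V) UU.
have := cl (~` V) V UC Vl; by case=> x [].
Qed.

Lemma cvg_heis {T} {F : set_system T} {FF : Filter F} (x y z : T -> R) (a b c : R) :
  x t @[t --> F] --> a -> y t @[t --> F] --> b -> z t @[t --> F] --> c ->
  (x t, y t, z t) @[t --> F] --> ((a, b, c) : heis R).
Proof.
move=> xa yb zc.
exact: (@cvg_pair _ _ _ F (nbhs (a, b)) (nbhs c) _ _ _ _ _ (@cvg_pair _ _ _ F (nbhs a) (nbhs b) _ _ _ _ _ xa yb) zc).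
Qed.

Lemma ultra_bounded_cvg_heis (U : set_system nat) (UU : UltraFilter U)
    (A : nat -> heis R) (M : R) :
  (forall n, enorm2 (A n).1 <= M) -> (forall n, `|(A n).2| <= M) ->
  exists B : heis R, A n @[n --> U] --> B.
Proof.
move=> hM vM.
have [x Hx] := ultra_bounded_cvg UU (fun n => le_trans (enorm2_ge1 _) (hM n)).
have [y Hy] := ultra_bounded_cvg UU (fun n => le_trans (enorm2_ge2 _) (hM n)).
have [z Hz] := ultra_bounded_cvg UU vM.
exists (x, y, z).
have -> : A = (fun n => ((A n).1.1, (A n).1.2, (A n).2)).
  by apply/funext => n; case: (A n) => [[]].
exact: cvg_heis.
Qed.

Section Limits.
Context {T : Type} {F : set_system T} {FF : Filter F}.

Lemma cvg_fst2 {V W : topologicalType} (f : T -> V * W) (l : V * W) :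
  f t @[t --> F] --> l -> (f t).1 @[t --> F] --> l.1.
Proof. move=> h; exact: (cvg_comp _ _ h (@cvg_fst _ _ _ _ _)). Qed.

Lemma cvg_snd2 {V W : topologicalType} (f : T -> V * W) (l : V * W) :
  f t @[t --> F] --> l -> (f t).2 @[t --> F] --> l.2.
Proof. move=> h; exact: (cvg_comp _ _ h (@cvg_snd _ _ _ _ _)). Qed.

Lemma cvg_enorm2 (f : T -> R * R) (v : R * R) :
  f t @[t --> F] --> v -> enorm2 (f t) @[t --> F] --> enorm2 v.
Proof.
move=> h; rewrite /enorm2.
apply: (@continuous_cvg _ _ _ _ _ _ (@Num.sqrt R)); first exact: sqrt_continuous.
under eq_fun do rewrite !expr2; rewrite !expr2.
have h1 := cvg_fst2 h; have h2 := cvg_snd2 h.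
exact: cvgD (cvgM h1 h1) (cvgM h2 h2).
Qed.

Lemma cvg_zeta (f g : T -> heis R) (A B : heis R) :
  f t @[t --> F] --> A -> g t @[t --> F] --> B ->
  zeta (f t) (g t) @[t --> F] --> zeta A B.
Proof.
move=> fA gB.
have f1 := cvg_fst2 fA; have g1 := cvg_fst2 gB.
have wedge_cvg := cvgB (cvgM (cvg_fst2 f1) (cvg_snd2 g1)) (cvgM (cvg_snd2 f1) (cvg_fst2 g1)).
rewrite /zeta /wedge; apply: cvgD; last by apply: cvgM; [exact: cvg_cst|exact: wedge_cvg].
exact: cvgB (cvg_snd2 gB) (cvg_snd2 fA).
Qed.

Lemma cvg_plane (f : T -> R * R) (l : R * R) :
  (forall e, 0 < e -> \forall x \near F, enorm2 (f x - l) <= e) -> f x @[x --> F] --> l.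
Proof.
move=> H.
have h1 (g : T -> R) (k : R) : (forall x, `|k - g x| <= enorm2 (f x - l)) -> g x @[x --> F] --> k.
  move=> gl; apply/cvgrPdist_le => e e0; apply: filterS (H _ e0) => x /=.
  exact: le_trans.
case: l H h1 => [x y] H h1.
have -> : f = (fun t => ((f t).1, (f t).2)) by apply/funext => t; case: (f t).
apply: (@cvg_pair _ _ _ F (nbhs x) (nbhs y)); apply: h1 => t; rewrite distrC.
  exact: (enorm2_ge1 (f t - (x, y))).
exact: (enorm2_ge2 (f t - (x, y))).
Qed.

End Limits.

(** The chain of index [N] has step [1 / (N + 1)], and time [t] is read at the integer part of
    [t (N + 1)]. Rounding lengthens an interval by at most one step, hence at most doubles it for
    large [N]; this is the source of the powers of 2. The common starting point [p] makes the chains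
    bounded. *)
Lemma chain_limit (a s C K tau : R) (p : heis R) (A : nat -> nat -> heis R) :
  0 < a -> 0 <= C -> 0 <= K -> 0 <= tau ->
  (forall N, A N 0%N = p) ->
  (forall N i m, (0 < m)%N -> (i + m)%:R / N.+1%:R <= tau ->
     enorm2 ((A N (i + m)%N).1 - (A N i).1) <= C * (m%:R / N.+1%:R) `^ ((1 + a) / 2)) ->
  (forall N i m, (0 < m)%N -> (i + m)%:R / N.+1%:R <= tau ->
     `|zeta (A N i) (A N (i + m)%N) - s * (m%:R / N.+1%:R)|
        <= K * (m%:R / N.+1%:R) `^ (1 + a)) ->
  exists (c : R -> heis R) (U : set_system nat), [/\ ProperFilter U,
    forall P, (\forall n \near \oo, P n) -> U P,
    c 0 = p,
    forall t, 0 <= t -> t <= tau ->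
      A N (Num.truncn (t * N.+1%:R)) @[N --> U] --> c t &
    forall t t', 0 <= t -> t <= t' -> t' <= tau ->
      enorm2 ((c t').1 - (c t).1) <= 2 `^ ((1 + a) / 2) * C * (t' - t) `^ ((1 + a) / 2) /\
      `|zeta (c t) (c t') - s * (t' - t)| <= 2 `^ (1 + a) * K * (t' - t) `^ (1 + a)].
Proof.
move=> a0 C0 K0 tau0 A0 Ha Hb.
have [U [UU Uoo]] := nat_ultrafilter.
have PU : ProperFilter U by exact: ultra_proper.
pose k N t := Num.truncn (t * N.+1%:R : R).
have b0 : 0 <= (1 + a) / 2 by rewrite divr_ge0// addr_ge0// ltW.
have b0' : 0 < (1 + a) / 2 by rewrite divr_gt0// addr_gt0.
have a1 : 0 <= 1 + a by rewrite addr_ge0// ltW.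
have N0 N : 0 < N.+1%:R :> R by rewrite ltr0n.
have kle N t : 0 <= t -> (k N t)%:R / N.+1%:R <= t.
  move=> t0; rewrite ler_pdivrMr//.
  by have /andP[] := truncn_itv (mulr_ge0 t0 (ltW (N0 N))).
have kgt N t : 0 <= t -> t < (k N t)%:R / N.+1%:R + N.+1%:R^-1.
  move=> t0; rewrite -[X in _ + X]mul1r -mulrDl ltr_pdivlMr//.
  by rewrite natr1; have /andP[] := truncn_itv (mulr_ge0 t0 (ltW (N0 N))).
have kmono N t t' : t <= t' -> (k N t <= k N t')%N.
  by move=> tt'; apply: le_truncn; rewrite ler_wpM2r.
pose m N t t' := (k N t' - k N t)%N.
have mE N t t' : t <= t' -> (m N t t')%:R / N.+1%:R = (k N t')%:R / N.+1%:R - (k N t)%:R / N.+1%:R.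
  by move=> tt'; rewrite natrB ?kmono// mulrBl.
have Ha' N t t' : 0 <= t -> t <= t' -> t' <= tau ->
    enorm2 ((A N (k N t')).1 - (A N (k N t)).1) <= C * ((m N t t')%:R / N.+1%:R) `^ ((1 + a) / 2).
  move=> t0 tt' t'T; have [m0|m0] := posnP (m N t t').
    have -> : k N t' = k N t.
      by apply/eqP; rewrite eqn_leq (kmono N t t' tt') andbT -subn_eq0 -/(m N t t') m0.
    by rewrite subrr enorm20 mulr_ge0// powR_ge0.
  have kE : k N t' = (k N t + m N t t')%N by rewrite subnKC// kmono.
  rewrite [in leLHS]kE; apply: Ha => //; rewrite -kE.
  by rewrite (le_trans (kle _ _ _))// (le_trans t0).
have Hb' N t t' : 0 <= t -> t <= t' -> t' <= tau ->
    `|zeta (A N (k N t)) (A N (k N t')) - s * ((m N t t')%:R / N.+1%:R)| <= K * ((m N t t')%:R / N.+1%:R) `^ (1 + a).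
  move=> t0 tt' t'T; have [m0|m0] := posnP (m N t t').
    have -> : k N t' = k N t.
      by apply/eqP; rewrite eqn_leq (kmono N t t' tt') andbT -subn_eq0 -/(m N t t') m0.
    rewrite m0 mul0r mulr0 subr0 (_ : zeta _ _ = 0); last by rewrite /zeta /wedge; ring.
    by rewrite normr0 mulr_ge0// powR_ge0.
  have kE : k N t' = (k N t + m N t t')%N by rewrite subnKC// kmono.
  rewrite [in leLHS]kE; apply: Hb => //; rewrite -kE.
  by rewrite (le_trans (kle _ _ _))// (le_trans t0).
have k0 N : k N 0 = 0%N by rewrite /k mul0r truncn0.
have mle N t t' : 0 <= t -> t <= t' -> (m N t t')%:R / N.+1%:R <= t' - t + N.+1%:R^-1.
  move=> t0 tt'; rewrite mE//.
  move: (kle N _ (le_trans t0 tt')) (kgt N _ t0).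
  set x := (k N t')%:R / _; set y := (k N t)%:R / _; set z := N.+1%:R^-1; lra.
have mge N t t' : 0 <= t -> t <= t' -> t' - t - N.+1%:R^-1 <= (m N t t')%:R / N.+1%:R.
  move=> t0 tt'; rewrite mE//.
  move: (kgt N _ (le_trans t0 tt')) (kle N _ t0).
  set x := (k N t')%:R / _; set y := (k N t)%:R / _; set z := N.+1%:R^-1; lra.
have mge0 N t t' : 0 <= (m N t t')%:R / N.+1%:R :> R by rewrite divr_ge0// ltW.
(* The range conditions stand inside the existential so that [choice] returns a total curve; outside
   [[0, tau]] any value will do. *)
have cvgA t : exists B : heis R, 0 <= t -> t <= tau -> A N (k N t) @[N --> U] --> B.
  have [/andP[t0 tT]|] := boolP ((0 <= t) && (t <= tau)); last first.
    by move=> h; exists p => t0 tT; rewrite t0 tT in h.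
  suff [M [M1 M2]] : exists M, (forall N, enorm2 (A N (k N t)).1 <= M) /\ (forall N, `|(A N (k N t)).2| <= M).
    by have [B HB] := ultra_bounded_cvg_heis UU M1 M2; exists B.
  have mt N : (m N 0 t)%:R / N.+1%:R <= t by rewrite /m k0 subn0; exact: kle.
  have h1 N : enorm2 ((A N (k N t)).1 - p.1) <= C * t `^ ((1 + a) / 2).
    have := Ha' N _ _ (lexx 0) t0 tT; rewrite k0 A0 => /le_trans; apply.
    by rewrite ler_wpM2l// le_powR.
  have h2 N : `|zeta p (A N (k N t))| <= `|s| * t + K * t `^ (1 + a).
    have := Hb' N _ _ (lexx 0) t0 tT; rewrite k0 A0 => h.
    rewrite -(subrK (s * ((m N 0 t)%:R / N.+1%:R)) (zeta _ _)) addrC (le_trans (ler_normD _ _))// lerD//.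
      by rewrite normrM ler_wpM2l// ger0_norm.
    by rewrite (le_trans h)// ler_wpM2l// le_powR.
  pose M1 := enorm2 p.1 + C * t `^ ((1 + a) / 2).
  have h3 N : enorm2 (A N (k N t)).1 <= M1.
    by rewrite -(subrK p.1 (A N (k N t)).1) addrC (le_trans (enorm2D _ _))// lerD2l.
  pose M2 := `|s| * t + K * t `^ (1 + a) + `|p.2| + 2 * (enorm2 p.1 * M1).
  exists (Num.max M1 M2); split => N; first by rewrite le_max h3.
  rewrite le_max; apply/orP; right.
  have -> : (A N (k N t)).2 = zeta p (A N (k N t)) + p.2 - 2 * wedge p.1 (A N (k N t)).1.
    by rewrite /zeta; ring.
  rewrite (le_trans (ler_normB _ _))// lerD//.
    by rewrite (le_trans (ler_normD _ _))// lerD.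
  rewrite normrM ger0_norm// ler_pM2l ?ltr0n// (le_trans (wedge_le _ _))//.
  by rewrite ler_wpM2l// enorm2_ge0.
have [c Hc] := choice cvgA.
exists c, U; split => //.
- have h := Hc 0 (lexx 0) tau0.
  have h' : A N (k N 0) @[N --> U] --> p.
    by under eq_fun do rewrite k0 A0; exact: cvg_cst.
  exact: (cvg_unique _ h h').
- move=> t t' t0 tt' t'T.
  have ct := Hc t t0 (le_trans tt' t'T); have ct' := Hc t' (le_trans t0 tt') t'T.
  move: tt'; rewrite le_eqVlt => /predU1P[->|tt'].
    rewrite !subrr enorm20 (_ : zeta _ _ = 0); last by rewrite /zeta /wedge; ring.
    by rewrite mulr0 subr0 normr0; split; rewrite mulr_ge0// ?powR_ge0// mulr_ge0// powR_ge0.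
  have near_inv (e : R) : 0 < e -> U [set N | N.+1%:R^-1 <= e].
    by move=> e0; apply: Uoo; exact: natSinv_small.
  have d0 : 0 < t' - t by rewrite subr_gt0.
  have m2 N : N.+1%:R^-1 <= t' - t -> (m N t t')%:R / N.+1%:R <= 2 * (t' - t).
    by move=> h; rewrite (le_trans (mle _ _ _ t0 (ltW tt')))//; move: h; set z := N.+1%:R^-1; lra.
  split.
    have lim : enorm2 ((A N (k N t')).1 - (A N (k N t)).1) @[N --> U] --> enorm2 ((c t').1 - (c t).1).
      by apply: cvg_enorm2; apply: cvgB; apply: cvg_fst2.
    apply: (cvgr_to_le lim); apply: filterS (near_inv _ d0) => N /= hN.
    rewrite (le_trans (Ha' _ _ _ t0 (ltW tt') t'T))//.
    rewrite mulrAC -(powRM _ (ler0n _ 2) (ltW d0)) mulrC.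
    by rewrite ler_wpM2r// le_powR// m2.
  have lim : `|zeta (A N (k N t)) (A N (k N t')) - s * (t' - t)| @[N --> U] --> `|zeta (c t) (c t') - s * (t' - t)|.
    by apply: cvg_norm; apply: cvgB; [exact: cvg_zeta|exact: cvg_cst].
  apply/ler_addgt0Pr => e e0; apply: (cvgr_to_le lim).
  have e1 : 0 < e / (`|s| + 1) by rewrite divr_gt0// ltr_wpDl.
  apply: filterS2 (near_inv _ d0) (near_inv _ e1) => N /= hN hN'.
  rewrite -(subrKA (s * ((m N t t')%:R / N.+1%:R))) (le_trans (ler_normD _ _))// lerD//.
    rewrite (le_trans (Hb' _ _ _ t0 (ltW tt') t'T))//.
    rewrite mulrAC -(powRM _ (ler0n _ 2) (ltW d0)) mulrC.
    by rewrite ler_wpM2r// le_powR// m2.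
  rewrite -mulrBr normrM (@le_trans _ _ ((`|s| + 1) * N.+1%:R^-1))//.
    apply: ler_pM => //; first by rewrite lerDl.
    rewrite ler_norml; move: (mle N _ _ t0 (ltW tt')) (mge N _ _ t0 (ltW tt')).
    set x := (m N t t')%:R / _; set z := N.+1%:R^-1; lra.
  by rewrite mulrC -ler_pdivlMr// ltr_wpDl.
Qed.

End Ultralimits.

(** * Topology of the distance, and curves parametrized by height *)

Section HeisTopology.
Context {R : realType}.

Lemma zetaxx (A : heis R) : zeta A A = 0.
Proof. by rewrite /zeta /wedge; ring. Qed.

(** The distance is not Lipschitz equivalent to the Euclidean one, but it induces the same topology:
    the vertical coordinate is a continuous function of [zeta A] and of the horizontal part. *)
Lemma cvg_heis_distP {T} {F : set_system T} {FF : Filter F} (f : T -> heis R) (A : heis R) :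
  f x @[x --> F] --> A <-> (forall e, 0 < e -> \forall x \near F, heis_dist A (f x) <= e).
Proof.
split=> [fA e e0|H].
  have h1 : enorm2 ((f x).1 - A.1) @[x --> F] --> 0.
    rewrite -[X in _ --> X](enorm20 (R := R)) -[in X in _ --> X](subrr A.1).
    by apply: cvg_enorm2; apply: cvgB; [exact: cvg_fst2|exact: cvg_cst].
  have h2 : zeta A (f x) @[x --> F] --> 0.
    by rewrite -[X in _ --> X](zetaxx A); apply: cvg_zeta => //; exact: cvg_cst.
  have e2 : 0 < e ^+ 2 by rewrite exprn_gt0.
  move/cvgrPdist_le : h1 => /(_ _ e0) h1; move/cvgrPdist_le : h2 => /(_ _ e2) h2.
  apply: filterS2 h1 h2 => x /=; rewrite !sub0r !normrN => h1 h2.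
  by apply: heis_dist_le; [exact: ltW|rewrite (le_trans (ler_norm _))|].
have h0 : (f x).1 @[x --> F] --> A.1.
  apply: cvg_plane => e e0; apply: filterS (H _ e0) => x /=.
  exact: le_trans (heis_dist_hor _ _).
have h1 : zeta A (f x) @[x --> F] --> (0 : R).
  apply/cvgrPdist_le => e e0.
  have s0 : 0 < Num.sqrt e by rewrite sqrtr_gt0.
  apply: filterS (H _ s0) => x /= hx; rewrite sub0r normrN.
  rewrite (le_trans (heis_dist_ver _ _))// -[leRHS](sqr_sqrtr (ltW e0)).
  by rewrite ler_pXn2r// ?nnegrE ?heis_dist_ge0// ltW.
have h2 : (f x).2 @[x --> F] --> A.2.
  have -> : (fun x => (f x).2) = (fun x => zeta A (f x) + A.2 - 2 * (A.1.1 * (f x).1.2 - A.1.2 * (f x).1.1)).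
    by apply/funext => x; rewrite /zeta /wedge; ring.
  rewrite -[X in _ --> X](_ : 0 + A.2 - 2 * (A.1.1 * A.1.2 - A.1.2 * A.1.1) = _); last by ring.
  apply: cvgB; first by apply: cvgD => //; exact: cvg_cst.
  apply: cvgM; first exact: cvg_cst.
  by apply: cvgB; apply: cvgM; (try exact: cvg_cst); [exact: cvg_snd2 h0|exact: cvg_fst2 h0].
have -> : f = (fun t => ((f t).1, (f t).2)) by apply/funext => t; case: (f t).
case: A h0 h2 {H h1} => [a z] h0 h2.
exact: (@cvg_pair _ _ _ F (nbhs a) (nbhs z)).
Qed.

Lemma nbhs_heis_dist (p : heis R) (e : R) : 0 < e -> nbhs p [set B | heis_dist p B <= e].
Proof.
by move=> e0; have /cvg_heis_distP/(_ _ e0) : (fun B : heis R => B) @ nbhs p --> p by exact: cvg_id.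
Qed.

(** The notion common to both directions: the parameter is the height climbed, up to an error of
    order [1 + a], which vanishes under subdivision. Equality cannot be asked for, since [zeta] is
    not additive. *)
Definition vcurve (a C lo hi : R) (c : R -> heis R) := forall t t',
  lo <= t -> t <= t' -> t' <= hi ->
  enorm2 ((c t').1 - (c t).1) <= C * (t' - t) `^ ((1 + a) / 2) /\
  `|zeta (c t) (c t') - (t' - t)| <= C * (t' - t) `^ (1 + a).

Lemma vcurve_sub (a C lo hi lo' hi' : R) c : lo <= lo' -> hi' <= hi ->
  vcurve a C lo hi c -> vcurve a C lo' hi' c.
Proof. by move=> l h v t t' lt tt' th; apply: v => //; [exact: le_trans lt|exact: le_trans h]. Qed.

Lemma vcurve_dist_small (a C lo hi : R) c : 0 < a -> 0 <= C -> vcurve a C lo hi c ->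
  forall e, 0 < e -> exists2 d, 0 < d & forall t t', lo <= t -> t <= hi -> lo <= t' -> t' <= hi ->
    `|t' - t| <= d -> heis_dist (c t) (c t') <= e.
Proof.
move=> a0 C0 v e e0.
have b0 : 0 < (1 + a) / 2 by rewrite divr_gt0// addr_gt0.
have a1 : 0 < 1 + a by rewrite addr_gt0.
have e3 : 0 < e ^+ 2 / 2 by rewrite divr_gt0// exprn_gt0.
have [d1 d10 H1] := powR_small b0 C0 e0.
have [d2 d20 H2] := powR_small a1 C0 e3.
exists (Num.min d1 (Num.min d2 (e ^+ 2 / 2))); first by rewrite !lt_min d10 d20.
suff main t t' : lo <= t -> t <= t' -> t' <= hi ->
    `|t' - t| <= Num.min d1 (Num.min d2 (e ^+ 2 / 2)) -> heis_dist (c t) (c t') <= e.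
  move=> t t' lt th lt' th' h; have [tt'|/ltW tt'] := leP t t'; first exact: main.
  by rewrite heis_distC; apply: main => //; rewrite distrC.
move=> lt tt' th; rewrite ger0_norm ?subr_ge0// !le_min => /and3P[hd1 hd2 hd3].
have [h1 h2] := v t t' lt tt' th; have d0 : 0 <= t' - t by rewrite subr_ge0.
apply: heis_dist_le; first exact: ltW.
  by rewrite (le_trans h1)// H1.
have h3 := le_trans h2 (H2 _ d0 hd2).
move: h3; rewrite !ler_norml; lra.
Qed.

Lemma heis_unif_continuous (lo hi : R) (c : R -> heis R) :
  (forall e, 0 < e -> exists2 d, 0 < d & forall t t', lo <= t -> t <= hi -> lo <= t' -> t' <= hi ->
    `|t' - t| <= d -> heis_dist (c t) (c t') <= e) ->
  {within `[lo, hi], continuous c}.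
Proof.
move=> unif; apply/subspace_continuousP => t; rewrite /= in_itv/= => /andP[lt th].
suff : c @ within `[lo, hi]%classic (nbhs t) --> c t by [].
apply/cvg_heis_distP => e /unif[d d0 H].
rewrite near_withinE; have : nbhs t [set t' | `|t - t'| < d] by exists d.
apply: filterS => t' /= h; rewrite in_itv/= => /andP[lt' th'].
by apply: H => //; rewrite distrC ltW.
Qed.

Lemma vcurve_continuous (a C lo hi : R) c : 0 < a -> 0 <= C -> vcurve a C lo hi c ->
  {within `[lo, hi], continuous c}.
Proof.
by move=> a0 C0 v; apply: heis_unif_continuous; exact: vcurve_dist_small a0 C0 v.
Qed.

End HeisTopology.

(** * Level sets near a regular point *)

Section LocalCurve.
Context {R : realType}.

(* In the paper's setting [Phi] is [F] composed with the inverse of the horizontal differential at [p]. *)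
Definition straight_near (a r C : R) (Phi : heis R -> R * R) (p : heis R) :=
  forall A B, heis_dist p A <= r -> enorm2 (B.1 - A.1) <= r ->
    enorm2 (Phi B - Phi A - (B.1 - A.1)) <=
      4^-1 * enorm2 (B.1 - A.1) + C * `|zeta A B| `^ ((1 + a) / 2).

Variables (a r C : R) (Phi : heis R -> R * R) (p : heis R).
Hypotheses (a0 : 0 < a) (a1 : a < 1) (r0 : 0 < r) (C0 : 0 <= C).
Hypothesis Phi_straight : straight_near a r C Phi p.
Hypothesis Phi_p : Phi p = 0.

Local Notation beta := ((1 + a) / 2).

Let b0 : 0 < beta. Proof. by rewrite divr_gt0// addr_gt0. Qed.
Let b1 : beta <= 1. Proof. by move: a1; lra. Qed.

(** A quarter of the displacement is absorbed in the left-hand side, whence the factor 4/3. The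
    tolerance [e] serves the almost-zeros of the chains; with [e = 0] and [zeta A B = 0] it
    identifies two points of the level set. *)
Lemma straight_hor_le A B (e : R) : heis_dist p A <= r -> enorm2 (B.1 - A.1) <= r ->
  enorm2 (Phi A) <= e -> enorm2 (Phi B) <= e ->
  enorm2 (B.1 - A.1) <= 4 / 3 * (2 * e + C * `|zeta A B| `^ beta).
Proof.
move=> pA dAB eA eB; have := Phi_straight pA dAB.
have : enorm2 (B.1 - A.1) <= enorm2 (Phi B - Phi A) + enorm2 (Phi B - Phi A - (B.1 - A.1)).
  rewrite -[X in enorm2 X <= _](subKr (Phi B - Phi A)); exact: enorm2B.
have := enorm2B (Phi B) (Phi A); lra.
Qed.

Section Chain.
Variables (s tau h : R).
Hypothesis s1 : `|s| = 1.
Hypothesis h0 : 0 < h.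
(** In [chain_hor] the two values of [Phi] contribute [2 C] and the vertical term another [2 C];
    multiplied by 4/3 this is [16 / 3 C], rounded up to [6 C]. *)
Let C1 : R := 6 * C.
Let K : R := sewing_cst a C1.
Hypothesis tau0 : 0 < tau.
(** [tauK] keeps the sewing error below the length that it corrects; [tauC] and [taur] bound the
    horizontal and the vertical drift of a chain well inside the ball where [Phi] is straight. *)
Hypothesis tauK : K * tau `^ a <= 1.
Hypothesis tauC : C1 * tau `^ beta <= r / 8.
Hypothesis taur : 2 * tau <= (r / 8) ^+ 2.

Let C10 : 0 <= C1. Proof. by rewrite mulr_ge0. Qed.
Let K0 : 0 <= K. Proof. exact: sewing_cst_ge0. Qed.

Lemma chain_zeta_le (x z : R) : 0 <= x -> x <= tau ->
  `|z - s * x| <= K * x `^ (1 + a) -> `|z| <= 2 * x.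
Proof.
move=> x0 xt hz.
have : `|z| <= `|z - s * x| + `|s * x|.
  by rewrite -{1}(subrK (s * x) z) ler_normD.
rewrite normrM s1 mul1r (ger0_norm x0).
have : K * x `^ (1 + a) <= x.
  rewrite powR1D// mulrCA -[leRHS]mulr1 ler_wpM2l// (le_trans _ tauK)//.
  by rewrite ler_wpM2l// le_powR// ltW.
move: hz; lra.
Qed.

(** The bootstrap: for pieces of length [m], the horizontal bounds already known for shorter pieces
    control [zeta] by sewing, and straightness turns this control into the horizontal bound at
    length [m]. The constant does not deteriorate, because straightness depends on [zeta] and not on
    the previous horizontal bounds. *)
Lemma chain_hor (n : nat) (A : nat -> heis R) : n%:R * h <= tau ->
  (forall k, (k <= n)%N -> heis_dist p (A k) <= r / 2) ->
  (forall k, (k <= n)%N -> enorm2 (Phi (A k)) <= C * h `^ beta) ->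
  (forall k, (k < n)%N -> zeta (A k) (A k.+1) = s * h) ->
  forall m i, (0 < m)%N -> (i + m <= n)%N ->
    enorm2 ((A (i + m)%N).1 - (A i).1) <= C1 * (m%:R * h) `^ beta.
Proof.
move=> nh near_p small step; elim/ltn_ind => m IH i m_gt0 imn.
have hm : `|zeta (A i) (A (i + m)%N) - s * (m%:R * h)| <= K * (m%:R * h) `^ (1 + a).
  apply: (@discrete_sewing _ a s h C1 n m A) => //; first exact: ltW.
    by move=> j k /andP[k_gt0 km] jkn; exact: IH.
  by rewrite m_gt0 leqnn.
set x := m%:R * h in hm *.
have hx : h <= x.
  by rewrite /x ler_peMl ?ler1n// ltW.
have x0 : 0 <= x by rewrite (le_trans _ hx)// ltW.
have xt : x <= tau.
  rewrite (le_trans _ nh)// (ler_wpM2r (ltW h0))// ler_nat.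
  by rewrite (leq_trans _ imn)// leq_addl.
have z2 := chain_zeta_le x0 xt hm.
have iN : (i <= n)%N by rewrite (leq_trans _ imn)// leq_addr.
have pi := near_p _ iN; have pj := near_p _ imn.
have d : enorm2 ((A (i + m)%N).1 - (A i).1) <= r.
  rewrite (le_trans (heis_dist_hor _ _))// (le_trans (heis_dist_triangle p _ _))//.
  by rewrite heis_distC (splitr r) lerD.
have pi' : heis_dist p (A i) <= r by rewrite (le_trans pi)//; move: r0; lra.
have := straight_hor_le pi' d (small _ iN) (small _ imn).
have : C * `|zeta (A i) (A (i + m)%N)| `^ beta <= 2 * (C * x `^ beta).
  rewrite mulrCA ler_wpM2l// (le_trans (le_powR (ltW b0) _ z2))//.
  by apply: powRMl_le => //; [lra|exact: ltW].
have : C * h `^ beta <= C * x `^ beta.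
  by rewrite ler_wpM2l// le_powR// ltW.
have : 0 <= C * x `^ beta by rewrite mulr_ge0// powR_ge0.
have -> : C1 * x `^ beta = 6 * (C * x `^ beta) by rewrite /C1 mulrA.
set y := C * x `^ beta; lra.
Qed.

(* A vertical displacement followed by one Newton step: this order makes [zeta A (step A)] equal to [s * h]
   exactly, and the Newton step keeps [Phi] of size [h `^ beta] along the whole chain. *)
Let lift A : heis R := heis_mul A (0, s * h).
Let step A : heis R := heis_mul (lift A) (- Phi (lift A), 0).
Let A k := iter k step p.

Let htau : h <= tau -> h <= (r / 8) ^+ 2.
Proof. by move: taur tau0; lra. Qed.

(** The vertical move at most doubles the bound on [Phi]. The Newton step has [zeta] zero, so
    straightness leaves a quarter of its length: the new bound is half of the old one, within the
    invariant. The radii add up as [r / 4 + r / 8 + r / 8]. *)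
Lemma chain_step B : h <= tau -> heis_dist p B <= r / 4 -> enorm2 (Phi B) <= C * h `^ beta ->
  [/\ zeta B (step B) = s * h, heis_dist p (step B) <= r / 2 &
      enorm2 (Phi (step B)) <= C * h `^ beta].
Proof.
move=> ht pB PB.
have l1 : (lift B).1 - B.1 = 0 by rewrite heis_mul_fst addr0 subrr.
have zl : zeta B (lift B) = s * h by rewrite zeta_mul.
have zh : `|zeta B (lift B)| = h by rewrite zl normrM s1 mul1r gtr0_norm.
have dl : heis_dist B (lift B) <= r / 8.
  apply: heis_dist_le; rewrite ?l1 ?enorm20 ?zh ?htau//; move: r0; lra.
have pl : heis_dist p (lift B) <= r.
  rewrite (le_trans (heis_dist_triangle B _ _))//; move: pB dl r0; lra.
have hb : h `^ beta <= tau `^ beta by rewrite le_powR// ltW.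
have Phl : enorm2 (Phi (lift B)) <= 2 * (C * h `^ beta).
  have := @Phi_straight B (lift B); rewrite l1 enorm20 subr0 mulr0 add0r zh => H.
  have {}H : enorm2 (Phi (lift B) - Phi B) <= C * h `^ beta.
    by apply: H; move: pB r0; lra.
  rewrite -(subrK (Phi B) (Phi (lift B))) (le_trans (enorm2D _ _))//; move: H PB; lra.
have Chb : 6 * (C * h `^ beta) <= r / 8.
  by rewrite (le_trans _ tauC)// mulrA ler_wpM2l.
have Chb0 : 0 <= C * h `^ beta by rewrite mulr_ge0// powR_ge0.
have s2 : (step B).1 - (lift B).1 = - Phi (lift B) by rewrite heis_mul_fst addrC addKr.
have zs : zeta (lift B) (step B) = 0 by rewrite zeta_mul.
have ns : enorm2 (- Phi (lift B)) <= 2 * (C * h `^ beta) by rewrite enorm2N.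
have ds : heis_dist (lift B) (step B) <= r / 8.
  apply: heis_dist_le; rewrite ?s2 ?zs ?normr0 ?sqr_ge0//; move: r0 ns Chb Chb0; lra.
split.
- by rewrite (zeta_split _ (lift B)) zl zs l1 /wedge /=; ring.
- rewrite (le_trans (heis_dist_triangle B _ _))// (le_trans (lerD (lexx _) (heis_dist_triangle (lift B) _ _)))//.
  move: pB dl ds; lra.
- have := @Phi_straight (lift B) (step B); rewrite s2 zs normr0 powR0 ?gt_eqF// mulr0 addr0 opprK subrK => H.
  have {}H := H pl; rewrite (le_trans (H _))//; move: ns Chb Chb0 r0; lra.
Qed.

(** One step loses half of the radius, from [r / 4] to [r / 2], and could not be iterated by itself.
    The weaker radius is enough for [chain_hor], whose estimate over the whole chain from [p] brings
    the new point back within [r / 4]. *)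
Lemma chain_near (n : nat) : n%:R * h <= tau -> forall k, (k <= n)%N ->
  [/\ heis_dist p (A k) <= r / 4, enorm2 (Phi (A k)) <= C * h `^ beta &
      (k < n)%N -> zeta (A k) (A k.+1) = s * h].
Proof.
elim: n => [_ [|//] _|n IH nh].
  by rewrite /A /= heis_distxx Phi_p enorm20; split => //; [move: r0; lra|rewrite mulr_ge0// powR_ge0].
have ht : h <= tau by rewrite (le_trans _ nh)// -[leLHS]mul1r (ler_wpM2r (ltW h0))// ler1n.
have nh' : n%:R * h <= tau.
  by rewrite (le_trans _ nh)// (ler_wpM2r (ltW h0))// ler_nat.
have {}IH := IH nh'.
have [IH1 IH2 _] := IH n (leqnn n).
have [z1 p1 P1] := chain_step ht IH1 IH2.
have zn k : (k < n.+1)%N -> zeta (A k) (A k.+1) = s * h.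
  rewrite ltnS leq_eqVlt => /predU1P[->//|kn].
  by have [_ _ ->] := IH k (ltnW kn).
have Pk k : (k <= n.+1)%N -> enorm2 (Phi (A k)) <= C * h `^ beta.
  rewrite leq_eqVlt => /predU1P[->//|]; rewrite ltnS => kn; by have [] := IH k kn.
have pk k : (k <= n.+1)%N -> heis_dist p (A k) <= r / 2.
  rewrite leq_eqVlt => /predU1P[->//|]; rewrite ltnS => kn.
  by have [h1 _ _] := IH k kn; rewrite (le_trans h1)//; move: r0; lra.
have hor := chain_hor nh pk Pk zn.
have x0 : 0 <= n.+1%:R * h by rewrite mulr_ge0// ltW.
have far : heis_dist p (A n.+1) <= r / 4.
  apply: heis_dist_le; first by move: r0; lra.
    have := hor n.+1 0%N isT (leqnn _); rewrite add0n => /le_trans; apply.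
    rewrite (@le_trans _ _ (C1 * tau `^ beta))//; last by move: r0 tauC; lra.
    by rewrite ler_wpM2l// le_powR// ltW.
  have /(chain_zeta_le x0 nh) : `|zeta (A 0%N) (A (0 + n.+1)%N) - s * (n.+1%:R * h)| <= K * (n.+1%:R * h) `^ (1 + a).
    apply: (@discrete_sewing _ a s h C1 n.+1 n.+1 A) => //; first exact: ltW.
      by move=> i m /andP[m0 _]; exact: hor.
    by rewrite leqnn.
  move=> h1; rewrite (le_trans h1)// (@le_trans _ _ (2 * tau))//; first by rewrite ler_pM2l.
  by rewrite (le_trans taur)// !expr2; move: r0; nra.
move=> k kn; split; [|exact: Pk|exact: zn].
move: kn; rewrite leq_eqVlt => /predU1P[->//|]; rewrite ltnS => kn; by have [] := IH k kn.
Qed.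

Lemma chain_exists : exists A : nat -> heis R, A 0%N = p /\ forall n, n%:R * h <= tau ->
  enorm2 (Phi (A n)) <= C * h `^ beta /\
  forall i m, (0 < m)%N -> (i + m)%N = n ->
    enorm2 ((A n).1 - (A i).1) <= C1 * (m%:R * h) `^ beta /\
    `|zeta (A i) (A n) - s * (m%:R * h)| <= K * (m%:R * h) `^ (1 + a).
Proof.
exists A; split=> // n nh; have H := chain_near nh.
split=> [|i m m0 imn]; first by have [] := H n (leqnn n).
have pk k : (k <= n)%N -> heis_dist p (A k) <= r / 2.
  by move=> kn; have [h1 _ _] := H k kn; rewrite (le_trans h1)//; move: r0; lra.
have Pk k : (k <= n)%N -> enorm2 (Phi (A k)) <= C * h `^ beta.
  by move=> kn; have [] := H k kn.
have zn k : (k < n)%N -> zeta (A k) (A k.+1) = s * h.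
  by move=> kn; have [_ _ ->] := H k (ltnW kn).
have hor := chain_hor nh pk Pk zn.
have imn' : (i + m <= n)%N by rewrite imn.
rewrite -imn; split; first exact: hor.
apply: (@discrete_sewing _ a s h C1 n m A) => //; first exact: ltW.
  by move=> j k /andP[k0 _]; exact: hor.
by rewrite m0 leqnn.
Qed.

End Chain.

End LocalCurve.

(** * Sign of [zeta] along a curve, and gluing of half curves *)

Section VcurveLemmas.
Context {R : realType}.
Implicit Types (c : R -> heis R).

(** On a short interval [zeta (c t) (c t')] therefore has the sign and the size of [t' - t].
    Injectivity, the sign changes and the comparison of [heis_dist] with the parameter all rest on
    this. *)
Lemma vcurve_zeta_half (a C lo hi : R) c : 0 < a -> 0 <= C ->
  C * (hi - lo) `^ a <= 2^-1 -> vcurve a C lo hi c ->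
  forall t t', lo <= t -> t <= t' -> t' <= hi ->
    `|zeta (c t) (c t') - (t' - t)| <= (t' - t) / 2.
Proof.
move=> a0 C0 Ch v t t' lt tt' th; have [_ h] := v t t' lt tt' th.
have d0 : 0 <= t' - t by rewrite subr_ge0.
rewrite (le_trans h)// powR1D// mulrCA ler_wpM2l// (le_trans _ Ch)//.
by rewrite ler_wpM2l// le_powR// ?lerB// ltW.
Qed.

Lemma vcurve_zeta_continuous (a C lo hi : R) c B : 0 < a -> 0 <= C -> vcurve a C lo hi c ->
  {within `[lo, hi], continuous (fun t => zeta (c t) B)}.
Proof.
move=> a0 C0 v; have := vcurve_continuous a0 C0 v.
move=> /subspace_continuousP cc; apply/subspace_continuousP => t tI.
suff : zeta (c u) B @[u --> within `[lo, hi]%classic (nbhs t)] --> zeta (c t) B by [].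
by apply: cvg_zeta; [exact: cc|exact: cvg_cst].
Qed.

(** Across the junction the errors of the two halves add up to [2 C], and the defect of additivity
    of [zeta] at the common point adds [2 C ^+ 2]. *)
Lemma vcurve_glue (a C hi : R) (cp cm : R -> heis R) : 0 < a -> 0 <= C ->
  cp 0 = cm 0 ->
  (forall t t', 0 <= t -> t <= t' -> t' <= hi ->
     enorm2 ((cp t').1 - (cp t).1) <= C * (t' - t) `^ ((1 + a) / 2) /\
     `|zeta (cp t) (cp t') - 1 * (t' - t)| <= C * (t' - t) `^ (1 + a)) ->
  (forall t t', 0 <= t -> t <= t' -> t' <= hi ->
     enorm2 ((cm t').1 - (cm t).1) <= C * (t' - t) `^ ((1 + a) / 2) /\
     `|zeta (cm t) (cm t') - -1 * (t' - t)| <= C * (t' - t) `^ (1 + a)) ->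
  vcurve a (2 * C + 2 * C ^+ 2) (- hi) hi (fun t => if 0 <= t then cp t else cm (- t)).
Proof.
move=> a0 C0 c0 Hp Hm t t' lt tt' th.
have b0 : 0 <= (1 + a) / 2 by rewrite divr_ge0// addr_ge0// ltW.
have a1 : 0 <= 1 + a by rewrite addr_ge0// ltW.
have CC : C <= 2 * C + 2 * C ^+ 2 by have := sqr_ge0 C; move: C0; lra.
have wk (x y : R) : 0 <= y -> x <= C * y -> x <= (2 * C + 2 * C ^+ 2) * y.
  by move=> y0 /le_trans; apply; rewrite ler_wpM2r.
case: (leP 0 t) => [t0|t0]; case: (leP 0 t') => [t0'|t0'].
- have [h1 h2] := Hp t t' t0 tt' th; rewrite mul1r in h2.
  by split; apply: wk => //; exact: powR_ge0.
- by have := le_lt_trans (le_trans t0 tt') t0'; rewrite ltxx.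
- have nt : 0 <= - t by rewrite oppr_ge0 ltW.
  have nth : - t <= hi by rewrite lerNl.
  have hi0 : 0 <= hi by exact: le_trans nth.
  have [h1 h2] := Hp 0 t' (lexx 0) t0' th.
  have [h3 h4] := Hm 0 (- t) (lexx 0) nt nth.
  rewrite c0 !subr0 in h1 h2; rewrite !subr0 in h3 h4.
  have tle : - t <= t' - t by rewrite lerDr.
  have t'le : t' <= t' - t by rewrite lerDl.
  have tt0 : 0 <= t' - t by rewrite subr_ge0.
  set q := cm 0 in h1 h2 h3 h4; set A := cm (- t) in h3 h4 *; set B := cp t' in h1 h2 *.
  have k1 : enorm2 (B.1 - q.1) <= C * (t' - t) `^ ((1 + a) / 2).
    by rewrite (le_trans h1)// ler_wpM2l// le_powR.
  have k3 : enorm2 (q.1 - A.1) <= C * (t' - t) `^ ((1 + a) / 2).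
    by rewrite enorm2_subC (le_trans h3)// ler_wpM2l// le_powR.
  have C2 : 0 <= C ^+ 2 by exact: sqr_ge0.
  split.
    rewrite -(subrKA q.1) (le_trans (enorm2D _ _))//.
    have := powR_ge0 (t' - t) ((1 + a) / 2); move: k1 k3.
    set x := (_ `^ _) => k1 k3 x0; rewrite mulrDl.
    have : 0 <= 2 * C ^+ 2 * x by rewrite mulr_ge0// mulr_ge0.
    move: k1 k3; lra.
  have k2 : `|zeta q B - t'| <= C * (t' - t) `^ (1 + a).
    by move: h2; rewrite mul1r => h2; rewrite (le_trans h2)// ler_wpM2l// le_powR.
  have k4 : `|zeta A q + t| <= C * (t' - t) `^ (1 + a).
    have -> : zeta A q + t = - (zeta q A - -1 * - t) by rewrite (zetaC A q); ring.
    by rewrite normrN (le_trans h4)// ler_wpM2l// le_powR.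
  have k5 : `|zeta A B - zeta A q - zeta q B| <= 2 * C ^+ 2 * (t' - t) `^ (1 + a).
    rewrite (le_trans (zeta_split_le _ _ _))// -mulrA ler_pM2l ?ltr0n//.
    rewrite (le_trans (ler_pM (enorm2_ge0 _) (enorm2_ge0 _) k3 k1))//.
    by rewrite mulrACA powR_half_mul.
  have -> : zeta A B - (t' - t) = (zeta A B - zeta A q - zeta q B) + ((zeta q B - t') + (zeta A q + t)) by ring.
  rewrite (le_trans (ler_normD _ _))// (le_trans (lerD k5 (ler_normD _ _)))//.
  rewrite (le_trans (lerD (lexx _) (lerD k2 k4)))// le_eqVlt; apply/orP; left; apply/eqP; ring.
- have nt' : 0 <= - t' by rewrite oppr_ge0 ltW.
  have ntt : - t' <= - t by rewrite lerN2.
  have nth : - t <= hi by rewrite lerNl.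
  have [h1 h2] := Hm (- t') (- t) nt' ntt nth.
  have e : - t - - t' = t' - t by ring.
  rewrite e in h1 h2; split; apply: wk; rewrite ?powR_ge0//; first by rewrite enorm2_subC.
  have -> : zeta (cm (- t)) (cm (- t')) - (t' - t) = - (zeta (cm (- t')) (cm (- t)) - -1 * (t' - t)).
    by rewrite (zetaC (cm (- t'))); ring.
  by rewrite normrN.
Qed.

End VcurveLemmas.

Section LocalCurve.
Context {R : realType}.
Variables (a r C : R) (Phi : heis R -> R * R) (p : heis R).
Hypotheses (a0 : 0 < a) (a1 : a < 1) (r0 : 0 < r) (C0 : 0 <= C).
Hypothesis Phi_straight : straight_near a r C Phi p.
Hypothesis Phi_p : Phi p = 0.
Hypothesis Phi_cont : continuous Phi.

Local Notation beta := ((1 + a) / 2).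

Let b0 : 0 < beta. Proof. by rewrite divr_gt0// addr_gt0. Qed.

(** [tau] and [C2] are chosen before the direction [s], so that the upward and the downward curve
    can be glued at [p]. *)
Lemma half_curve : exists tau C2 : R, [/\ 0 < tau, 0 <= C2 &
  forall s : R, `|s| = 1 -> exists c : R -> heis R, [/\ c 0 = p,
    forall t, 0 <= t -> t <= tau -> Phi (c t) = 0 &
    forall t t', 0 <= t -> t <= t' -> t' <= tau ->
     enorm2 ((c t').1 - (c t).1) <= C2 * (t' - t) `^ beta /\
     `|zeta (c t) (c t') - s * (t' - t)| <= C2 * (t' - t) `^ (1 + a)]].
Proof.
pose C1 := 6 * C; pose K := sewing_cst a C1.
have C10 : 0 <= C1 by rewrite mulr_ge0.
have K0 : 0 <= K by exact: sewing_cst_ge0.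
have r8 : 0 < r / 8 by rewrite divr_gt0.
have [d1 d10 H1] := powR_small a0 K0 ltr01; have [d2 d20 H2] := powR_small b0 C10 r8.
pose tau := Num.min d1 (Num.min d2 ((r / 8) ^+ 2 / 2)).
have tau0 : 0 < tau by rewrite !lt_min d10 d20/= divr_gt0// exprn_gt0// divr_gt0.
have tauK : K * tau `^ a <= 1.
  by apply: H1; [exact: ltW|rewrite ge_min lexx].
have tauC : C1 * tau `^ beta <= r / 8.
  by apply: H2; [exact: ltW|rewrite /tau minCA ge_min lexx].
have taur : 2 * tau <= (r / 8) ^+ 2.
  rewrite mulrC -ler_pdivlMr ?ltr0n//.
  by rewrite /tau minA ge_min lexx orbT.
exists tau, (2 `^ beta * C1 + 2 `^ (1 + a) * K); split => //.
  by rewrite addr_ge0// mulr_ge0// powR_ge0.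
move=> s s1.
have N0 N : 0 < N.+1%:R^-1 :> R by rewrite invr_gt0.
have [A HA] := choice (fun N => chain_exists a0 a1 r0 C0 Phi_straight Phi_p s1 (N0 N) tau0 tauK tauC taur).
have [c [U [PU Uoo c0 Ac Hc]]] := @chain_limit R a s C1 K tau p A a0 C10 K0 (ltW tau0)
  (fun N => (HA N).1)
  (fun N i m m0 im => (((HA N).2 (i + m)%N im).2 i m m0 erefl).1)
  (fun N i m m0 im => (((HA N).2 (i + m)%N im).2 i m m0 erefl).2).
exists c; split => //.
  move=> t t0 tt; have lim := Ac t t0 tt.
  have lim' : enorm2 (Phi (A N (Num.truncn (t * N.+1%:R)))) @[N --> U] --> enorm2 (Phi (c t)).
    apply: cvg_enorm2; apply: (@continuous_cvg _ _ _ _ _ _ Phi) => //; exact: Phi_cont.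
  apply: enorm2_eq0; apply/ler_addgt0Pr => e e0; rewrite add0r.
  apply: (cvgr_to_le lim').
  have [d d0 Hd] := powR_small b0 C0 e0.
  apply: filterS (Uoo _ (natSinv_small d0)) => N /= hN.
  have kt : (Num.truncn (t * N.+1%:R))%:R / N.+1%:R <= tau.
    rewrite (le_trans _ tt)// ler_pdivrMr//.
    by have /andP[] := truncn_itv (mulr_ge0 t0 (ler0n R N.+1)).
  have [h _] := (HA N).2 _ kt.
  by rewrite (le_trans h)//; apply: Hd => //; exact: ltW.
move=> t t' t0 tt' t'T; have [h1 h2] := Hc t t' t0 tt' t'T; split.
  by rewrite (le_trans h1)// ler_wpM2r ?powR_ge0// lerDl mulr_ge0// powR_ge0.
by rewrite (le_trans h2)// ler_wpM2r ?powR_ge0// lerDr mulr_ge0// powR_ge0.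
Qed.

Theorem local_curve : exists (tau C2 : R) (c : R -> heis R), [/\
  0 < tau /\ 0 <= C2, c 0 = p /\ vcurve a C2 (- tau) tau c,
  forall t, - tau <= t -> t <= tau -> Phi (c t) = 0,
  forall t t', - tau <= t -> t <= t' -> t' <= tau ->
    `|zeta (c t) (c t') - (t' - t)| <= (t' - t) / 2 &
  exists2 e : R, 0 < e & forall B, heis_dist p B <= e -> Phi B = 0 ->
    exists t, [/\ - tau <= t, t <= tau & c t = B]].
Proof.
have [tau1 [C1 [tau10 C10 H]]] := half_curve.
have [cp [cp0 Pp Hp]] := H 1 (normr1 _).
have [cm [cm0 Pm Hm]] := H (-1) (normrN1 _).
pose c t := if 0 <= t then cp t else cm (- t).
pose C2 := 2 * C1 + 2 * C1 ^+ 2.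
have C20 : 0 <= C2 by rewrite addr_ge0// mulr_ge0// sqr_ge0.
have vc : vcurve a C2 (- tau1) tau1 c by apply: vcurve_glue => //; rewrite cp0 cm0.
have c0 : c 0 = p by rewrite /c lexx.
have Pc t : - tau1 <= t -> t <= tau1 -> Phi (c t) = 0.
  move=> lt th; rewrite /c; case: leP => t0; first exact: Pp.
  by apply: Pm; [rewrite oppr_ge0 ltW|rewrite lerNl].
have r2 : 0 < r / 2 by rewrite divr_gt0.
have [d d0 Hd] := vcurve_dist_small a0 C20 vc r2.
have e2 : 0 < 2^-1 :> R by rewrite invr_gt0.
have [d' d'0 Hd'] := powR_small a0 C20 e2.
pose tau := Num.min tau1 (Num.min d (d' / 2)).
have tau0 : 0 < tau by rewrite !lt_min tau10 d0 divr_gt0.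
have tt1 : tau <= tau1 by rewrite ge_min lexx.
have td : tau <= d by rewrite /tau minCA ge_min lexx.
have td' : tau <= d' / 2 by rewrite /tau minA ge_min lexx orbT.
have vc' : vcurve a C2 (- tau) tau c by apply: vcurve_sub vc => //; rewrite lerN2.
have small : C2 * (tau - - tau) `^ a <= 2^-1.
  by apply: Hd'; move: td' tau0; lra.
have half := vcurve_zeta_half a0 C20 small vc'.
have near_p t : - tau <= t -> t <= tau -> heis_dist p (c t) <= r / 2.
  move=> lt th; rewrite -c0; apply: Hd; rewrite ?(le_trans _ tt1)//.
  - by rewrite oppr_le0 ltW.
  - exact: ltW.
  - by rewrite (le_trans _ lt)// lerN2.
  - by rewrite subr0 ler_norml (le_trans th td) andbT (le_trans _ lt)// lerN2.
exists tau, C2, c; split => //.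
  by move=> t lt th; apply: Pc; [rewrite (le_trans _ lt)// lerN2|exact: le_trans tt1].
(* [r / 2] keeps [B] within [r] of the curve, and 1 gives [e ^+ 2 <= e]. The last bound makes
   [|zeta p B|] plus the defect [r * e] at most [tau / 4], while [zeta] between [p] and either end
   of the curve is at least [tau / 2] in size: the signs at the two ends are forced. *)
pose e := Num.min (r / 2) (Num.min 1 (tau / (4 * (1 + r)))).
have r1 : 0 < 1 + r by rewrite addr_gt0.
have e0 : 0 < e by rewrite !lt_min r2 ltr01 divr_gt0// mulr_gt0.
have er : e <= r / 2 by rewrite ge_min lexx.
have el1 : e <= 1 by rewrite /e minCA ge_min lexx.
have et : e * (1 + r) <= tau / 4.
  have : e <= tau / (4 * (1 + r)) by rewrite /e minA ge_min lexx orbT.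
  by rewrite invfM mulrA ler_pdivlMr.
exists e => // B pB PB.
have nt : - tau <= tau by move: tau0; lra.
have zpB : `|zeta p B| <= e.
  rewrite (le_trans (heis_dist_ver _ _))// (@le_trans _ _ (e ^+ 2))//.
    by rewrite ler_pXn2r// nnegrE ?heis_dist_ge0// ltW.
  by rewrite expr2 -[leRHS]mulr1 ler_wpM2l// ltW.
have split_le t : - tau <= t -> t <= tau ->
    `|zeta (c t) B - zeta (c t) p - zeta p B| <= r * e.
  move=> lt th; rewrite (le_trans (zeta_split_le _ _ _))//.
  have h1 := le_trans (heis_dist_hor _ _) (near_p _ lt th).
  have h2 := le_trans (heis_dist_hor _ _) pB.
  rewrite enorm2_subC in h1.
  have := ler_pM (enorm2_ge0 _) (enorm2_ge0 _) h1 h2; set x := _ * _; lra.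
have hi_lt : zeta (c tau) B <= 0.
  have := split_le _ nt (lexx _).
  have := half 0 tau; rewrite c0 subr0 oppr_le0 (ltW tau0) => /(_ isT isT (lexx _)).
  rewrite (zetaC p) !ler_norml; move: zpB et; rewrite ler_norml; move: tau0; lra.
have lo_gt : 0 <= zeta (c (- tau)) B.
  have := split_le _ (lexx _) nt.
  have := half (- tau) 0; rewrite c0 sub0r opprK oppr_le0 (ltW tau0) => /(_ (lexx _) isT isT).
  rewrite !ler_norml; move: zpB et; rewrite ler_norml; move: tau0; lra.
have [|t] := IVT nt (vcurve_zeta_continuous (B := B) a0 C20 vc') (v := 0).
  by rewrite ge_min le_max hi_lt lo_gt orbT.
rewrite in_itv/= => /andP[lt th] zt; exists t; split => //.
have pct := near_p t lt th.
have pct' : heis_dist p (c t) <= r by rewrite (le_trans pct)//; move: r0; lra.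
have dB : enorm2 (B.1 - (c t).1) <= r.
  rewrite (le_trans (heis_dist_hor _ _))// (le_trans (heis_dist_triangle p _ _))//.
  by rewrite heis_distC (splitr r) lerD// (le_trans pB).
have Pct : Phi (c t) = 0 by apply: Pc; [rewrite (le_trans _ lt)// lerN2|exact: le_trans tt1].
have := @straight_hor_le R a r C Phi p Phi_straight (c t) B 0 pct' dB.
rewrite Pct PB enorm20 zt normr0 powR0 ?gt_eqF// !mulr0 addr0 mulr0 => /(_ (lexx _) (lexx _)) h.
apply: heis_dist_eq0; apply: heis_dist_le => //.
by rewrite zt normr0 expr0n.
Qed.

End LocalCurve.

(** * Taylor formula for maps with Hoelder horizontal differential *)

Section HorizontalHom.
Context {R : realType}.
Implicit Types (L : heis R -> R * R).

Lemma scale_pairE (k : R) (v : R * R) : k *: v = (k * v.1, k * v.2).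
Proof. by []. Qed.

(** On the vertical axis additivity gives [L (0, 0, 4 z) = 4 L (0, 0, z)], whereas the dilation of
    factor 2 gives [2 L (0, 0, z)]; so [L] vanishes there. *)
Lemma hom_fst L : horizontal_hom L -> forall A, L A = L (A.1, 0).
Proof.
move=> [_ LM Ldil].
have vert z : L (0, 0, z) = 0.
  have add x y : L (0, 0, x + y) = L (0, 0, x) + L (0, 0, y).
    by rewrite -LM; congr (L _); rewrite /heis_mul /=; congr (_, _, _); ring.
  have h4 : L (0, 0, 2 ^+ 2 * z) = 2 *: L (0, 0, z).
    by rewrite -Ldil ?ltr0n//; congr (L _); rewrite /heis_dil /= mulr0.
  have : L (0, 0, 2 ^+ 2 * z) = L (0, 0, z) + L (0, 0, z) + (L (0, 0, z) + L (0, 0, z)).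
    by rewrite -!add; congr (L (_, _, _)); ring.
  rewrite h4 scaler_nat mulr2n => /eqP; rewrite -subr_eq0 opprD addrA subrr add0r.
  rewrite oppr_eq0 -mulr2n -scaler_nat scaler_eq0 pnatr_eq0/= => /eqP //.
move=> A; have {1}-> : A = heis_mul (A.1, 0) (0, 0, A.2).
  case: A => [[x y] z]; rewrite /heis_mul /=; congr (_, _, _); ring.
by rewrite LM vert addr0.
Qed.

Lemma hom_horD L : horizontal_hom L -> forall u v : R * R, L (u + v, 0) = L (u, 0) + L (v, 0).
Proof.
by move=> hL u v; have [_ LM _] := hL; rewrite -LM [RHS](hom_fst hL).
Qed.

Lemma hom_hor0 L : horizontal_hom L -> L (0 : R * R, 0) = 0.
Proof.
move=> hL; have := hom_horD hL 0 0; rewrite addr0 => /eqP.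
by rewrite -subr_eq0 opprD addrA subrr add0r oppr_eq0 => /eqP.
Qed.

Lemma hom_horN L : horizontal_hom L -> forall u : R * R, L (- u, 0) = - L (u, 0).
Proof.
by move=> hL u; apply/eqP; rewrite -subr_eq0 opprK -hom_horD// addNr hom_hor0.
Qed.

Lemma hom_horZ L : horizontal_hom L -> forall k (u : R * R), L (k *: u, 0) = k *: L (u, 0).
Proof.
move=> hL; have [_ _ Ldil] := hL.
have pos k (u : R * R) : 0 < k -> L (k *: u, 0) = k *: L (u, 0).
  move=> k0; rewrite -Ldil//; congr (L _); rewrite /heis_dil /= mulr0.
  by case: u.
move=> k u; have [k0|k0|->] := ltgtP k 0; last by rewrite !scale0r hom_hor0.
  have nk : 0 < - k by rewrite oppr_gt0.
  by rewrite -[in LHS](opprK k) scaleNr hom_horN// pos// scaleNr opprK.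
exact: pos.
Qed.

Lemma hom_hor_basis L : horizontal_hom L -> forall u : R * R,
  L (u, 0) = u.1 *: L (1, 0, 0) + u.2 *: L (0, 1, 0).
Proof.
move=> hL u; rewrite -!hom_horZ// -hom_horD//; congr (L (_, _)).
case: u => x y; rewrite -[RHS]/(x * 1 + y * 0, x * 0 + y * 1).
by rewrite !mulr1 !mulr0 addr0 add0r.
Qed.

Lemma hom_bound L : horizontal_hom L -> exists2 k : R, 0 <= k & forall A,
  enorm2 (L A) <= k * enorm2 A.1.
Proof.
move=> hL; exists (enorm2 (L (1, 0, 0)) + enorm2 (L (0, 1, 0))).
  by rewrite addr_ge0// enorm2_ge0.
move=> A; rewrite hom_fst// hom_hor_basis// (le_trans (enorm2D _ _))// mulrDl !enorm2Z.
by rewrite lerD// mulrC ler_wpM2l ?enorm2_ge0 ?enorm2_ge1 ?enorm2_ge2.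
Qed.

Lemma rho_hor (v : R * R) : rho_oo (v, 0) = enorm2 v.
Proof. by rewrite /rho_oo /= normr0 sqrtr0; apply/max_idPl/enorm2_ge0. Qed.

Lemma rho_ge_hor (A : heis R) : enorm2 A.1 <= rho_oo A.
Proof. by rewrite /rho_oo le_max lexx. Qed.

Lemma hom_dist_apply L1 L2 : horizontal_hom L1 -> horizontal_hom L2 ->
  forall v : R * R, enorm2 (L1 (v, 0) - L2 (v, 0)) <= hom_dist L1 L2 * enorm2 v.
Proof.
move=> h1 h2 v.
have [k1 k10 H1] := hom_bound h1; have [k2 k20 H2] := hom_bound h2.
have [/eqP v0|v0] := boolP (enorm2 v == 0).
  have -> : v = 0 by apply: enorm2_eq0; rewrite v0.
  by rewrite !hom_hor0// subrr enorm20 mulr0.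
have vp : 0 < enorm2 v by rewrite lt_neqAle eq_sym v0 enorm2_ge0.
have vE : v = enorm2 v *: ((enorm2 v)^-1 *: v) by rewrite scalerA mulfV// scale1r.
rewrite {1 2}vE !hom_horZ// -scalerBr enorm2Z gtr0_norm// mulrC ler_pM2r//.
rewrite /hom_dist /hom_norm; apply: ub_le_sup.
  exists (k1 + k2) => _ [B /= B1 <-].
  rewrite (le_trans (enorm2B _ _))// lerD//.
    by rewrite (le_trans (H1 _))// -[leRHS]mulr1 ler_wpM2l// (le_trans (rho_ge_hor _)).
  by rewrite (le_trans (H2 _))// -[leRHS]mulr1 ler_wpM2l// (le_trans (rho_ge_hor _)).
exists ((enorm2 v)^-1 *: v, 0); last by rewrite !hom_horZ// -scalerBr.
by rewrite /= rho_hor enorm2Z gtr0_norm ?invr_gt0// mulVf.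
Qed.

Lemma hom_dist_le L1 L2 (k : R) : 0 <= k -> horizontal_hom L1 -> horizontal_hom L2 ->
  (forall v : R * R, enorm2 (L1 (v, 0) - L2 (v, 0)) <= k * enorm2 v) ->
  hom_dist L1 L2 <= k.
Proof.
move=> k0 h1 h2 H; apply: ge_sup.
  exists (enorm2 (L1 (0 : heis R) - L2 0)); exists 0 => //=.
  by rewrite /rho_oo /= enorm20 normr0 sqrtr0 maxxx ler01.
move=> _ [B /= B1 <-]; rewrite (hom_fst h1) (hom_fst h2) (le_trans (H _))//.
by rewrite -[leRHS]mulr1 ler_wpM2l// (le_trans (rho_ge_hor _)).
Qed.

Lemma hom_dist_ge0 L1 L2 : horizontal_hom L1 -> horizontal_hom L2 -> 0 <= hom_dist L1 L2.
Proof.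
move=> h1 h2; have := hom_dist_apply h1 h2 (1, 0).
have -> : enorm2 ((1, 0) : R * R) = 1 by rewrite /enorm2 /= expr1n expr0n addr0 sqrtr1.
by rewrite mulr1; apply: le_trans; exact: enorm2_ge0.
Qed.

End HorizontalHom.

Section MeanValue.
Context {R : realType}.

Lemma heis_mul_hor0 (A : heis R) : heis_mul A (0 : R * R, 0) = A.
Proof.
rewrite -[(0 : R * R, 0)]/(0, 0, 0).
by case: A => [[x y] z]; rewrite /heis_mul /=; congr (_, _, _); ring.
Qed.

Lemma is_derive_of_bound (f : R -> R) (x l : R) :
  (forall e, 0 < e -> \forall h \near 0, `|f (x + h) - f x - h * l| <= e * `|h|) ->
  is_derive x 1 f l.
Proof.
move=> H.
have lim : h^-1 *: ((f \o shift x) (h *: 1) - f x) @[h --> 0^'] --> l.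
  apply/cvgrPdist_le => e e0; near=> h.
  have h0 : h != 0 by near: h; exact: nbhs_dnbhs_neq.
  have : `|f (x + h) - f x - h * l| <= e * `|h|.
    by near: h; apply: nbhs_dnbhs; exact: H.
  rewrite -ler_pdivrMr ?normr_gt0// -normfV -normrM distrC; apply: le_trans.
  rewrite le_eqVlt; apply/orP; left; apply/eqP; congr `|_|.
  rewrite /= mulrBl [h * l]mulrC mulfK// mulrC; congr (_ * (f _ - _) - _).
  by rewrite /GRing.scale/= mulr1 addrC.
apply: DeriveDef; first by apply/cvg_ex; exists l.
exact: cvg_lim lim.
Unshelve. all: by end_near. Qed.

Lemma cvg_hor0 (v : R * R) : ((h *: v, 0) : heis R) @[h --> (0 : R)] --> (0 : heis R).
Proof.
apply: (@cvg_pair _ _ _ (nbhs (0 : R)) (nbhs (0 : R * R)) (nbhs (0 : R))); last exact: cvg_cst.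
have h0 : h *: v @[h --> (0 : R)] --> (0 : R) *: v by apply: cvgZr_tmp; exact: cvg_id.
by rewrite scale0r in h0.
Qed.

Variables (F : heis R -> R * R) (D : heis R -> heis R -> R * R).
Hypothesis FD : forall A, is_hdiff F A (D A).

Let homD A : horizontal_hom (D A). Proof. by have [] := FD A. Qed.

(** The points [heis_mul A (s *: v, 0)] run along a left-invariant horizontal line, where horizontal
    differentiability is ordinary differentiability. Pairing with a fixed [w] makes the function
    scalar, and subtracting the differential at [A] leaves only its variation in the derivative. *)
Lemma is_derive_hor (w : R * R) A (v : R * R) (s : R) :
  is_derive s 1 (fun s => dot w (F (heis_mul A (s *: v, 0)) - s *: D A (v, 0)))
    (dot w (D (heis_mul A (s *: v, 0)) (v, 0) - D A (v, 0))).
Proof.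
apply: is_derive_of_bound => e e0.
set B := heis_mul A (s *: v, 0).
pose k := enorm2 w * enorm2 v + 1.
have k0 : 0 < k by rewrite ltr_wpDl// mulr_ge0// enorm2_ge0.
have ek : 0 < e / k by rewrite divr_gt0.
have [_ /(_ _ ek) HB] := FD B.
have cv : ((h *: v, 0) : heis R) @[h --> (0 : R)] --> (0 : heis R) by exact: cvg_hor0.
have := cv _ HB; rewrite nbhs_simpl/=; apply: filterS => h /=.
rewrite rho_hor enorm2Z => hB.
have e1 : heis_mul A ((s + h) *: v, 0) = heis_mul B (h *: v, 0).
  rewrite /B -heis_mulA; congr heis_mul.
  by rewrite !scale_pairE /heis_mul /=; congr (_, _, _); ring.
rewrite e1; set X := F _ in hB *; set Y := F B in hB *.
have -> : dot w (X - (s + h) *: D A (v, 0)) - dot w (Y - s *: D A (v, 0)) - h * dot w (D B (v, 0) - D A (v, 0))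
  = dot w (X - Y - D B (h *: v, 0)).
  by rewrite hom_horZ// !scale_pairE /dot /=; ring.
rewrite (le_trans (dot_le _ _))// (le_trans (ler_wpM2l (enorm2_ge0 _) hB))//.
have -> : enorm2 w * (e / k * (`|h| * enorm2 v)) = enorm2 w * enorm2 v / k * (e * `|h|) by ring.
have eh : 0 <= e * `|h| by rewrite mulr_ge0// ltW.
by apply: ler_piMl => //; rewrite ler_pdivrMr// mul1r lerDl.
Qed.

Variables (a M : R).
Hypotheses (a0 : 0 < a) (M0 : 0 <= M).
Hypothesis holdD : forall A B, hom_dist (D A) (D B) <= M * heis_dist A B `^ a.

(** The mean value theorem is applied with [w] the remainder itself: its squared norm equals a
    derivative bounded by its norm times the oscillation of the differential. *)
Lemma segment_taylor A (v : R * R) :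
  enorm2 (F (heis_mul A (v, 0)) - F A - D A (v, 0)) <= M * enorm2 v `^ (1 + a).
Proof.
set w := F _ - _ - _.
pose g s := dot w (F (heis_mul A (s *: v, 0)) - s *: D A (v, 0)).
pose g' s := dot w (D (heis_mul A (s *: v, 0)) (v, 0) - D A (v, 0)).
have dg (s : R) : is_derive s 1 g (g' s) by exact: is_derive_hor.
have [|s sI] := MVT_segment (ler01 : (0 : R) <= 1) (fun s _ => dg s).
  by apply: derivable_within_continuous => s _; have [] := dg s.
rewrite subr0 mulr1 => gE.
have {gE} wE : enorm2 w ^+ 2 = g' s.
  rewrite -gE /g !scale1r !scale0r -dotvv.
  have -> : heis_mul A (0 : R * R, 0) = A by exact: heis_mul_hor0.
  by rewrite /w /dot /=; ring.
move: sI; rewrite in_itv/= => /andP[s0 s1].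
have [w0|w0] := leP (enorm2 w) 0; first by rewrite (le_trans w0)// mulr_ge0// powR_ge0.
rewrite -(ler_pM2l w0) -expr2 wE (le_trans (ler_norm _))// (le_trans (dot_le _ _))//.
rewrite ler_wpM2l ?enorm2_ge0// (le_trans (hom_dist_apply (homD _) (homD _) _))//.
rewrite powR1D ?enorm2_ge0// mulrCA mulrC ler_wpM2l ?enorm2_ge0//.
rewrite (le_trans (holdD _ _))//; apply: ler_wpM2l => //.
apply: le_powR; [exact: ltW|exact: heis_dist_ge0|].
rewrite heis_distC; apply: heis_dist_le; rewrite ?enorm2_ge0//.
  rewrite heis_mul_fst addrC addKr enorm2Z ger0_norm//.
  by rewrite -[leRHS]mul1r ler_wpM2r ?enorm2_ge0.
by rewrite zeta_mul normr0 sqr_ge0.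
Qed.

End MeanValue.

Section Taylor.
Context {R : realType}.
Variables (F : heis R -> R * R) (D : heis R -> heis R -> R * R).
Hypothesis FD : forall A, is_hdiff F A (D A).
Variables (a M : R).
Hypotheses (a0 : 0 < a) (a1 : a < 1) (M0 : 0 <= M).
Hypothesis holdD : forall A B, hom_dist (D A) (D B) <= M * heis_dist A B `^ a.

Let homD A : horizontal_hom (D A). Proof. by have [] := FD A. Qed.

Lemma hom_diff_le A B (v : R * R) :
  enorm2 (D B (v, 0) - D A (v, 0)) <= M * heis_dist A B `^ a * enorm2 v.
Proof.
apply: (le_trans (hom_dist_apply (homD _) (homD _) _)).
by rewrite ler_wpM2r ?enorm2_ge0// heis_distC holdD.
Qed.

(** One more horizontal segment costs [M] for the expansion at [X], and [M * k] for replacing the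
    differential at [X] by the one at [A], the two points being at distance at most [k * r]. *)
Lemma taylor_step (A X : heis R) (u : R * R) (K k r : R) : 0 <= r -> 1 <= k ->
  enorm2 (F X - F A - D A (X.1 - A.1, 0)) <= K * r `^ (1 + a) ->
  heis_dist A X <= k * r -> enorm2 u <= r ->
  enorm2 (F (heis_mul X (u, 0)) - F A - D A ((heis_mul X (u, 0)).1 - A.1, 0))
     <= (K + M + M * k) * r `^ (1 + a) /\
  heis_dist A (heis_mul X (u, 0)) <= (k + 1) * r.
Proof.
move=> r0 k1 TX dX ur; split; last first.
  rewrite (le_trans (heis_dist_triangle X _ _))// mulrDl mul1r lerD//.
  by rewrite heis_dist_mul_hor.
have -> : (heis_mul X (u, 0)).1 - A.1 = (X.1 - A.1) + u by rewrite heis_mul_fst addrAC.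
rewrite hom_horD//; set Y := heis_mul _ _.
have -> : F Y - F A - (D A (X.1 - A.1, 0) + D A (u, 0)) =
   (F X - F A - D A (X.1 - A.1, 0)) + (F Y - F X - D X (u, 0)) + (D X (u, 0) - D A (u, 0)).
  by apply/eqP; rewrite -subr_eq0; apply/eqP; rewrite !opprD !opprK; move: (F X) (F Y) (F A) (D A _) (D A _) (D X _) => *;
     congr (_, _); rewrite /=; ring.
apply: (le_trans (enorm2D _ _)); rewrite mulrDl; apply: lerD.
  rewrite (le_trans (enorm2D _ _))// mulrDl lerD//.
  apply: (le_trans (segment_taylor FD a0 M0 holdD _ _)).
  rewrite ler_wpM2l// le_powR ?enorm2_ge0//.
  by rewrite addr_ge0// ltW.
apply: (le_trans (hom_diff_le _ _ _)).
rewrite powR1D// (mulrC r) mulrA; apply: ler_pM; rewrite ?enorm2_ge0// ?mulr_ge0 ?powR_ge0//.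
rewrite -mulrA ler_wpM2l//; apply: (@le_trans _ _ ((k * r) `^ a)).
  by apply: le_powR; [exact: ltW|exact: heis_dist_ge0|].
by apply: powRMl_le => //; exact: ltW.
Qed.

Lemma heis_commutator (X : heis R) (u v : R * R) :
  heis_mul (heis_mul (heis_mul (heis_mul X (u, 0)) (v, 0)) (- u, 0)) (- v, 0) =
  heis_mul X (0, 0, - (4 * wedge u v)).
Proof.
by case: X u v => [[x y] z] [u1 u2] [v1 v2]; rewrite /heis_mul /wedge /=; congr (_, _, _); ring.
Qed.

(* [B] is reached from [A] by a horizontal segment followed by a commutator of four horizontal segments,
   which climbs the height [zeta A B]. *)
Lemma heis_taylor (A B : heis R) :
  enorm2 (F B - F A - D A (B.1 - A.1, 0)) <= 15 * M * heis_dist A B `^ (1 + a).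
Proof.
set r := heis_dist A B; have r0 : 0 <= r by exact: heis_dist_ge0.
(* The commutator of two orthogonal segments of length [q] climbs [4 * q ^+ 2]; their order decides
   the sign. *)
pose q := Num.sqrt `|zeta A B| / 2.
have q0 : 0 <= q by rewrite divr_ge0.
have qr : q <= r.
  have : Num.sqrt `|zeta A B| <= r by rewrite /r heis_distE le_max lexx orbT.
  by rewrite /q; have := sqrtr_ge0 `|zeta A B|; lra.
have q4 : 4 * q ^+ 2 = `|zeta A B|.
  by rewrite /q expr_div_n sqr_sqrtr//; lra.
have [u [v [ur vr uv]]] : exists u v : R * R, [/\ enorm2 u <= r, enorm2 v <= r & - (4 * wedge u v) = zeta A B].
  have e1 : enorm2 ((q, 0) : R * R) <= r.
    by rewrite /enorm2 /= expr0n addr0 sqrtr_sqr ger0_norm.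
  have e2 : enorm2 ((0, q) : R * R) <= r.
    by rewrite /enorm2 /= expr0n add0r sqrtr_sqr ger0_norm.
  have [z0|z0] := leP 0 (zeta A B).
    have zE : zeta A B = 4 * q ^+ 2 by rewrite q4 ger0_norm.
    by exists (0, q), (q, 0); split => //; rewrite zE /wedge /=; ring.
  have zE : zeta A B = - (4 * q ^+ 2) by rewrite q4 ltr0_norm// opprK.
  by exists (q, 0), (0, q); split => //; rewrite zE /wedge /=; ring.
have BE : B = heis_mul (heis_mul A (B.1 - A.1, 0)) (0, 0, - (4 * wedge u v)).
  rewrite uv /zeta; case: A B {r r0 q q0 qr q4 u v ur vr uv} => [[x y] z] [[x' y'] z'].
  rewrite -[(x', y', z').1 - _]/(x' - x, y' - y) /heis_mul /wedge /=; congr (_, _, _); ring.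
have hr : enorm2 (B.1 - A.1) <= r by exact: heis_dist_hor.
have T0 : enorm2 (F A - F A - D A (A.1 - A.1, 0)) <= 0 * r `^ (1 + a).
  by rewrite !subrr hom_hor0// subrr enorm20 mul0r.
have T1 : enorm2 (F (heis_mul A (B.1 - A.1, 0)) - F A - D A ((heis_mul A (B.1 - A.1, 0)).1 - A.1, 0)) <= M * r `^ (1 + a).
  rewrite (_ : (heis_mul _ _).1 - A.1 = B.1 - A.1); last by rewrite heis_mul_fst addrC addKr.
  apply: (le_trans (segment_taylor FD a0 M0 holdD _ _)).
  by rewrite ler_wpM2l// le_powR ?enorm2_ge0// addr_ge0// ltW.
have d1 : heis_dist A (heis_mul A (B.1 - A.1, 0)) <= 1 * r.
  by rewrite mul1r heis_dist_mul_hor.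
have [T2 d2] := taylor_step r0 (lexx _) T1 d1 ur.
have k2 : 1 <= 1 + 1 :> R by lra.
have [T3 d3] := taylor_step r0 k2 T2 d2 vr.
have k3 : 1 <= 1 + 1 + 1 :> R by lra.
rewrite -enorm2N in ur; rewrite -enorm2N in vr.
have [T4 d4] := taylor_step r0 k3 T3 d3 ur.
have k4 : 1 <= 1 + 1 + 1 + 1 :> R by lra.
have [T5 _] := taylor_step r0 k4 T4 d4 vr.
(* Over the five segments the constant grows by [M] times 1, 2, 3, 4 and 5, which adds up to 15. *)
move: T5; rewrite heis_commutator -BE => /le_trans; apply.
by rewrite le_eqVlt; apply/orP; left; apply/eqP; ring.
Qed.

Lemma heis_taylor_continuous : continuous F.
Proof.
move=> A; apply: cvg_plane => e e0.
have [k k0 Hk] := hom_bound (homD A).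
have e2 : 0 < e / 2 by rewrite divr_gt0.
have M15 : 0 <= 15 * M by rewrite mulr_ge0.
have [d d0 Hd] := powR_small (addr_gt0 ltr01 a0) M15 e2.
have [d' d'0 Hd'] := powR_small ltr01 k0 e2.
have dm : 0 < Num.min d d' by rewrite lt_min d0.
apply: filterS (nbhs_heis_dist A dm) => B /=; rewrite le_min => /andP[dB dB'].
rewrite -(subrK (D A (B.1 - A.1, 0)) (F B - F A)) (le_trans (enorm2D _ _))// (splitr e) lerD//.
  by rewrite (le_trans (heis_taylor _ _))// Hd// heis_dist_ge0.
rewrite (le_trans (Hk _))//= -[enorm2 _]powRr1 ?enorm2_ge0// Hd' ?enorm2_ge0//.
by rewrite (le_trans (heis_dist_hor _ _)).
Qed.

End Taylor.

(** * Normalizing the horizontal differential at a regular point *)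

Section NormalForm.
Context {R : realType}.

(** Cramer's rule: the determinants are inverse to each other, so the inverse matrix is the adjugate
    divided by [d], and it commutes with the given matrix. *)
Lemma right_inverse2 (x y z t p q r s : R) :
  x * p + y * r = 1 -> x * q + y * s = 0 -> z * p + t * r = 0 -> z * q + t * s = 1 ->
  [/\ p * x + q * z = 1, p * y + q * t = 0, r * x + s * z = 0 & r * y + s * t = 1].
Proof.
move=> h1 h2 h3 h4; set d := x * t - y * z.
have dd : d * (p * s - q * r) = 1.
  have -> : d * (p * s - q * r) = (x * p + y * r) * (z * q + t * s) - (x * q + y * s) * (z * p + t * r) by rewrite /d; ring.
  by rewrite h1 h2 h3 h4; ring.
have d0 : d != 0 by apply/eqP => d0; move: dd; rewrite d0 mul0r => /eqP; rewrite eq_sym oner_eq0.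
have pd : d * p = t.
  have -> : d * p = t * (x * p + y * r) - y * (z * p + t * r) by rewrite /d; ring.
  by rewrite h1 h3; ring.
have rd : d * r = - z.
  have -> : d * r = x * (z * p + t * r) - z * (x * p + y * r) by rewrite /d; ring.
  by rewrite h1 h3; ring.
have qd : d * q = - y.
  have -> : d * q = t * (x * q + y * s) - y * (z * q + t * s) by rewrite /d; ring.
  by rewrite h2 h4; ring.
have sd : d * s = x.
  have -> : d * s = x * (z * q + t * s) - z * (x * q + y * s) by rewrite /d; ring.
  by rewrite h2 h4; ring.
by split; apply: (mulfI d0); rewrite mulrDr !mulrA ?pd ?rd ?qd ?sd /d; ring.
Qed.

Lemma hom_inverse (L : heis R -> R * R) : horizontal_hom L -> set_surj setT setT L ->
  exists b1 b2 : R * R, (forall w : R * R, L (w.1 *: b1 + w.2 *: b2, 0) = w) /\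
    forall v : R * R, (L (v, 0)).1 *: b1 + (L (v, 0)).2 *: b2 = v.
Proof.
move=> hL sL.
have [B1 _ L1] := sL (1, 0) I; have [B2 _ L2] := sL (0, 1) I.
rewrite (hom_fst hL) in L1; rewrite (hom_fst hL) in L2.
have LR (w : R * R) : L (w.1 *: B1.1 + w.2 *: B2.1, 0) = w.
  rewrite hom_horD// !hom_horZ// L1 L2; case: w => x y.
  by rewrite -[LHS]/(x * 1 + y * 0, x * 0 + y * 1) !mulr1 !mulr0 addr0 add0r.
exists B1.1, B2.1; split=> // v.
rewrite (hom_hor_basis hL) in L1; rewrite (hom_hor_basis hL) in L2.
rewrite (hom_hor_basis hL v).
move: L1 L2 {LR}; set c1 := L (1, 0, 0); set c2 := L (0, 1, 0).
move: B1.1 B2.1 c1 c2 => [p1 p2] [q1 q2] [x z] [y t] /= [h1 h2] [h3 h4].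
have [|||| k1 k2 k3 k4] := @right_inverse2 x y z t p1 q1 p2 q2.
- by rewrite mulrC (mulrC y); exact: h1.
- by rewrite mulrC (mulrC y); exact: h3.
- by rewrite mulrC (mulrC t); exact: h2.
- by rewrite mulrC (mulrC t); exact: h4.
case: v => v1 v2 /=.
rewrite -[LHS]/((v1 * x + v2 * y) * p1 + (v1 * z + v2 * t) * q1, (v1 * x + v2 * y) * p2 + (v1 * z + v2 * t) * q2).
congr (_, _).
  have -> : (v1 * x + v2 * y) * p1 + (v1 * z + v2 * t) * q1 = v1 * (p1 * x + q1 * z) + v2 * (p1 * y + q1 * t) by ring.
  by rewrite k1 k2; ring.
have -> : (v1 * x + v2 * y) * p2 + (v1 * z + v2 * t) * q2 = v1 * (p2 * x + q2 * z) + v2 * (p2 * y + q2 * t) by ring.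
by rewrite k3 k4; ring.
Qed.

Lemma Dh_hdiff (F : heis R -> R * R) A : hdifferentiable F A -> is_hdiff F A (Dh F A).
Proof. by move=> [L HL]; rewrite /Dh; apply: (@xgetPex _ _ [set L | is_hdiff F A L]); exists L. Qed.

Lemma sqrt_powR1D (a x : R) : 0 <= x -> Num.sqrt x `^ (1 + a) = x `^ ((1 + a) / 2).
Proof. by move=> x0; rewrite -powR12_sqrt// -powRrM mulrC. Qed.

(** The quarter in [straight_near] is made of two eighths, both granted by the choice of [r]. One
    pays for the variation of the differential from [p] to [A]. The other pays for the Taylor
    remainder when the horizontal displacement realizes the distance; when the vertical one does,
    the remainder is the power of [zeta]. *)
Theorem normal_form (a : R) (F : heis R -> R * R) (p : heis R) : 0 < a -> a < 1 ->
  C1H_holder a F -> set_surj setT setT (Dh F p) ->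
  exists (r C : R) (Phi : heis R -> R * R), [/\ 0 < r, 0 <= C, straight_near a r C Phi p,
    continuous Phi & forall A, Phi A = 0 <-> F A = F p].
Proof.
move=> a0 a1 [[hd _] [M0 HM0]] sp.
have FD A : is_hdiff F A (Dh F A) by exact: Dh_hdiff.
pose M := Num.max M0 0; have M_ge0 : 0 <= M by rewrite le_max lexx orbT.
have HM A B : hom_dist (Dh F A) (Dh F B) <= M * heis_dist A B `^ a.
  by rewrite (le_trans (HM0 _ _))// ler_wpM2r ?powR_ge0// le_max lexx.
have hp : horizontal_hom (Dh F p) by have [] := FD p.
have [b1 [b2 [RI LI]]] := hom_inverse hp sp.
pose S (w : R * R) := w.1 *: b1 + w.2 *: b2.
pose k := enorm2 b1 + enorm2 b2.
have k0 : 0 <= k by rewrite addr_ge0// enorm2_ge0.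
have Sk w : enorm2 (S w) <= k * enorm2 w.
  rewrite (le_trans (enorm2D _ _))// mulrDl !enorm2Z.
  by rewrite lerD// mulrC ler_wpM2l ?enorm2_ge0 ?enorm2_ge1 ?enorm2_ge2.
have SB u v : S (u - v) = S u - S v by rewrite /S /= !scalerBl opprD addrACA.
have k15 : 0 <= k * (15 * M) by rewrite mulr_ge0// mulr_ge0.
have e8 : 0 < 8^-1 :> R by rewrite invr_gt0.
have [r r0 kr] := powR_small a0 k15 e8.
exists r, (k * (15 * M)), (fun A => S (F A - F p)); split => //.
- move=> A B pA dAB.
  rewrite -SB opprB addrA subrK -{1}(LI (B.1 - A.1)) -/(S _) -SB.
  set DL := Dh F p (B.1 - A.1, 0).
  have -> : F B - F A - DL = (F B - F A - Dh F A (B.1 - A.1, 0)) + (Dh F A (B.1 - A.1, 0) - DL) by rewrite addrA subrK.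
  rewrite (le_trans (Sk _))// (le_trans (ler_wpM2l k0 (enorm2D _ _)))// mulrDr.
  have h1 := ler_wpM2l k0 (heis_taylor FD a0 a1 M_ge0 HM A B).
  have h2 := ler_wpM2l k0 (hom_diff_le FD HM p A (B.1 - A.1)).
  have h3 : k * (M * heis_dist p A `^ a * enorm2 (B.1 - A.1)) <= 8^-1 * enorm2 (B.1 - A.1).
    rewrite !mulrA ler_wpM2r ?enorm2_ge0// (le_trans _ (kr _ (heis_dist_ge0 _ _) pA))//.
    by rewrite ler_wpM2r ?powR_ge0// ler_wpM2l//; move: M_ge0; lra.
  have h4 : k * (15 * M) * heis_dist A B `^ (1 + a) <=
     8^-1 * enorm2 (B.1 - A.1) + k * (15 * M) * `|zeta A B| `^ ((1 + a) / 2).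
    rewrite heis_distE; case: (leP (enorm2 (B.1 - A.1)) (Num.sqrt `|zeta A B|)) => _.
      by rewrite sqrt_powR1D// lerDr mulr_ge0// enorm2_ge0.
    rewrite powR1D ?enorm2_ge0// mulrCA mulrC.
    rewrite (@le_trans _ _ (8^-1 * enorm2 (B.1 - A.1)))//.
      by rewrite ler_wpM2r ?enorm2_ge0// kr ?enorm2_ge0.
    by rewrite lerDl mulr_ge0// powR_ge0.
  by move: h1 h2 h3 h4; lra.
- move=> A; have FA : F B @[B --> A] --> F A by exact: (heis_taylor_continuous FD a0 a1 M_ge0 HM).
  have h : F B - F p @[B --> A] --> F A - F p by apply: cvgB => //; exact: cvg_cst.
  by apply: cvgD; apply: cvgZr_tmp; [exact: cvg_fst2 h|exact: cvg_snd2 h].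
- move=> A; split => [SA|->]; last by rewrite subrr /S /= !scale0r addr0.
  have := RI (F A - F p); rewrite -/(S _) SA hom_hor0// => /esym/eqP.
  by rewrite subr_eq0 => /eqP.
Qed.

End NormalForm.

(** * Area integrals and level curves *)

Section Area.
Context {R : realType}.

Lemma uniform_partition (t d : R) : 0 < t -> 0 < d ->
  exists2 s, itv_partition 0 t s & mesh 0 t s < d.
Proof.
move=> t0 d0; pose n := (Num.bound (t / d)).+1.
have n0 : 0 < n%:R :> R by rewrite ltr0n.
have tn : t / n%:R < d.
  rewrite ltr_pdivrMr// mulrC -ltr_pdivrMr// (lt_le_trans (archi_boundP _)) ?ler_nat//.
  by rewrite divr_ge0// ltW.
pose s := mkseq (fun i => t * i.+1%:R / n%:R) n.
have nthE i : (i <= n)%N -> nth t (0 :: s) i = t * i%:R / n%:R.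
  case: i => [|i] ni; first by rewrite /= mulr0 mul0r.
  by rewrite /= nth_mkseq.
have ss : size s = n by rewrite size_mkseq.
have diff i : (i < n)%N -> nth t (0 :: s) i.+1 - nth t (0 :: s) i = t / n%:R.
  by move=> ni; rewrite !nthE// ?(ltnW ni)// -mulrBl -mulrBr -natrB ?leqnSn// subSnn mulr1.
exists s.
  split.
    apply/(pathP t) => i; rewrite ss => ni.
    rewrite -[X in (_ < X)%O]/(nth t (0 :: s) i.+1) -subr_gt0 diff//.
    exact: divr_gt0.
  rewrite (last_nth t) ss nthE// mulfK// gt_eqF//.
rewrite /mesh ss big_nat; apply: bigmax_lt => // i /andP[_ ni].
by rewrite diff.
Qed.

(** [Zarea] selects a limit by [get], so uniqueness has to be proved: two limits are compared on one
    subdivision that is fine enough for both. *)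
Lemma Zarea_eq (g : R -> R * R) (t I : R) : 0 <= t -> is_area_integral g t I ->
  Zarea g t = 2 * I.
Proof.
move=> t0 HI; rewrite /Zarea; congr (2 * _).
have HJ : is_area_integral g t (get [set I | is_area_integral g t I]).
  by apply: (@getPex _ [set I | is_area_integral g t I]); exists I.
set J := get _ in HJ *; apply/eqP; rewrite -subr_eq0 -normr_le0; apply/ler_addgt0Pr => e e0.
rewrite add0r; have e2 : 0 < e / 2 by rewrite divr_gt0.
have [d1 d10 H1] := HI _ e2; have [d2 d20 H2] := HJ _ e2.
have [s ps ms] : exists2 s, itv_partition 0 t s & mesh 0 t s < Num.min d1 d2.
  move: t0; rewrite le_eqVlt => /predU1P[<-|t0]; last first.
    by apply: uniform_partition => //; rewrite lt_min d10.
  by exists [::]; [|rewrite /mesh big_geq// lt_min d10].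
move: ms; rewrite lt_min => /andP[/(H1 _ ps) h1 /(H2 _ ps) h2].
rewrite -(subrKA (area_sum g 0 t s)) (le_trans (ler_normD _ _))// (splitr e) lerD// ltW//.
by rewrite distrC.
Qed.

Lemma area_integral (a C T : R) (c : R -> heis R) : 0 < a -> 0 <= C ->
  (forall t t', 0 <= t -> t <= t' -> t' <= T ->
    `|zeta (c t) (c t') - (t' - t)| <= C * (t' - t) `^ (1 + a)) ->
  forall t, 0 <= t -> t <= T ->
  is_area_integral (fun t => (c t).1) t ((t - ((c t).2 - (c 0).2)) / 2).
Proof.
move=> a0 C0 Hc t t0 tT e e0.
have CT : 0 <= C * t by rewrite mulr_ge0.
have [d d0 Hd] := powR_small a0 CT e0.
exists d => // s ps md.
pose x i := nth t (0 :: s) i; pose n := size s.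
have xge i : (i <= n)%N -> 0 <= x i.
  by move=> ni; exact: itv_partition_nth_ge.
have xle i : (i <= n)%N -> x i <= t.
  by move=> ni; exact: itv_partition_nth_le.
have xlt i : (i < n)%N -> x i <= x i.+1.
  by move=> ni; have [/(pathP t)/(_ i ni)/ltW h _] := ps; exact: h.
have xm i : (i < n)%N -> x i.+1 - x i <= mesh 0 t s.
  move=> ni; rewrite /mesh; pose G i := nth t (0 :: s) i.+1 - nth t (0 :: s) i.
  by apply: (@le_bigmax_seq _ _ _ (index_iota 0 (size s)) 0 i predT G); rewrite ?mem_index_iota.
have xn : x n = t by exact: itv_partition_nth_size.
have m0 : 0 <= mesh 0 t s.
  have [n0|n0] := posnP n; first by rewrite /mesh -/n n0 big_geq.
  by rewrite (le_trans _ (xm _ n0))// subr_ge0 xlt.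
have areaE : area_sum (fun t => (c t).1) 0 t s = \sum_(0 <= i < n) wedge (c (x i)).1 (c (x i.+1)).1 by [].
(* Heights and parameters telescope, so the area sum is the only term that depends on the
   subdivision. Each summand on the right is [O ((x i.+1 - x i) ^ (1 + a))], and their sum is
   bounded by [C * t] times the mesh to the power [a]. *)
have key : 2 * (area_sum (fun t => (c t).1) 0 t s - (t - ((c t).2 - (c 0).2)) / 2) =
  \sum_(0 <= i < n) (zeta (c (x i)) (c (x i.+1)) - (x i.+1 - x i)).
  have -> : \sum_(0 <= i < n) (zeta (c (x i)) (c (x i.+1)) - (x i.+1 - x i)) =
    \sum_(0 <= i < n) (((c (x i.+1)).2 - (c (x i)).2) + 2 * wedge (c (x i)).1 (c (x i.+1)).1 - (x i.+1 - x i)).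
    by apply: eq_bigr.
  rewrite sumrB big_split/= -mulr_sumr -areaE.
  rewrite (@telescope_sumr _ 0 n (fun i => (c (x i)).2))// (@telescope_sumr _ 0 n x)// xn.
  rewrite (_ : x 0%N = 0)//; set A := area_sum _ _ _ _; set z := (c t).2; set z' := (c 0).2; lra.
have bnd : `|\sum_(0 <= i < n) (zeta (c (x i)) (c (x i.+1)) - (x i.+1 - x i))| <= C * t * mesh 0 t s `^ a.
  rewrite (le_trans (ler_norm_sum _ _ _))//.
  apply: (@le_trans _ _ (\sum_(0 <= i < n) (C * mesh 0 t s `^ a * (x i.+1 - x i)))).
    rewrite !big_nat; apply: ler_sum => i /andP[_ ni].
    have d_ge0 : 0 <= x i.+1 - x i by rewrite subr_ge0 xlt.
    have h := Hc (x i) (x i.+1) (xge _ (ltnW ni)) (xlt _ ni) (le_trans (xle _ ni) tT).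
    rewrite (le_trans h)// powR1D// -mulrA ler_wpM2l// mulrC ler_wpM2r//.
    by apply: le_powR => //; [exact: ltW|exact: xm].
  rewrite -mulr_sumr (@telescope_sumr _ 0 n x)// xn /x /= subr0.
  by rewrite mulrAC.
have fin : C * t * mesh 0 t s `^ a <= e by exact: Hd m0 (ltW md).
have : `|2 * (area_sum (fun t => (c t).1) 0 t s - (t - ((c t).2 - (c 0).2)) / 2)| <= e.
  by rewrite key (le_trans bnd).
rewrite normrM ger0_norm//; move: e0; set z := `| _ |; lra.
Qed.

(** The existence of the limit behind [Zarea] is a consequence of the estimate on [zeta], so the
    height of [c] has no choice but to be the one of a vertical lift. *)
Lemma vertical_liftE (a C T : R) (c : R -> heis R) (z0 : R) : 0 < a -> 0 <= C ->
  (forall t t', 0 <= t -> t <= t' -> t' <= T ->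
    `|zeta (c t) (c t') - (t' - t)| <= C * (t' - t) `^ (1 + a)) ->
  forall t, 0 <= t -> t <= T ->
  vertical_lift (fun t => (c t).1) z0 t = ((c t).1, z0 + ((c t).2 - (c 0).2)).
Proof.
move=> a0 C0 Hc t t0 tT; rewrite /vertical_lift (Zarea_eq t0 (area_integral a0 C0 Hc t0 tT)).
by case: (c t) => [[x y] z] /=; congr (_, _); field.
Qed.

End Area.

(** * Level sets as arcs and as vertical lifts *)

Section LevelCurves.
Context {R : realType}.

Lemma half_inj (lo hi : R) (c : R -> heis R) :
  (forall t t', lo <= t -> t <= t' -> t' <= hi ->
    `|zeta (c t) (c t') - (t' - t)| <= (t' - t) / 2) ->
  forall t t', lo <= t -> t <= hi -> lo <= t' -> t' <= hi ->
    `|t' - t| <= 2 * `|zeta (c t) (c t')|.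
Proof.
move=> half.
have main t t' : lo <= t -> t <= t' -> t' <= hi -> t' - t <= 2 * `|zeta (c t) (c t')|.
  move=> lt tt' th; have := half t t' lt tt' th; rewrite ler_distlC.
  have := ler_norm (zeta (c t) (c t')); lra.
move=> t t' lt th lt' th'; have [tt'|/ltW tt'] := leP t t'.
  by rewrite ger0_norm ?subr_ge0//; exact: main.
by rewrite zetaC normrN distrC ger0_norm ?subr_ge0//; exact: main.
Qed.

Lemma half_injective (lo hi : R) (c : R -> heis R) :
  (forall t t', lo <= t -> t <= t' -> t' <= hi ->
    `|zeta (c t) (c t') - (t' - t)| <= (t' - t) / 2) ->
  forall t t', lo <= t -> t <= hi -> lo <= t' -> t' <= hi -> c t = c t' -> t = t'.
Proof.
move=> half t t' lt th lt' th' cc; have := half_inj half lt th lt' th'.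
rewrite cc zetaxx normr0 mulr0 normr_le0 subr_eq0 => /eqP //.
Qed.


Section ArcsOfCurves.
Variables (lo hi : R) (c : R -> heis R).
Hypothesis half : forall t t', lo <= t -> t <= t' -> t' <= hi ->
  `|zeta (c t) (c t') - (t' - t)| <= (t' - t) / 2.
Hypothesis unif : forall e, 0 < e -> exists2 d, 0 < d & forall t t',
  lo <= t -> t <= hi -> lo <= t' -> t' <= hi ->
  `|t' - t| <= d -> heis_dist (c t) (c t') <= e.

Let inj := half_injective half.

Lemma segment_simple_arc (u v : R) : lo <= u -> u < v -> v <= hi -> simple_arc (c @` `[u, v]).
Proof.
move=> lu uv vh; have d0 : 0 < v - u by rewrite subr_gt0.
pose k s := (v - u) * s + u.
have k0 s : 0 <= s -> u <= k s.
  by move=> s0; rewrite lerDr mulr_ge0// ltW.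
have k1 s : s <= 1 -> k s <= v.
  by move=> s1; rewrite -lerBrDr -[leRHS]mulr1 ler_wpM2l// ltW.
have kl s : 0 <= s -> lo <= k s by move=> s0; exact: le_trans (k0 _ s0).
have kh s : s <= 1 -> k s <= hi by move=> s1; exact: le_trans (k1 _ s1) _.
have kB s s' : k s' - k s = (v - u) * (s' - s) by rewrite /k; ring.
exists (c \o k); split.
- apply: heis_unif_continuous => e /unif[d dpos Hd].
  exists (d / (v - u)); first by rewrite divr_gt0.
  move=> s s' s0 s1 s'0 s'1 ss'; apply: Hd; [exact: kl|exact: kh|exact: kl|exact: kh|].
  by rewrite kB normrM (gtr0_norm d0) mulrC -ler_pdivlMr.
- move=> s s'; rewrite !in_itv/= => /andP[s0 s1] /andP[s'0 s'1] h.
  have kk := inj (kl _ s0) (kh _ s1) (kl _ s'0) (kh _ s'1) h.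
  have := kB s s'; rewrite kk subrr => /esym/eqP.
  by rewrite mulf_eq0 (gt_eqF d0)/= subr_eq0 => /eqP.
- apply/seteqP; split => B /= [s]; rewrite in_itv/= => /andP[s0 s1] <-{B}.
    by exists (k s) => //; rewrite in_itv/= k0// k1.
  exists ((s - u) / (v - u)).
    by rewrite in_itv/= ler_pdivrMr// mul1r lerB// divr_ge0// ?subr_ge0// ltW.
  by rewrite /k mulrC divfK ?gt_eqF// subrK.
Qed.

(** The parametrization of the arc is pulled back to the parameter of [c]. The pull-back [theta] is
    continuous, since [|t' - t|] is at most twice [|zeta (c t) (c t')|], and injective, so its image
    is an interval. This handles neighbourhoods of which nothing is known except that they cut an
    arc from the level set. *)
Lemma simple_arc_segment (S : set (heis R)) : S `<=` c @` `[lo, hi] -> simple_arc S ->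
  exists u v, [/\ lo <= u, u < v, v <= hi & S = c @` `[u, v]].
Proof.
move=> Sc [f [cf injf imf]].
have ex s : exists t, 0 <= s -> s <= 1 -> [/\ lo <= t, t <= hi & c t = f s].
  have [/andP[s0 s1]|] := boolP ((0 <= s) && (s <= 1)); last first.
    by move=> h; exists 0 => s0 s1; rewrite s0 s1 in h.
  have : S (f s) by rewrite -imf; exists s => //=; rewrite in_itv/= s0.
  by move=> /Sc[t]; rewrite /= in_itv/= => /andP[lt th] ct; exists t.
have [theta Hth] := choice ex.
have cth : {within `[0, 1], continuous theta}.
  apply/subspace_continuousP => s; rewrite /= in_itv/= => /andP[s0 s1].
  suff : theta @ within `[0, 1]%classic (nbhs s) --> theta s by [].
  have fc : f s' @[s' --> within `[0, 1]%classic (nbhs s)] --> f s.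
    by have /subspace_continuousP := cf; apply; rewrite /= in_itv/= s0.
  have zc : zeta (f s) (f s') @[s' --> within `[0, 1]%classic (nbhs s)] --> zeta (f s) (f s).
    by apply: cvg_zeta => //; exact: cvg_cst.
  rewrite zetaxx in zc.
  apply/cvgrPdist_le => e e0; have e2 : 0 < e / 2 by rewrite divr_gt0.
  move/cvgrPdist_le : zc => /(_ _ e2); rewrite !near_withinE; apply: filterS => s' H /= s'I.
  have := H s'I; rewrite sub0r normrN; move: s'I; rewrite /= in_itv/= => /andP[s'0 s'1].
  have [h1 h2 h3] := Hth s s0 s1; have [h4 h5 h6] := Hth s' s'0 s'1.
  have := half_inj half h1 h2 h4 h5; rewrite h3 h6 distrC => /le_trans h hz; apply: h.
  by rewrite mulrC -ler_pdivlMr.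
have ith : {in `[0, 1] &, injective theta}.
  move=> s s' sI s'I th; apply: injf => //; move: sI s'I.
  rewrite !in_itv/= => /andP[s0 s1] /andP[s'0 s'1].
  by have [_ _ <-] := Hth s s0 s1; have [_ _ <-] := Hth s' s'0 s'1; rewrite th.
have imth := continuous_inj_image_segment ler01 cth ith.
set u := Num.min (theta 0) (theta 1) in imth; set v := Num.max (theta 0) (theta 1) in imth.
have [l0 h0 _] := Hth 0 (lexx _) ler01; have [l1 h1 _] := Hth 1 ler01 (lexx _).
exists u, v; split.
- by rewrite le_min l0.
- rewrite /u /v; case: (ltgtP (theta 0) (theta 1)) => // th01.
  have : (0 : R) = 1 by apply: ith => //; rewrite in_itv/= ?lexx ler01.
  by move/eqP; rewrite eq_sym oner_eq0.
- by rewrite ge_max h0.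
- rewrite -imf; apply/seteqP; split => B /= [s sI <-{B}].
    have H : (theta @` `[0, 1]) (theta s) by exists s.
    rewrite imth in H; exists (theta s) => //.
    by move: sI; rewrite in_itv/= => /andP[s0 s1]; have [] := Hth s s0 s1.
  have : (theta @` `[0, 1]) s by rewrite imth.
  move=> [s' s'I <-]; exists s' => //.
  by move: s'I; rewrite /= in_itv/= => /andP[s0 s1]; have [] := Hth s' s0 s1.
Qed.

Lemma segment_vertical_lift (a C u v : R) : 0 < a -> 0 <= C -> vcurve a C lo hi c ->
  lo <= u -> u < v -> v <= hi ->
  exists (T : R) (g : R -> R * R) (z0 : R),
    [/\ 0 < T, holder_curve ((1 + a) / 2) T g & arc_param 0 T (vertical_lift g z0) (c @` `[u, v])].
Proof.
move=> a0 C0 vc lu uv vh.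
pose cu t := c (u + t).
have ul t : 0 <= t -> lo <= u + t by move=> t0; rewrite (le_trans lu)// lerDl.
have uh t : t <= v - u -> u + t <= hi by move=> tv; rewrite (le_trans _ vh)// -lerBrDl.
have uB t t' : u + t' - (u + t) = t' - t by ring.
have Hcu t t' : 0 <= t -> t <= t' -> t' <= v - u ->
    enorm2 ((cu t').1 - (cu t).1) <= C * (t' - t) `^ ((1 + a) / 2) /\
    `|zeta (cu t) (cu t') - (t' - t)| <= C * (t' - t) `^ (1 + a).
  move=> l tt' h; rewrite -uB; apply: vc; [exact: ul| |exact: uh].
  by rewrite lerD2l.
have liftE' := vertical_liftE (cu 0).2 a0 C0 (fun t t' l tt' h => (Hcu t t' l tt' h).2).
have liftE t : 0 <= t -> t <= v - u -> vertical_lift (fun t => (cu t).1) (cu 0).2 t = cu t.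
  by move=> l h; rewrite liftE'// addrC subrK; case: (cu t).
clear liftE'; exists (v - u), (fun t => (cu t).1), (cu 0).2; split.
- by rewrite subr_gt0.
- exists C => s t; rewrite !in_itv/= => /andP[s0 s1] /andP[u0 u1].
  have [st|/ltW st] := leP s t.
    by rewrite ger0_norm ?subr_ge0//; have [] := Hcu s t s0 st u1.
  by rewrite distrC enorm2_subC ger0_norm ?subr_ge0//; have [] := Hcu t s u0 st s1.
split.
- apply: heis_unif_continuous => e' /unif[d' d'0 Hd']; exists d' => // s s' s0 s1 s'0 s'1 ss'.
  rewrite (liftE s s0 s1) (liftE s' s'0 s'1).
  by apply: Hd'; [exact: ul|exact: uh|exact: ul|exact: uh|rewrite uB].
- move=> s s'; rewrite !in_itv/= => /andP[s0 s1] /andP[s'0 s'1].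
  rewrite (liftE s s0 s1) (liftE s' s'0 s'1) => h.
  by apply: (@addrI _ u); apply: inj h; [exact: ul|exact: uh|exact: ul|exact: uh].
- apply/seteqP; split => B /= [s]; rewrite in_itv/= => /andP[s0 s1] <-{B}.
    exists (u + s); last by rewrite (liftE s s0 s1).
    by rewrite in_itv/= lerDl s0 -lerBrDl.
  have s0' : 0 <= s - u by rewrite subr_ge0.
  have s1' : s - u <= v - u by rewrite lerB.
  exists (s - u); first by rewrite in_itv/= s0'.
  by rewrite (liftE _ s0' s1') /cu addrC subrK.
Qed.

End ArcsOfCurves.

Theorem level_curve (a : R) (a0 : 0 < a) (a1 : a < 1) (F : heis R -> R * R) (p : heis R) :
  C1H_holder a F -> set_surj setT setT (Dh F p) ->
  (forall V : set (heis R), nbhs p V ->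
     exists K : set (heis R),
       [/\ compact K, nbhs p K, K `<=` V & simple_arc (level_in F p K)]) /\
  (exists2 U : set (heis R), nbhs p U &
     forall K : set (heis R), compact K -> nbhs p K -> K `<=` U ->
       simple_arc (level_in F p K) ->
       exists (T : R) (g : R -> R * R) (z0 : R),
         [/\ 0 < T, holder_curve ((1 + a) / 2) T g &
             arc_param 0 T (vertical_lift g z0) (level_in F p K)]).
Proof.
move=> CF sF; have [r [C [Phi [r0 C0 str cPhi PhiF]]]] := normal_form a0 a1 CF sF.
have Pp : Phi p = 0 by apply/PhiF.
have [tau [C2 [c [[tau0 C20] [c0 vc] Pc half [e e0 cover]]]]] := local_curve a0 a1 r0 C0 str Pp cPhi.
have unif := vcurve_dist_small a0 C20 vc.
have nt : - tau <= 0 by rewrite oppr_le0 ltW.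
have t0 : 0 <= tau by exact: ltW.
split.
- move=> V Vp.
  have Up : nbhs p (V `&` [set B | heis_dist p B <= e]) by apply: filterI => //; exact: nbhs_heis_dist.
  have [/= d d0 dU] := (nbhs_ballP p _).1 Up.
  have d2 : 0 < d / 2 by rewrite divr_gt0.
  pose Box : set (heis R) := (`[p.1.1 - d / 2, p.1.1 + d / 2] `*` `[p.1.2 - d / 2, p.1.2 + d / 2])
     `*` `[p.2 - d / 2, p.2 + d / 2].
  have cBox : compact Box by apply: compact_setX; [apply: compact_setX|]; exact: segment_compact.
  have BoxU : Box `<=` V `&` [set B | heis_dist p B <= e].
    move=> [[x y] z] [[/=]]; rewrite !in_itv/= => /andP[x1 x2] /andP[y1 y2] /andP[z1 z2].
    apply: dU; split; [split|]; rewrite /= /ball /= ltr_distlC; apply/andP; split; move: d0; lra.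
  have nBox : nbhs p Box.
    apply/nbhs_ballP; exists (d / 2) => // [[[x y] z]] [[/=]].
    rewrite /ball /= !ltr_distlC => /andP[x1 x2] /andP[y1 y2] /andP[z1 z2].
    by split; [split|]; rewrite /= in_itv/= !ltW.
  have [eps [eps0 epst epsBox]] : exists eps : R, [/\ 0 < eps, eps <= tau & forall t, - eps <= t -> t <= eps -> Box (c t)].
    have : c t @[t --> within `[- tau, tau]%classic (nbhs (0 : R))] --> c 0.
      have /subspace_continuousP := vcurve_continuous a0 C20 vc; apply.
      by rewrite /= in_itv/= nt.
    rewrite c0 => /(_ _ nBox); rewrite nbhs_simpl/= => -[/= h h0 hB].
    exists (Num.min tau (h / 2)); rewrite lt_min tau0 divr_gt0//; split => //.
      by rewrite ge_min lexx.
    move=> t; rewrite lerNl le_min => /andP[l1 l2]; rewrite le_min => /andP[l3 l4].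
    apply: hB; last by rewrite /= in_itv/= l3 lerNl l1.
    rewrite /ball_/= sub0r normrN ltr_norml; apply/andP; split; move: h0; lra.
  have nepst : - tau <= - eps by rewrite lerN2.
  have neps : - eps <= eps by move: eps0; lra.
  have neps0 : - eps <= 0 by move: eps0; lra.
  (* A box alone might meet the level set in several pieces. The two closed half-spaces translate,
     on the curve, into [- eps <= t] and [t <= eps], because [zeta] has the sign of the parameter
     increment; [p] is interior to both. *)
  pose K := Box `&` ([set B | 0 <= zeta (c (- eps)) B] `&` [set B | 0 <= zeta B (c eps)]).
  have clz (f : heis R -> R) : continuous f -> closed [set B | 0 <= f B].
    move=> cf; apply: (@preimage_closed _ _ f [set x | 0 <= x]); last exact: closed_ge.
    by move=> x _; exact: cf.
  have cz1 q : continuous (fun B : heis R => zeta q B).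
    by move=> B; apply: cvg_zeta; [exact: cvg_cst|exact: cvg_id].
  have cz2 q : continuous (fun B : heis R => zeta B q).
    by move=> B; apply: cvg_zeta; [exact: cvg_id|exact: cvg_cst].
  have levelK : level_in F p K = c @` `[- eps, eps].
    apply/seteqP; split => B /=.
      rewrite /level_in /= => -[FB [BB [B1 B2]]].
      have [_ pB] := BoxU _ BB.
      have [t [lt th ct]] := cover B pB ((PhiF B).2 FB).
      exists t => //; rewrite in_itv/=; move: B1 B2; rewrite /= -ct => B1 B2.
      apply/andP; split; rewrite leNgt; apply/negP => h.
        have := half t (- eps) lt (ltW h) (le_trans neps epst).
        by rewrite (zetaC (c (- eps))) ler_distlC => /andP[h1 h2]; move: B1 h1 h2 h; lra.
      have := half eps t (le_trans nepst neps) (ltW h) th.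
      by rewrite (zetaC (c t)) ler_distlC => /andP[h1 h2]; move: B2 h1 h2 h; lra.
    move=> [t]; rewrite in_itv/= => /andP[lt th] <-{B}; split.
      by apply/PhiF/Pc; [exact: le_trans lt|exact: le_trans epst].
    split; first exact: epsBox.
    split => /=.
      have := half (- eps) t nepst lt (le_trans th epst).
      by rewrite ler_distlC => /andP[h1 h2]; move: h1 h2 lt; lra.
    have := half t eps (le_trans nepst lt) th epst.
    by rewrite ler_distlC => /andP[h1 h2]; move: h1 h2 th; lra.
  exists K; split.
  + apply: compact_closedI => //; apply: closedI; apply: clz; [exact: cz1|exact: cz2].
  + apply: filterI => //; apply: filterI.
      have z1 : 0 < zeta (c (- eps)) p.
        have := half (- eps) 0 nepst neps0 t0; rewrite c0 ler_distlC => /andP[h1 h2].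
        move: h1 h2 eps0; lra.
      have h := cz1 (c (- eps)) p.
      exact: cvgr_ge _ h _ z1.
    have z1 : 0 < zeta p (c eps).
      have := half 0 eps nt (ltW eps0) epst; rewrite c0 ler_distlC => /andP[h1 h2].
      move: h1 h2 eps0; lra.
    have h := cz2 (c eps) p.
    exact: cvgr_ge _ h _ z1.
  + by move=> B [/BoxU[]].
  + by rewrite levelK; apply: (segment_simple_arc half unif) => //; move: eps0; lra.
- exists [set B | heis_dist p B <= e]; first exact: nbhs_heis_dist.
  move=> K _ _ KU arcK.
  have sub : level_in F p K `<=` c @` `[- tau, tau].
    move=> B [FB KB]; have [t [lt th ct]] := cover _ (KU _ KB) ((PhiF _).2 FB).
    by exists t => //=; rewrite in_itv/= lt.
  have [u [v [lu uv vh ->]]] := simple_arc_segment half sub arcK.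
  exact: (segment_vertical_lift half unif a0 C20 vc).
Qed.

End LevelCurves.

(** * Vertical lifts of Hoelder curves *)

Section HolderLift.
Context {R : realType}.

(** The height is not integrated but sewn: chains above the grid points of [g] with constant
    vertical step satisfy the hypotheses of [chain_limit], and the horizontal part of the limit is
    [g] again by continuity. *)
Lemma holder_lift (a C T : R) (g : R -> R * R) : 0 < a -> 0 <= C -> 0 <= T ->
  (forall t t', 0 <= t -> t <= t' -> t' <= T ->
     enorm2 (g t' - g t) <= C * (t' - t) `^ ((1 + a) / 2)) ->
  exists (Z : R -> R) (C' : R), 0 <= C' /\ vcurve a C' 0 T (fun t => (g t, Z t)).
Proof.
move=> a0 C0 T0 Hg; pose K := sewing_cst a C.
have K0 : 0 <= K by exact: sewing_cst_ge0.
have b0 : 0 < (1 + a) / 2 by rewrite divr_gt0// addr_gt0.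
pose x N k : R := k%:R / N.+1%:R.
(* The increments are those of time minus twice the area sum, which makes [zeta] of consecutive
   points exactly [1 / (N + 1)]. *)
pose z N := fix z k := if k is j.+1 then
  z j + 1 * N.+1%:R^-1 - 2 * wedge (g (x N j)) (g (x N j.+1)) else 0.
pose A N k : heis R := (g (x N k), z N k).
have x0 N k : 0 <= x N k by rewrite divr_ge0.
have xD N i m : x N (i + m)%N - x N i = m%:R / N.+1%:R by rewrite /x natrD mulrDl addrAC subrr add0r.
have step N k : zeta (A N k) (A N k.+1) = 1 * N.+1%:R^-1.
  by rewrite /zeta /A /=; ring.
have hor N i m : x N (i + m)%N <= T ->
    enorm2 ((A N (i + m)%N).1 - (A N i).1) <= C * (m%:R / N.+1%:R) `^ ((1 + a) / 2).
  move=> h; rewrite -(xD N i m); apply: Hg => //.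
  by rewrite -subr_ge0 xD divr_ge0.
have xle N j k : (j <= k)%N -> x N j <= x N k.
  by move=> jk; rewrite ler_pM2r ?invr_gt0// ler_nat.
have ver N i m : (0 < m)%N -> x N (i + m)%N <= T ->
    `|zeta (A N i) (A N (i + m)%N) - 1 * (m%:R / N.+1%:R)| <= K * (m%:R / N.+1%:R) `^ (1 + a).
  move=> m0 h; apply: (@discrete_sewing R a 1 N.+1%:R^-1 C (i + m) m (A N)) => //.
  - by move=> j l _ jl; apply: hor; exact: le_trans (xle _ _ _ jl) h.
  - by rewrite m0 leqnn.
have A0 N : A N 0%N = (g 0, 0) by rewrite /A /x mul0r.
have [c [U [PU Uoo c0 Ac Hc]]] := chain_limit a0 C0 K0 T0 A0 (fun N i m _ => @hor N i m) ver.
have c1 t : 0 <= t -> t <= T -> (c t).1 = g t.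
  move=> t0 tT; apply/eqP; rewrite -subr_eq0; apply/eqP/enorm2_eq0/ler_addgt0Pr => e e0.
  rewrite add0r; have [d d0 Hd] := powR_small b0 C0 e0.
  have lim : enorm2 ((A N (Num.truncn (t * N.+1%:R))).1 - g t) @[N --> U] --> enorm2 ((c t).1 - g t).
    apply: cvg_enorm2; apply: cvgB; last exact: cvg_cst.
    exact: cvg_fst2 (Ac t t0 tT).
  apply: (cvgr_to_le lim).
  apply: filterS (Uoo _ (natSinv_small d0)) => N /= hN; rewrite enorm2_subC /=; set k := Num.truncn _.
  have /andP[k1 k2] : k%:R <= t * N.+1%:R < k.+1%:R by apply: truncn_itv; rewrite mulr_ge0.
  have N0 : 0 < N.+1%:R :> R by [].
  have xt : x N k <= t by rewrite ler_pdivrMr.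
  rewrite (le_trans (Hg _ _ (x0 _ _) xt tT))//.
  apply: Hd; first by rewrite subr_ge0.
  rewrite (le_trans _ hN)// lerBlDl -[X in _ + X]mul1r -mulrDl ler_pdivlMr//.
  by rewrite natr1 ltW.
pose C' := 2 `^ ((1 + a) / 2) * C + 2 `^ (1 + a) * K.
exists (fun t => (c t).2), C'; split.
  by rewrite addr_ge0// mulr_ge0// powR_ge0.
move=> t t' t0 tt' t'T; have [h1 h2] := Hc t t' t0 tt' t'T.
have cE s : 0 <= s -> s <= T -> (g s, (c s).2) = c s.
  by move=> s0 sT; rewrite -c1//; case: (c s).
rewrite (cE t t0 (le_trans tt' t'T)) (cE t' (le_trans t0 tt') t'T).
rewrite mul1r in h2; split.
  by rewrite (le_trans h1)// ler_wpM2r ?powR_ge0// lerDl mulr_ge0// powR_ge0.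
by rewrite (le_trans h2)// ler_wpM2r ?powR_ge0// lerDr mulr_ge0// powR_ge0.
Qed.

(** By [vertical_liftE] the sewn height and the one defined by [Zarea] differ by a constant, and
    [zeta] does not see a common vertical translation. *)
Lemma vertical_lift_vcurve (a C T z0 : R) (g : R -> R * R) : 0 < a -> 0 <= C -> 0 <= T ->
  (forall t t', 0 <= t -> t <= t' -> t' <= T ->
     enorm2 (g t' - g t) <= C * (t' - t) `^ ((1 + a) / 2)) ->
  exists2 C' : R, 0 <= C' & vcurve a C' 0 T (vertical_lift g z0).
Proof.
move=> a0 C0 T0 Hg; have [Z [C' [C'0 vc]]] := holder_lift a0 C0 T0 Hg.
exists C' => // t t' t0 tt' t'T.
have liftE := vertical_liftE z0 a0 C'0 (fun t t' l tt' h => (vc t t' l tt' h).2).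
have {}liftE s : 0 <= s -> s <= T -> vertical_lift g z0 s = (g s, z0 + (Z s - Z 0)).
  exact: liftE.
rewrite (liftE t t0 (le_trans tt' t'T)) (liftE t' (le_trans t0 tt') t'T).
have [h1 h2] := vc t t' t0 tt' t'T; split => //.
by move: h2; congr (`|_ - _| <= _); rewrite /zeta /=; ring.
Qed.

End HolderLift.

(** * Whitney extension along a curve *)

Section Jets.
Context {R : realType}.
Implicit Types (f : heis R -> R) (G : heis R -> R * R).

Lemma dotDl (u v w : R * R) : dot (u + v) w = dot u w + dot v w.
Proof. by rewrite /dot /=; ring. Qed.

Lemma dotDr (u v w : R * R) : dot w (u + v) = dot w u + dot w v.
Proof. by rewrite /dot /=; ring. Qed.

Lemma dotZl (k : R) (v w : R * R) : dot (k *: v) w = k * dot v w.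
Proof. by rewrite -[k *: v]/(k * v.1, k * v.2) /dot /=; ring. Qed.

Lemma dotZr (k : R) (v w : R * R) : dot w (k *: v) = k * dot w v.
Proof. by rewrite -[k *: v]/(k * v.1, k * v.2) /dot /=; ring. Qed.

Lemma dot0l (v : R * R) : dot 0 v = 0.
Proof. by rewrite -(scale0r 0) dotZl mul0r. Qed.

Definition taylor_rem f G A B : R := f B - f A - dot (G A) (B.1 - A.1).

(* [G] plays the role of the horizontal gradient of [f], and [r] is the length scale at which [f] varies. *)
Definition reg (r K : R) f G :=
  (forall A, `|f A| <= K) /\
  (forall A B, `|taylor_rem f G A B| <= K * (heis_dist A B / r) ^+ 2).

Lemma reg_ge0 r K f G : reg r K f G -> 0 <= K.
Proof. by move=> [/(_ (0, 0, 0)) h _]; exact: le_trans h. Qed.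

Lemma reg_le r K K' f G : K <= K' -> reg r K f G -> reg r K' f G.
Proof.
move=> KK' [h1 h2]; split=> [A|A B]; first exact: le_trans KK'.
by rewrite (le_trans (h2 A B))// ler_wpM2r// sqr_ge0.
Qed.

(* Testing a vector against its own direction at length [r]. *)
Lemma enorm2_test (r k : R) (w : R * R) : 0 < r -> 
  (forall v, enorm2 v = r -> dot w v <= k) -> r * enorm2 w <= k.
Proof.
move=> r0 H; have [w0|w0] := leP (enorm2 w) 0.
  move: H; rewrite (enorm2_eq0 w0) enorm20 mulr0 => H; have := H (r, 0); rewrite dot0l; apply.
  by rewrite /enorm2 /= expr0n addr0 sqrtr_sqr gtr0_norm.
have := H ((r / enorm2 w) *: w); rewrite dotZr dotvv expr2 mulrA divfK ?gt_eqF//; apply.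
by rewrite enorm2Z gtr0_norm ?divr_gt0// divfK// gt_eqF.
Qed.

Lemma taylor_rem_hor f G (A : heis R) (v : R * R) :
  taylor_rem f G A (heis_mul A (v, 0)) = f (heis_mul A (v, 0)) - f A - dot (G A) v.
Proof. by rewrite /taylor_rem heis_mul_fst [_ + v]addrC addrK. Qed.

Lemma reg_grad r K f G A : 0 < r -> reg r K f G -> enorm2 (G A) <= 3 * K / r.
Proof.
move=> r0 [h1 h2]; rewrite ler_pdivlMr// mulrC; apply: enorm2_test => // v vr.
set B := heis_mul A (v, 0).
have := h2 A B; rewrite taylor_rem_hor heis_dist_mul_hor vr divff ?gt_eqF// expr1n mulr1.
have := h1 A; have := h1 B; rewrite !ler_norml; rewrite -/B; lra.
Qed.

(** Beyond the scale [r] the bound on the values suffices; below it the gradient contributes [3 * K]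
    and the quadratic remainder [K]. *)
Lemma reg_lip r K f G A B : 0 < r -> reg r K f G -> `|f B - f A| <= 4 * K * (heis_dist A B / r).
Proof.
move=> r0 rf; have [h1 h2] := rf; have K0 := reg_ge0 rf.
set d := heis_dist A B / r; have d0 : 0 <= d by rewrite divr_ge0 ?heis_dist_ge0// ltW.
have [d1|d1] := leP 1 d.
  have := h1 A; have := h1 B; have := ler_normB (f B) (f A).
  have : K <= K * d by rewrite ler_peMr.
  have : 0 <= K * d by rewrite mulr_ge0.
  rewrite -mulrA; lra.
have g : `|dot (G A) (B.1 - A.1)| <= 3 * K * d.
  rewrite (le_trans (dot_le _ _))//.
  have -> : 3 * K * d = 3 * K / r * heis_dist A B by rewrite /d; ring.
  by rewrite ler_pM ?enorm2_ge0 ?heis_dist_hor ?(reg_grad _ r0 rf).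
have := h2 A B; rewrite -/d.
have : K * d ^+ 2 <= K * d by rewrite ler_wpM2l// expr2 ler_piMl// ltW.
have -> : f B - f A = taylor_rem f G A B + dot (G A) (B.1 - A.1) by rewrite /taylor_rem subrK.
have := ler_normD (taylor_rem f G A B) (dot (G A) (B.1 - A.1)).
move: g; rewrite -!mulrA; set x := K * d; lra.
Qed.

(** By the Leibniz rule the remainder consists of one remainder of each factor and of the product of
    the two increments: 18 = 1 + 1 + 4 * 4. *)
Lemma reg_mul r K K' f f' G G' : 0 < r -> reg r K f G -> reg r K' f' G' ->
  reg r (18 * (K * K')) (fun A => f A * f' A) (fun A => f A *: G' A + f' A *: G A).
Proof.
move=> r0 rf rf'; have K0 := reg_ge0 rf; have K0' := reg_ge0 rf'.
have KK : 0 <= K * K' by rewrite mulr_ge0.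
have [h1 h2] := rf; have [h1' h2'] := rf'; split=> [A|A B].
  rewrite normrM (le_trans (ler_pM _ _ (h1 A) (h1' A)))//; move: KK; lra.
have -> : taylor_rem (fun A => f A * f' A) (fun A => f A *: G' A + f' A *: G A) A B =
  f A * taylor_rem f' G' A B + f' A * taylor_rem f G A B + (f B - f A) * (f' B - f' A).
  by rewrite /taylor_rem dotDl !dotZl; ring.
set q := (heis_dist A B / r).
have q0 : 0 <= q by rewrite divr_ge0 ?heis_dist_ge0// ltW.
have e1 : `|f A * taylor_rem f' G' A B| <= K * (K' * q ^+ 2).
  by rewrite normrM ler_pM// h2'.
have e2 : `|f' A * taylor_rem f G A B| <= K' * (K * q ^+ 2).
  by rewrite normrM ler_pM// h2.
have e3 : `|(f B - f A) * (f' B - f' A)| <= (4 * K * q) * (4 * K' * q).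
  by rewrite normrM ler_pM// ?(reg_lip _ _ r0 rf) ?(reg_lip _ _ r0 rf').
rewrite (le_trans (ler_normD _ _))// (le_trans (lerD (ler_normD _ _) e3))//.
rewrite (le_trans (lerD (lerD e1 e2) (lexx _)))// le_eqVlt; apply/orP; left; apply/eqP; ring.
Qed.

Lemma reg_scale r K e f G : reg r K f G -> reg r (`|e| * K) (fun A => e * f A) (fun A => e *: G A).
Proof.
move=> [h1 h2]; split=> [A|A B]; first by rewrite normrM ler_wpM2l.
have -> : taylor_rem (fun A => e * f A) (fun A => e *: G A) A B = e * taylor_rem f G A B.
  by rewrite /taylor_rem dotZl; ring.
by rewrite normrM -mulrA ler_wpM2l.
Qed.

Lemma reg_coarsen r K f G : 0 < r -> reg (r / 2) K f G -> reg r (4 * K) f G.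
Proof.
move=> r0 rf; have K0 := reg_ge0 rf; have [h1 h2] := rf.
split=> [A|A B]; first by rewrite (le_trans (h1 A))//; move: K0; lra.
rewrite (le_trans (h2 A B))// [4 * K]mulrC -mulrA ler_wpM2l//.
have -> : heis_dist A B / (r / 2) = 2 * (heis_dist A B / r) by field; rewrite gt_eqF.
by rewrite exprMn; lra.
Qed.

Lemma reg_comp r K Q (q q' : R -> R) f G : 0 < r -> reg r K f G -> (forall A, 0 <= f A) ->
  (forall s, 0 <= s -> `|q s| <= Q) -> (forall s, 0 <= s -> `|q' s| <= Q) ->
  (forall s t, 0 <= s -> 0 <= t -> `|q t - q s - q' s * (t - s)| <= Q * (t - s) ^+ 2) ->
  reg r (Q * (1 + K + 16 * K ^+ 2)) (fun A => q (f A)) (fun A => q' (f A) *: G A).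
Proof.
move=> r0 rf f0 hq hq' hT; have K0 := reg_ge0 rf; have [h1 h2] := rf.
have Q0 : 0 <= Q by exact: le_trans (hq 0 (lexx _)).
have QK : 0 <= Q * K by rewrite mulr_ge0.
have QK2 : 0 <= Q * K ^+ 2 by rewrite mulr_ge0// sqr_ge0.
have e : Q * (1 + K + 16 * K ^+ 2) = Q + Q * K + 16 * (Q * K ^+ 2) by ring.
split=> [A|A B].
  by rewrite (le_trans (hq _ (f0 A)))// e; lra.
have -> : taylor_rem (fun A => q (f A)) (fun A => q' (f A) *: G A) A B =
  (q (f B) - q (f A) - q' (f A) * (f B - f A)) + q' (f A) * taylor_rem f G A B.
  by rewrite /taylor_rem dotZl; ring.
set d := heis_dist A B / r.
have e1 := hT _ _ (f0 A) (f0 B).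
have e2 : `|q' (f A) * taylor_rem f G A B| <= Q * (K * d ^+ 2).
  by rewrite normrM ler_pM// ?hq' ?f0// h2.
have e3 : (f B - f A) ^+ 2 <= 16 * K ^+ 2 * d ^+ 2.
  have d0 : 0 <= d by rewrite divr_ge0 ?heis_dist_ge0// ltW.
  have -> : 16 * K ^+ 2 * d ^+ 2 = (4 * K * d) ^+ 2 by ring.
  have Kd : 0 <= 4 * K * d by apply: mulr_ge0 => //; exact: mulr_ge0.
  by rewrite -real_normK ?num_real// ler_pXn2r// ?nnegrE//; exact: reg_lip r0 rf.
rewrite (le_trans (ler_normD _ _))// (le_trans (lerD e1 e2))// e.
have := ler_wpM2l Q0 e3; have : 0 <= Q * d ^+ 2 by rewrite mulr_ge0// sqr_ge0.
lra.
Qed.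

Lemma sum_supp_le (I : finType) (P : pred I) (x : I -> R) (k : R) (N : nat) :
  0 <= k -> (forall i, `|x i| <= k) -> (forall i, ~~ P i -> x i = 0) ->
  (#|[set i | P i]%SET| <= N)%N -> \sum_i `|x i| <= N%:R * k.
Proof.
move=> k0 xk xP PN; rewrite (bigID P)/= [X in _ + X]big1 ?addr0; last first.
  by move=> i /xP ->; rewrite normr0.
apply: (@le_trans _ _ (\sum_(i | P i) k)); first exact: ler_sum.
rewrite sumr_const -[leLHS]mulr_natl ler_wpM2r// ler_nat (leq_trans _ PN)//.
by rewrite cardsE.
Qed.

Lemma dot_suml (I : finType) (G : I -> R * R) (v : R * R) : dot (\sum_i G i) v = \sum_i dot (G i) v.
Proof.
elim/big_rec2 : _ => [|i x y _ <-]; first by rewrite dot0l.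
by rewrite dotDl.
Qed.

(** The number of terms does not enter: the remainder between [A] and [B] only involves the indices
    active at [A] or at [B], at most [2 * N] of them. *)
Lemma reg_sum (I : finType) (r K : R) (N : nat) (f : I -> heis R -> R) (G : I -> heis R -> R * R)
    (S : I -> heis R -> bool) :
  0 <= K -> (forall i, reg r K (f i) (G i)) ->
  (forall i A, ~~ S i A -> f i A = 0 /\ G i A = 0) ->
  (forall A, (#|[set i | S i A]%SET| <= N)%N) ->
  reg r ((2 * N)%:R * K) (fun A => \sum_i f i A) (fun A => \sum_i G i A).
Proof.
move=> K0 rf sup card; split=> [A|A B].
  apply: (le_trans (ler_norm_sum _ _ _)).
  apply: (sum_supp_le (P := S ^~ A)) => //.
  - by move=> i; have [h _] := rf i.
  - by move=> i /sup[].
  - by rewrite (leq_trans (card A))// leq_pmull.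
have -> : taylor_rem (fun A => \sum_i f i A) (fun A => \sum_i G i A) A B =
   \sum_i taylor_rem (f i) (G i) A B.
  by rewrite /taylor_rem dot_suml !sumrB.
rewrite (le_trans (ler_norm_sum _ _ _))// -mulrA.
apply: (sum_supp_le (P := fun i => S i A || S i B)).
- by rewrite mulr_ge0// sqr_ge0.
- by move=> i; have [_ h] := rf i.
- move=> i; rewrite negb_or => /andP[/sup[fA GA] /sup[fB _]].
  by rewrite /taylor_rem fA fB GA dot0l !subr0.
rewrite mul2n -addnn (leq_trans _ (leq_add (card A) (card B)))//.
rewrite (_ : [set i | S i A || S i B] = [set i | S i A] :|: [set i | S i B])%SET.
  by rewrite cardsU leq_subr.
by apply/setP => i; rewrite !inE.
Qed.

End Jets.

(** * Bump functions adapted to the distance *)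

Section Bump.
Context {R : realType}.

Definition pos (x : R) : R := Num.max x 0.

Lemma pos_ge0 x : 0 <= pos x. Proof. by rewrite le_max lexx orbT. Qed.

Lemma pos_taylor (x y : R) : `|pos y ^+ 2 - pos x ^+ 2 - 2 * pos x * (y - x)| <= (y - x) ^+ 2.
Proof.
rewrite /pos; case: (leP x 0) => hx; case: (leP y 0) => hy.
- by rewrite expr0n mulr0 mul0r !subr0 normr0 sqr_ge0.
- rewrite expr0n mulr0 mul0r !subr0 ger0_norm ?sqr_ge0//.
  by have := mulr_le0_ge0 hx (ltW hy); have := sqr_ge0 x; lra.
- have := mulr_ge0_le0 (ltW hx) hy; have := sqr_ge0 x; have := sqr_ge0 y.
  by rewrite expr0n /= ler_norml => *; apply/andP; split; lra.
- have -> : y ^+ 2 - x ^+ 2 - 2 * x * (y - x) = (y - x) ^+ 2 by ring.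
  by rewrite ger0_norm// sqr_ge0.
Qed.

Definition ball_fun (A : heis R) : R := 1 - A.1.1 ^+ 2 - A.1.2 ^+ 2 - A.2 ^+ 2.

(** The derivatives of [ball_fun] along the left-invariant frame [d/dx + 2 y d/dz],
    [d/dy - 2 x d/dz]. *)
Definition ball_grad (A : heis R) : R * R :=
  (- (2 * A.1.1) - 4 * A.2 * A.1.2, - (2 * A.1.2) + 4 * A.2 * A.1.1).

(** The square of the positive part has a Lipschitz derivative, which is all that [reg] asks for.
    The factor 4 lifts the function above 1 on the ball of radius 1/2, where [ball_fun] is at least
    11/16. *)
Definition bump (A : heis R) : R := 4 * pos (ball_fun A) ^+ 2.

Definition bump_grad (A : heis R) : R * R := (8 * pos (ball_fun A)) *: ball_grad A.

Lemma ball_fun_coords A : 0 < ball_fun A -> enorm2 A.1 <= 1 /\ `|A.2| <= 1.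
Proof.
rewrite /ball_fun => h; split.
  apply: enorm2_le => //; rewrite expr1n; have := sqr_ge0 A.2; move: h; lra.
rewrite -(ler_pXn2r (ltn0Sn 1)) ?nnegrE// real_normK ?num_real// expr1n.
have := sqr_ge0 A.1.1; have := sqr_ge0 A.1.2; move: h; lra.
Qed.

Lemma ball_grad_le A : 0 < ball_fun A -> enorm2 (ball_grad A) <= 12.
Proof.
move=> /ball_fun_coords[h1 h2]; rewrite (le_trans (enorm2_le_norms _))//=.
have x1 := le_trans (enorm2_ge1 _) h1; have y1 := le_trans (enorm2_ge2 _) h1.
have p1 : `|A.2 * A.1.1| <= 1 by rewrite normrM mulr_ile1.
have p2 : `|A.2 * A.1.2| <= 1 by rewrite normrM mulr_ile1.
have b1 : `|- (2 * A.1.1) - 4 * A.2 * A.1.2| <= 6.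
  by move: x1 p2; rewrite !ler_norml -mulrA; set u := A.2 * _; lra.
have b2 : `|- (2 * A.1.2) + 4 * A.2 * A.1.1| <= 6.
  by move: y1 p1; rewrite !ler_norml -mulrA; set u := A.2 * _; lra.
by move: b1 b2; lra.
Qed.

Lemma ball_taylor A B : 0 < ball_fun A -> heis_dist A B <= 1 ->
  `|taylor_rem ball_fun ball_grad A B| <= 12 * heis_dist A B ^+ 2.
Proof.
move=> /ball_fun_coords[h1 h2] d1; set d := heis_dist A B in d1 *.
have d0 : 0 <= d by exact: heis_dist_ge0.
have hd := heis_dist_hor A B; have vd := heis_dist_ver A B; rewrite -/d in hd vd.
have -> : taylor_rem ball_fun ball_grad A B =
   - (enorm2 (B.1 - A.1) ^+ 2) - 2 * (A.2 * zeta A B)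
   - (zeta A B - 2 * wedge A.1 (B.1 - A.1)) ^+ 2.
  by rewrite enorm2_sqr /taylor_rem /ball_fun /ball_grad /zeta /wedge /dot /=; ring.
have e1 : enorm2 (B.1 - A.1) ^+ 2 <= d ^+ 2 by rewrite ler_pXn2r// ?nnegrE ?enorm2_ge0.
have e2 : `|A.2 * zeta A B| <= d ^+ 2.
  by rewrite normrM -[leRHS]mul1r ler_pM.
have e3 : `|wedge A.1 (B.1 - A.1)| <= d.
  by rewrite (le_trans (wedge_le _ _))// -[leRHS]mul1r ler_pM ?enorm2_ge0.
have e4 : `|zeta A B - 2 * wedge A.1 (B.1 - A.1)| <= 3 * d.
  have dd : d ^+ 2 <= d by rewrite expr2 ler_piMl.
  by move: vd e3; rewrite !ler_norml; move: dd; lra.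
have e5 : (zeta A B - 2 * wedge A.1 (B.1 - A.1)) ^+ 2 <= 9 * d ^+ 2.
  have -> : 9 * d ^+ 2 = (3 * d) ^+ 2 by ring.
  by rewrite -real_normK ?num_real// ler_pXn2r// ?nnegrE// mulr_ge0.
have := sqr_ge0 (enorm2 (B.1 - A.1)); have := sqr_ge0 (zeta A B - 2 * wedge A.1 (B.1 - A.1)).
move: e1 e2 e5; rewrite !ler_norml; set a := (_ - 2 * wedge _ _) ^+ 2; set b := enorm2 _ ^+ 2.
lra.
Qed.

Lemma ball_lip A B : 0 < ball_fun A -> heis_dist A B <= 1 ->
  `|ball_fun B - ball_fun A| <= 24 * heis_dist A B.
Proof.
move=> hA d1; have := ball_taylor hA d1; have g := ball_grad_le hA.
have d0 := heis_dist_ge0 A B.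
have -> : ball_fun B - ball_fun A = taylor_rem ball_fun ball_grad A B + dot (ball_grad A) (B.1 - A.1).
  by rewrite /taylor_rem subrK.
have e : `|dot (ball_grad A) (B.1 - A.1)| <= 12 * heis_dist A B.
  by rewrite (le_trans (dot_le _ _))// ler_pM ?enorm2_ge0 ?heis_dist_hor.
have dd : heis_dist A B ^+ 2 <= heis_dist A B by rewrite expr2 ler_piMl.
have := ler_normD (taylor_rem ball_fun ball_grad A B) (dot (ball_grad A) (B.1 - A.1)).
move: e dd; lra.
Qed.

Lemma ball_fun_le1 A : ball_fun A <= 1.
Proof.
rewrite /ball_fun; have := sqr_ge0 A.2; have := sqr_ge0 A.1.1; have := sqr_ge0 A.1.2; lra.
Qed.

Lemma pos_ball_le1 A : pos (ball_fun A) <= 1.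
Proof. by rewrite /pos ge_max ball_fun_le1 ler01. Qed.

Lemma bump_ge0 A : 0 <= bump A.
Proof. by rewrite mulr_ge0// sqr_ge0. Qed.

Lemma bump_le A : bump A <= 4.
Proof. by rewrite -[leRHS]mulr1 ler_wpM2l// expr_le1 ?pos_ge0 ?pos_ball_le1. Qed.

(** The constant is [4 * 24 ^+ 2 + 8 * 12], attained in the case of [A] inside the ball and [B]
    within distance 1. If [A] is outside and [B] inside, [ball_lip] is used from [B], where the
    gradient is controlled. *)
Lemma bump_reg : reg 1 (24 * 100) bump bump_grad.
Proof.
split=> [A|A B].
  by rewrite ger0_norm ?bump_ge0// (le_trans (bump_le A))//; lra.
rewrite divr1; set d := heis_dist A B.
have d0 : 0 <= d by exact: heis_dist_ge0.
have grad12 : enorm2 (bump_grad A) <= 96.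
  rewrite enorm2Z ger0_norm ?mulr_ge0 ?pos_ge0//.
  have [hA|hA] := leP (ball_fun A) 0.
    by rewrite /pos (max_idPr hA) mulr0 mul0r.
  have -> : 96 = (8 * 1) * 12 :> R by ring.
  by rewrite ler_pM ?enorm2_ge0 ?ball_grad_le ?mulr_ge0 ?pos_ge0// ler_wpM2l// pos_ball_le1.
have [d1|d1] := leP 1 d.
  have e : `|dot (bump_grad A) (B.1 - A.1)| <= 96 * d.
    by rewrite (le_trans (dot_le _ _))// ler_pM ?enorm2_ge0 ?heis_dist_hor.
  have dd : d <= d ^+ 2 by rewrite expr2 ler_peMl.
  have := bump_ge0 A; have := bump_ge0 B; have := bump_le A; have := bump_le B.
  by move: e; rewrite /taylor_rem !ler_norml; lra.
have {}d1 := ltW d1.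
have [hA|hA] := leP (ball_fun A) 0.
  have pA : pos (ball_fun A) = 0 by rewrite /pos (max_idPr hA).
  have -> : taylor_rem bump bump_grad A B = bump B.
    by rewrite /taylor_rem /bump_grad pA mulr0 scale0r dot0l subr0 /bump pA expr0n mulr0 subr0.
  rewrite ger0_norm ?bump_ge0// /bump.
  have [hB|hB] := leP (ball_fun B) 0.
    by rewrite /pos (max_idPr hB) expr0n mulr0; have := sqr_ge0 d; lra.
  have := @ball_lip B A hB; rewrite heis_distC -/d => /(_ d1) h.
  have hh : pos (ball_fun B) <= 24 * d.
    by rewrite /pos (max_idPl (ltW hB)); move: h; rewrite ler_norml; move: hA; lra.
  have : pos (ball_fun B) ^+ 2 <= (24 * d) ^+ 2 by rewrite ler_pXn2r// ?nnegrE ?pos_ge0// mulr_ge0.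
  rewrite exprMn; have := sqr_ge0 d; lra.
have -> : taylor_rem bump bump_grad A B =
   4 * (pos (ball_fun B) ^+ 2 - pos (ball_fun A) ^+ 2 - 2 * pos (ball_fun A) * (ball_fun B - ball_fun A))
   + 8 * (pos (ball_fun A) * taylor_rem ball_fun ball_grad A B).
  by rewrite /taylor_rem /bump /bump_grad dotZl; ring.
have e1 := pos_taylor (ball_fun A) (ball_fun B).
have e2 : (ball_fun B - ball_fun A) ^+ 2 <= (24 * d) ^+ 2.
  by rewrite -real_normK ?num_real// ler_pXn2r// ?nnegrE ?mulr_ge0// ball_lip.
have e3 : `|pos (ball_fun A) * taylor_rem ball_fun ball_grad A B| <= 12 * d ^+ 2.
  rewrite normrM -[leRHS]mul1r ler_pM//; last exact: ball_taylor.
  by rewrite ger0_norm ?pos_ge0 ?pos_ball_le1.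
move: e1 e2 e3; rewrite exprMn !ler_norml.
set x := pos _ ^+ 2 - _ - _; set y := pos _ * _; lra.
Qed.

(** The dilation of factor [r^-1] after the left translation by the inverse of [C]: a similarity, so
    every estimate on [bump] transfers to the ball of centre [C] and radius [r] with the same
    constant. *)
Definition recenter (C : heis R) (r : R) (A : heis R) : heis R :=
  (r^-1 *: (A.1 - C.1), zeta C A / r ^+ 2).

Lemma recenter_dist C r A B : 0 < r ->
  heis_dist (recenter C r A) (recenter C r B) = heis_dist A B / r.
Proof.
move=> r0; have ri : 0 <= r^-1 by rewrite invr_ge0 ltW.
rewrite !heis_distE /recenter /= -scalerBr.
have -> : B.1 - C.1 - (A.1 - C.1) = B.1 - A.1 by rewrite opprB subrKA.
have -> : zeta (r^-1 *: (A.1 - C.1), zeta C A / r ^+ 2) (r^-1 *: (B.1 - C.1), zeta C B / r ^+ 2)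
   = zeta A B * r^-1 ^+ 2.
  rewrite /zeta -[_ *: (A.1 - _)]/(r^-1 * (A.1.1 - C.1.1), r^-1 * (A.1.2 - C.1.2)).
  rewrite -[_ *: (B.1 - _)]/(r^-1 * (B.1.1 - C.1.1), r^-1 * (B.1.2 - C.1.2)) /wedge /=.
  by field; rewrite gt_eqF.
rewrite enorm2Z normrM (ger0_norm (sqr_ge0 _)) sqrtrM// sqrtr_sqr (ger0_norm ri).
by rewrite mulrC -maxr_pMl.
Qed.

Definition bump_at C r A := bump (recenter C r A).
Definition bump_at_grad C r A := r^-1 *: bump_grad (recenter C r A).

Lemma bump_at_reg C r : 0 < r -> reg r (24 * 100) (bump_at C r) (bump_at_grad C r).
Proof.
move=> r0; have [h1 h2] := bump_reg; split=> [A|A B]; first exact: h1.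
have := h2 (recenter C r A) (recenter C r B); rewrite divr1 recenter_dist//.
congr (`|_| <= _); rewrite /taylor_rem; congr (_ - _ - _).
have -> : (recenter C r B).1 - (recenter C r A).1 = r^-1 *: (B.1 - A.1).
  by rewrite -scalerBr opprB subrKA.
by rewrite dotZr /bump_at_grad [in RHS]dotZl.
Qed.

Lemma bump_at_ge0 C r A : 0 <= bump_at C r A.
Proof. exact: bump_ge0. Qed.

Lemma bump_at_supp C r A : 0 < r -> ~~ (heis_dist C A <= r) ->
  bump_at C r A = 0 /\ bump_at_grad C r A = 0.
Proof.
move=> r0 far; suff h : ball_fun (recenter C r A) <= 0.
  by rewrite /bump_at /bump_at_grad /bump /bump_grad /pos (max_idPr h) expr0n !mulr0 scale0r scaler0.
rewrite leNgt; apply: contra far => /ball_fun_coords[/= h1 h2].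
apply: heis_dist_le; first exact: ltW.
  by move: h1; rewrite enorm2Z gtr0_norm ?invr_gt0// ler_pdivrMl// mulr1.
move: h2; rewrite normrM normfV (ger0_norm (sqr_ge0 r)) ler_pdivrMr ?mul1r//.
by rewrite exprn_gt0.
Qed.

Lemma bump_at_ge1 C r A : 0 < r -> heis_dist C A <= r / 2 -> 1 <= bump_at C r A.
Proof.
move=> r0 near.
have h1 : enorm2 (recenter C r A).1 <= 1 / 2.
  rewrite enorm2Z gtr0_norm ?invr_gt0// ler_pdivrMl//.
  by rewrite (le_trans (heis_dist_hor _ _))// (le_trans near)//; lra.
have h2 : `|(recenter C r A).2| <= 1 / 4.
  rewrite normrM normfV (ger0_norm (sqr_ge0 r)) ler_pdivrMr ?exprn_gt0//.
  rewrite (le_trans (heis_dist_ver _ _))// (@le_trans _ _ ((r / 2) ^+ 2))//.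
    by rewrite ler_pXn2r// ?nnegrE ?heis_dist_ge0// divr_ge0// ltW.
  by rewrite expr_div_n; lra.
have h3 : enorm2 (recenter C r A).1 ^+ 2 <= (1 / 2) ^+ 2.
  by rewrite ler_pXn2r// ?nnegrE ?enorm2_ge0// divr_ge0.
have h4 : (recenter C r A).2 ^+ 2 <= (1 / 4) ^+ 2.
  by rewrite -real_normK ?num_real// ler_pXn2r// ?nnegrE// divr_ge0.
have h5 : 11 / 16 <= pos (ball_fun (recenter C r A)).
  rewrite /pos le_max; apply/orP; left; rewrite /ball_fun.
  by move: h3 h4; rewrite enorm2_sqr; lra.
rewrite /bump_at /bump; have : (11 / 16) ^+ 2 <= pos (ball_fun (recenter C r A)) ^+ 2.
  by rewrite ler_pXn2r// ?nnegrE ?pos_ge0// divr_ge0.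
lra.
Qed.

End Bump.

Section ReciprocalCutoff.
Context {R : realType}.

(* A [C^{1,1}] function on the half line that agrees with [1/s] for [s >= 1]. *)
Definition recip (s : R) : R := if 1 <= s then s^-1 else 2 - s.
Definition recip' (s : R) : R := if 1 <= s then - s^-1 ^+ 2 else -1.

Lemma recip_le s : 0 <= s -> `|recip s| <= 2.
Proof.
rewrite /recip => s0; case: (leP 1 s) => s1; last by rewrite ler_norml; apply/andP; split; lra.
have i1 : s^-1 <= 1 by rewrite invf_le1// (lt_le_trans ltr01).
by rewrite ger0_norm ?invr_ge0//; lra.
Qed.

Lemma recip'_le s : 0 <= s -> `|recip' s| <= 2.
Proof.
rewrite /recip' => s0; case: (leP 1 s) => s1; last by rewrite normrN normr1; lra.
have i0 : 0 <= s^-1 by rewrite invr_ge0.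
have i1 : s^-1 <= 1 by rewrite invf_le1// (lt_le_trans ltr01).
by rewrite normrN ger0_norm ?sqr_ge0// (@le_trans _ _ 1) ?expr_le1//; lra.
Qed.

Lemma recip_taylor s t : 0 <= s -> 0 <= t ->
  `|recip t - recip s - recip' s * (t - s)| <= 2 * (t - s) ^+ 2.
Proof.
rewrite /recip /recip' => s0 t0; case: (leP 1 s) => s1; case: (leP 1 t) => t1.
- have sp : 0 < s by rewrite (lt_le_trans ltr01).
  have tp : 0 < t by rewrite (lt_le_trans ltr01).
  have -> : t^-1 - s^-1 - - s^-1 ^+ 2 * (t - s) = (t - s) ^+ 2 * (s^-1 ^+ 2 * t^-1).
    by field; rewrite !gt_eqF.
  have i1 : s^-1 ^+ 2 * t^-1 <= 1.
    have si0 : 0 <= s^-1 by rewrite invr_ge0.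
    have si1 : s^-1 <= 1 by rewrite invf_le1.
    have ti1 : t^-1 <= 1 by rewrite invf_le1.
    by rewrite mulr_ile1 ?sqr_ge0 ?invr_ge0// expr_le1.
  have i0 : 0 <= s^-1 ^+ 2 * t^-1 by rewrite mulr_ge0 ?sqr_ge0 ?invr_ge0.
  rewrite ger0_norm; last by apply: mulr_ge0 => //; exact: sqr_ge0.
  have := ler_piMr (sqr_ge0 (t - s)) i1; have := sqr_ge0 (t - s); lra.
- have sp : 0 < s by rewrite (lt_le_trans ltr01).
  set i := s^-1; have i0 : 0 <= i by rewrite invr_ge0.
  have i1 : i <= 1 by rewrite invf_le1.
  have is1 : i * s = 1 by rewrite mulVf ?gt_eqF.
  have -> : 2 - t - i - - i ^+ 2 * (t - s) = (1 - i) ^+ 2 + (1 - t) * (1 - i ^+ 2).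
    have -> : - i ^+ 2 * (t - s) = - i ^+ 2 * t + i * (i * s) by ring.
    by rewrite is1; ring.
  have e1 : 0 <= 1 - i by rewrite subr_ge0.
  have e2 : 1 - i <= s - 1.
    have -> : 1 - i = i * (s - 1) by rewrite mulrBr is1 mulr1.
    by rewrite ler_piMl// subr_ge0.
  have e3 : 0 <= 1 - t by rewrite subr_ge0 ltW.
  have e4 : 0 <= 1 - i ^+ 2 by rewrite subr_ge0 expr_le1.
  have e5 : 1 - i ^+ 2 <= 2 * (1 - i).
    have -> : 1 - i ^+ 2 = (1 + i) * (1 - i) by ring.
    by rewrite ler_wpM2r//; move: i1; lra.
  rewrite ger0_norm ?addr_ge0 ?sqr_ge0 ?mulr_ge0//.
  have e6 : (1 - i) ^+ 2 <= (s - 1) ^+ 2 by rewrite ler_pXn2r// ?nnegrE// (le_trans e1).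
  have e7 : (1 - t) * (1 - i ^+ 2) <= (1 - t) * (2 * (s - 1)).
    by rewrite ler_wpM2l// (le_trans e5)// ler_pM2l.
  have e8 := sqr_ge0 (1 - t); have e9 := sqr_ge0 (t - s).
  move: e6 e7 e8 e9; lra.
- have tp : 0 < t by rewrite (lt_le_trans ltr01).
  have -> : t^-1 - (2 - s) - -1 * (t - s) = (t - 1) ^+ 2 * t^-1 by field; rewrite gt_eqF.
  have i0 : 0 <= t^-1 by rewrite invr_ge0.
  have i1 : t^-1 <= 1 by rewrite invf_le1.
  rewrite ger0_norm; last by apply: mulr_ge0 => //; exact: sqr_ge0.
  have e1 : (t - 1) ^+ 2 * t^-1 <= (t - 1) ^+ 2 by rewrite ler_piMr ?sqr_ge0.
  have e2 : (t - 1) ^+ 2 <= (t - s) ^+ 2.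
    by rewrite ler_pXn2r// ?nnegrE; move: s1 t1; lra.
  have := sqr_ge0 (t - s); move: e1 e2; lra.
- have -> : 2 - t - (2 - s) - -1 * (t - s) = 0 by ring.
  by rewrite normr0; have := sqr_ge0 (t - s); lra.
Qed.

End ReciprocalCutoff.

Lemma card_window (m W : nat) (P : pred 'I_m) :
  (forall i j, P i -> P j -> (i <= j)%N -> (j <= i + W)%N) ->
  (#|[set i | P i]%SET| <= W.+1)%N.
Proof.
move=> H; have [i0 Pi0|P0] := pickP P; last first.
  by rewrite cardsE eq_card0// => i; rewrite inE P0.
have [k Pk kmin] := arg_minnP (fun i : 'I_m => i : nat) Pi0.
have inj : {in [set i | P i]%SET &, injective (fun i : 'I_m => inord (i - k) : 'I_W.+1)}.
  move=> i j; rewrite !inE => Pi Pj /(congr1 val) /=.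
  have ki := kmin _ Pi; have kj := kmin _ Pj.
  rewrite !inordK ?ltnS ?leq_subLR ?H// => e; apply/val_inj => /=.
  by rewrite -(subnKC ki) -(subnKC kj) e.
by rewrite -(card_in_imset inj) (leq_trans (max_card _))// card_ord.
Qed.

(** * Partitions of unity along a curve *)

Section PartitionOfUnity.
Context {R : realType}.

Record pou := Pou { pou_size : nat; pou_t : 'I_pou_size -> R;
  pou_f : 'I_pou_size -> heis R -> R; pou_g : 'I_pou_size -> heis R -> R * R }.
Arguments pou_t : clear implicits.
Arguments pou_f : clear implicits.
Arguments pou_g : clear implicits.

(** The sum is prescribed only on the curve; elsewhere all functions may vanish. The gradients have
    to be required to sum to zero there, since this does not follow from the values on the curve
    alone. *)
Definition is_pou (lo hi : R) (c : R -> heis R) (r K : R) (N : nat) (P : pou) := [/\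
  forall k, lo <= pou_t P k <= hi,
  forall k, reg r K (pou_f P k) (pou_g P k),
  forall k A, ~~ (heis_dist (c (pou_t P k)) A <= r) -> pou_f P k A = 0 /\ pou_g P k A = 0,
  forall A, (#|[set k | (heis_dist (c (pou_t P k)) A <= r)%R]%SET| <= N)%N &
  forall t, lo <= t -> t <= hi -> \sum_k pou_f P k (c t) = 1 /\ \sum_k pou_g P k (c t) = 0].

Variables (lo hi : R) (c : R -> heis R).
Hypothesis lohi : lo <= hi.
Hypothesis dist_ge : forall t t', lo <= t -> t <= t' -> t' <= hi ->
  (t' - t) / 2 <= heis_dist (c t) (c t') ^+ 2.
Hypothesis dist_le : forall t t', lo <= t -> t <= t' -> t' <= hi ->
  heis_dist (c t) (c t') ^+ 2 <= 2 * (t' - t).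

(** [K] and [N] are chosen before [r]: the squared distance along [c] being comparable to the
    parameter increment, equally spaced centres look alike at every scale. *)
Lemma pou_exists : exists (K : R) (N : nat), 0 <= K /\
  forall r, 0 < r -> exists P, is_pou lo hi c r K N P.
Proof.
have aux (e w : R) : w / 2 <= 2 ^+ 2 * (8 * e) -> w <= 64 * e by rewrite expr2; lra.
pose N := 65%N; pose bK : R := 24 * 100.
pose uK : R := (2 * N)%:R * bK.
pose qK : R := 2 * (1 + uK + 16 * uK ^+ 2).
have bK0 : 0 <= bK by rewrite mulr_ge0.
have uK0 : 0 <= uK by rewrite mulr_ge0.
have qK0 : 0 <= qK by have := sqr_ge0 uK; rewrite /qK; move: uK0; lra.
exists (18 * (bK * qK)), N; split; first by apply: mulr_ge0 => //; exact: mulr_ge0.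
(* With this spacing every point of the curve is within [Num.sqrt (2 * eta) = r / 2] of a centre,
   where its bump is at least 1. Two centres within [r] of the same point are at distance at most
   [2 * r], so their indices differ by at most [8 * r ^+ 2 / eta = 64]. *)
move=> r r0; pose eta := r ^+ 2 / 8.
have eta0 : 0 < eta by rewrite divr_gt0// exprn_gt0.
pose m := (Num.truncn ((hi - lo) / eta)).+1.
pose t (k : 'I_m) : R := lo + k%:R * eta.
have d0 : 0 <= (hi - lo) / eta by rewrite divr_ge0 ?subr_ge0// ltW.
have tI k : lo <= t k <= hi.
  rewrite lerDl mulr_ge0 ?(ltW eta0)//= -lerBrDl -ler_pdivlMr//.
  have /andP[h _] := truncn_itv d0; rewrite (le_trans _ h)// ler_nat -ltnS; exact: ltn_ord.
have tB (i j : 'I_m) : t j - t i = (j%:R - i%:R) * eta by rewrite /t; ring.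
pose psi k := bump_at (c (t k)) r; pose gpsi k := bump_at_grad (c (t k)) r.
have rpsi k : reg r bK (psi k) (gpsi k) by exact: bump_at_reg.
pose S k A := heis_dist (c (t k)) A <= r.
have supp k A : ~~ S k A -> psi k A = 0 /\ gpsi k A = 0 by exact: bump_at_supp.
have card A : (#|[set k | S k A]%SET| <= N)%N.
  apply: card_window => i j Si Sj ij.
  have /andP[i1 _] := tI i; have /andP[_ j2] := tI j.
  have tij : t i <= t j by rewrite -subr_ge0 tB mulr_ge0 ?(ltW eta0)// subr_ge0 ler_nat.
  have h1 := dist_ge i1 tij j2.
  have h2 : heis_dist (c (t i)) (c (t j)) <= 2 * r.
    rewrite (le_trans (heis_dist_triangle A _ _))// (heis_distC A) mulr2n mulrDl mul1r.
    exact: lerD.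
  have h3 : heis_dist (c (t i)) (c (t j)) ^+ 2 <= (2 * r) ^+ 2.
    by rewrite ler_pXn2r// ?nnegrE ?heis_dist_ge0// mulr_ge0// ltW.
  have h4 : (j%:R - i%:R) * eta <= 64%:R * eta.
    move: (le_trans h1 h3); rewrite tB exprMn.
    have -> : r ^+ 2 = 8 * eta by rewrite /eta; field.
    exact: aux.
  rewrite ler_pM2r// lerBlDl -natrD ler_nat in h4.
  exact: h4.
pose u A := \sum_k psi k A; pose gu A := \sum_k gpsi k A.
have ru : reg r uK u gu by apply: (reg_sum (S := S)).
have u0 A : 0 <= u A by apply: sumr_ge0 => k _; exact: bump_at_ge0.
have u1 s : lo <= s -> s <= hi -> 1 <= u (c s).
  move=> ls sh; have e0 : 0 <= (s - lo) / eta by rewrite divr_ge0 ?subr_ge0// ltW.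
  have /andP[k1 k2] := truncn_itv e0; set k0 := Num.truncn _ in k1 k2.
  have km : (k0 < m)%N.
    by rewrite ltnS; apply: le_truncn; rewrite ler_pM2r ?invr_gt0// lerB.
  pose k : 'I_m := Ordinal km.
  have ts : t k <= s by rewrite -lerBrDl -ler_pdivlMr.
  have st : s - t k <= eta.
    move: k2; rewrite ltr_pdivrMr// -natr1 mulrDl mul1r /t /=; set w := _ * eta; lra.
  have near : heis_dist (c (t k)) (c s) <= r / 2.
    rewrite -(ler_pXn2r (ltn0Sn 1)) ?nnegrE ?heis_dist_ge0 ?divr_ge0 ?(ltW r0)//.
    have /andP[l1 _] := tI k.
    rewrite (le_trans (dist_le l1 ts sh))// expr_div_n.
    by move: st; rewrite /eta; lra.
  rewrite /u (bigD1 k)//= (le_trans (bump_at_ge1 r0 near))// lerDl.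
  by apply: sumr_ge0 => j _; exact: bump_at_ge0.
(* [u] vanishes far from the curve, so division by it is replaced by [recip]; the two agree on the
   curve, where [u] is at least 1. *)
have rq := reg_comp r0 ru u0 recip_le recip'_le recip_taylor.
exists (@Pou m t (fun k A => psi k A * recip (u A))
  (fun k A => psi k A *: (recip' (u A) *: gu A) + recip (u A) *: gpsi k A)).
split => //=.
- by move=> k; exact: reg_mul r0 (rpsi k) rq.
- by move=> k A /supp[-> ->]; rewrite mul0r scale0r scaler0 addr0.
- move=> s ls sh; have us := u1 s ls sh.
  have un0 : u (c s) != 0 by rewrite gt_eqF// (lt_le_trans ltr01).
  rewrite -mulr_suml -/(u (c s)) big_split/=.
  have -> V : \sum_k psi k (c s) *: V = u (c s) *: V :> R * R by rewrite scaler_suml.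
  have -> W : \sum_k W *: gpsi k (c s) = W *: gu (c s) by rewrite scaler_sumr.
  rewrite /recip /recip' us mulfV//; split => //.
  by rewrite scalerA -scalerDl mulrN expr2 mulrA mulfV// mul1r addNr scale0r.
Qed.

End PartitionOfUnity.

Arguments pou_t {R} p _.
Arguments pou_f {R} p _ _.
Arguments pou_g {R} p _ _.

(** * Summation over dyadic scales *)

Section DyadicScales.
Context {R : realType}.

Definition scale (n : nat) : R := 2^-1 ^+ n.

Lemma scale_gt0 n : 0 < scale n.
Proof. by rewrite exprn_gt0// invr_gt0. Qed.

Lemma scaleS n : scale n.+1 = scale n / 2.
Proof. by rewrite /scale exprSr. Qed.

Lemma scale_le1 n : scale n <= 1.
Proof. by rewrite exprn_ile1//; lra. Qed.

Lemma scale_small (e : R) : 0 < e -> \forall n \near \oo, scale n <= e.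
Proof.
move=> e0; have := @cvg_expr R 2^-1; rewrite ger0_norm ?invr_ge0// => /(_ ltac:(lra)).
by move/cvgrPdist_le => /(_ _ e0); apply: filterS => n /=; rewrite sub0r normrN ger0_norm// ltW// scale_gt0.
Qed.

Lemma ler_sum_telescope (x P : nat -> R) N :
  (forall n, x n <= P n - P n.+1) -> \sum_(n < N) x n <= P 0%N - P N.
Proof.
move=> H; elim: N => [|N IH]; first by rewrite big_ord0 subrr.
by rewrite big_ord_recr/=; have := H N; move: IH; lra.
Qed.

(* Scales above [d] are controlled by the quadratic bound and scales below [d] by the linear one; both
   geometric series are dominated by the terms with [scale n] close to [d]. *)
Lemma sum_scales (a : R) : 0 < a -> a < 1 -> exists2 C : R, 0 <= C &
  forall (d k : R) (x : nat -> R) N, 0 <= d -> 0 <= k ->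
  (forall n, x n <= k * (scale n `^ (1 + a) * (d / scale n) ^+ 2)) ->
  (forall n, x n <= k * (scale n `^ (1 + a) * (d / scale n))) ->
  \sum_(n < N) x n <= k * C * d `^ (1 + a).
Proof.
move=> a0 a1; pose b := 1 - a; have b0 : 0 < b by rewrite subr_gt0.
pose theta : R := 2^-1 `^ a; have th1 : 0 < 1 - theta.
  by rewrite subr_gt0 powR_lt1 ?invr_ge0//; lra.
pose q : R := 2 `^ b; have q1 : 0 < q - 1.
  have e1 : (1 : R) `^ b = 1 by rewrite powR1.
  by rewrite subr_gt0 -{1}e1 lt_powR//; lra.
pose C1 := (1 - theta)^-1; pose C2 := (q - 1)^-1.
have C10 : 0 <= C1 by rewrite invr_ge0 ltW.
have C20 : 0 <= C2 by rewrite invr_ge0 ltW.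
exists (C1 * 2 `^ a + C2); first by rewrite addr_ge0// mulr_ge0// powR_ge0.
move=> d k x N; rewrite le_eqVlt => /predU1P[<-|d0] k0 Hq Hl.
  apply: (@le_trans _ _ 0); last by rewrite !mulr_ge0 ?addr_ge0 ?mulr_ge0 ?powR_ge0.
  by apply: sumr_le0 => n _; rewrite (le_trans (Hl n))// mul0r !mulr0.
(* Telescoping potentials: [P1] pays for the scales up to [2 * d] and is constant above [2 * d],
   [P2] pays for the larger ones. The threshold is [2 * d] rather than [d] so that the scale
   following a large one is still at least [d]. Convergence needs [a > 0] for small scales and
   [a < 1] for large ones. *)
pose P1 n := C1 * d * Num.min (scale n) (2 * d) `^ a.
pose P2 n := - (C2 * d ^+ 2 * (Num.max (scale n) d `^ b)^-1).
pose P n := k * (P1 n + P2 n).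
have half_le n : scale n.+1 <= scale n by rewrite scaleS; have := scale_gt0 n; lra.
have d20 : 0 <= 2 * d by rewrite mulr_ge0// ltW.
have d2 : 0 <= d ^+ 2 by exact: sqr_ge0.
have cd : 0 <= C2 * d ^+ 2 by exact: mulr_ge0.
have min0 n : 0 <= Num.min (scale n) (2 * d) by rewrite le_min d20 ltW// scale_gt0.
have max0 n : 0 < Num.max (scale n) d by rewrite lt_max d0 orbT.
have mono1 n : 0 <= P1 n - P1 n.+1.
  rewrite subr_ge0 ler_wpM2l ?mulr_ge0 ?(ltW d0)//; apply: le_powR => //; first exact: ltW.
  by rewrite le_min !ge_min lexx orbT half_le.
have mono2 n : 0 <= P2 n - P2 n.+1.
  rewrite /P2 opprK addrC subr_ge0 (ler_wpM2l cd)//.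
  rewrite lef_pV2 ?posrE ?powR_gt0//; apply: le_powR; [exact: ltW|exact: ltW|].
  by rewrite ge_max !le_max lexx orbT half_le.
have step n : x n <= P n - P n.+1.
  have sn := scale_gt0 n; have sn' := scale_gt0 n.+1.
  rewrite /P -mulrBr opprD addrACA.
  have [h|h] := leP (scale n) (2 * d).
    rewrite (le_trans (Hl n))// ler_wpM2l//.
    rewrite (@le_trans _ _ (P1 n - P1 n.+1))//; last by rewrite lerDl.
    have h' : scale n.+1 <= 2 * d by rewrite (le_trans (half_le n)).
    rewrite /P1 (min_idPl h) (min_idPl h') scaleS powRM ?invr_ge0// ?(ltW sn)// -/theta.
    rewrite powR1D// ?(ltW sn)// le_eqVlt; apply/orP; left; apply/eqP.
    have -> : C1 * d * scale n `^ a - C1 * d * (scale n `^ a * theta) = C1 * (1 - theta) * (d * scale n `^ a) by ring.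
    by rewrite /C1 mulVf ?gt_eqF// mul1r; field; rewrite gt_eqF.
  rewrite (le_trans (Hq n))// ler_wpM2l//.
  rewrite (@le_trans _ _ (P2 n - P2 n.+1))//; last by rewrite lerDr.
  have h1 : d <= scale n.+1 by rewrite scaleS; move: h; lra.
  have h2 : d <= scale n by rewrite (le_trans h1).
  rewrite /P2 (max_idPl h1) (max_idPl h2) opprK [leRHS]addrC -mulrBr.
  have sb : scale n `^ b != 0 by rewrite gt_eqF// powR_gt0.
  have -> : scale n `^ b = 2 `^ b * scale n.+1 `^ b.
    by rewrite -powRM ?(ltW sn')//; congr (_ `^ _); rewrite scaleS; field.
  have sb' : scale n.+1 `^ b != 0 by rewrite gt_eqF// powR_gt0.
  have q0 : q != 0 by rewrite gt_eqF// (lt_trans ltr01)// -subr_gt0.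
  have -> : C2 * d ^+ 2 * ((scale n.+1 `^ b)^-1 - (2 `^ b * scale n.+1 `^ b)^-1) =
     C2 * (q - 1) * (d ^+ 2 * (q * scale n.+1 `^ b)^-1).
    by rewrite -/q; field; rewrite ?q0 ?sb'.
  rewrite /C2 mulVf ?gt_eqF// mul1r le_eqVlt; apply/orP; left; apply/eqP.
  have -> : q * scale n.+1 `^ b = scale n `^ b.
    by rewrite -powRM ?(ltW sn')//; congr (_ `^ _); rewrite scaleS; field.
  have e : scale n `^ (1 + a) * scale n `^ b = scale n ^+ 2.
    rewrite -powRD ?(gt_eqF sn) ?implybT// -powR_mulrn ?(ltW sn)//; congr (_ `^ _).
    by rewrite /b; ring.
  have -> : scale n `^ (1 + a) = scale n ^+ 2 / scale n `^ b by rewrite -e mulfK.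
  by field; rewrite ?sb ?gt_eqF.
rewrite (le_trans (ler_sum_telescope N step))// /P -mulrBr -mulrA ler_wpM2l//.
have e1 : P1 0%N <= C1 * 2 `^ a * d `^ (1 + a).
  have -> : C1 * 2 `^ a * d `^ (1 + a) = C1 * d * (2 * d) `^ a.
    by rewrite powR1D ?(ltW d0)// powRM ?(ltW d0)//; ring.
  rewrite ler_wpM2l ?mulr_ge0 ?(ltW d0)//; apply: le_powR => //; first exact: ltW.
  by rewrite ge_min lexx orbT.
have e2 : - P2 N <= C2 * d `^ (1 + a).
  rewrite /P2 opprK -mulrA ler_wpM2l//.
  rewrite (@le_trans _ _ (d ^+ 2 * (d `^ b)^-1))//.
    rewrite ler_wpM2l// lef_pV2 ?posrE ?powR_gt0//; apply: le_powR; [exact: ltW|exact: ltW|].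
    by rewrite le_max lexx orbT.
  rewrite ler_pdivrMr ?powR_gt0// -powRD ?(gt_eqF d0) ?implybT// -powR_mulrn ?(ltW d0)//.
  by rewrite (_ : 1 + a + b = 2%:R)//; rewrite /b; ring.
have p1 : 0 <= P1 N by rewrite !mulr_ge0 ?powR_ge0 ?(ltW d0).
have p2 : P2 0%N <= 0.
  by rewrite oppr_le0 mulr_ge0// invr_ge0 powR_ge0.
move: e1 e2 p1 p2; rewrite mulrDl; lra.
Qed.

End DyadicScales.

(** * Averages of the data at one scale and their differences *)

Section WhitneyExtension.
Context {R : realType}.

Lemma enorm2_sum (I : finType) (G : I -> R * R) : enorm2 (\sum_i G i) <= \sum_i enorm2 (G i).
Proof.
elim/big_ind2 : _ => [|u x v y hu hv|i _]; rewrite ?enorm20//.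
by rewrite (le_trans (enorm2D _ _))// lerD.
Qed.

Lemma reg_taylor_lin (r K : R) f G (A B : heis R) : 0 < r -> reg r K f G ->
  `|taylor_rem f G A B| <= 7 * K * (heis_dist A B / r).
Proof.
move=> r0 rf; have h1 := reg_lip A B r0 rf; have h2 := reg_grad A r0 rf.
rewrite /taylor_rem (le_trans (ler_normB _ _))//.
have h3 : `|dot (G A) (B.1 - A.1)| <= 3 * K / r * heis_dist A B.
  by rewrite (le_trans (dot_le _ _))// ler_pM ?enorm2_ge0 ?heis_dist_hor.
rewrite (le_trans (lerD h1 h3))// le_eqVlt; apply/orP; left; apply/eqP; ring.
Qed.

Variables (a C lo hi : R) (c : R -> heis R) (gam : R -> R).
Hypotheses (a0 : 0 < a) (a1 : a < 1) (C0 : 0 <= C) (lohi : lo <= hi).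
Hypothesis gam_dist : forall t t', lo <= t <= hi -> lo <= t' <= hi ->
  `|gam t - gam t'| <= C * heis_dist (c t) (c t') `^ (1 + a).

Variables (K : R) (N : nat).
Hypothesis K0 : 0 <= K.
Notation ispou := (is_pou lo hi c).

Definition pou_val (P : @pou R) (A : heis R) : R := \sum_k gam (pou_t P k) * pou_f P k A.
Definition pou_grad (P : @pou R) (A : heis R) : R * R := \sum_k gam (pou_t P k) *: pou_g P k A.

Let ap : 0 < 1 + a. Proof. by rewrite addr_gt0. Qed.

Lemma pou_val_close r (P : @pou R) t : 0 < r -> ispou r K N P -> lo <= t <= hi ->
  `|pou_val P (c t) - gam t| <= N%:R * (C * r `^ (1 + a) * K).
Proof.
move=> r0 [tI rp sp cp sm] tt; have /andP[lt th] := tt; have [s1 _] := sm t lt th.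
have -> : pou_val P (c t) - gam t = \sum_k (gam (pou_t P k) - gam t) * pou_f P k (c t).
  under [in RHS]eq_bigr do rewrite mulrBl.
  by rewrite sumrB -mulr_sumr s1 mulr1.
rewrite (le_trans (ler_norm_sum _ _ _))//.
have kk : 0 <= C * r `^ (1 + a) * K by rewrite !mulr_ge0// powR_ge0.
apply: (sum_supp_le (P := fun k => heis_dist (c (pou_t P k)) (c t) <= r)) => //.
- move=> k; have [near|/sp[-> _]] := boolP (heis_dist (c (pou_t P k)) (c t) <= r); last first.
    by rewrite mulr0 normr0.
  rewrite normrM; apply: ler_pM => //; last by have [h _] := rp k.
  rewrite (le_trans (gam_dist (tI k) tt))// ler_wpM2l//.
  by apply: le_powR => //; [exact: ltW|exact: heis_dist_ge0].
- by move=> k /sp[-> _]; rewrite mulr0.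
Qed.

(** Since the gradients sum to zero on the curve, [gam t] may be subtracted from every coefficient.
    What remains is of order [r]^ (1 + a) / r = r [^ a], so the gradient vanishes on the curve in
    the limit. *)
Lemma pou_grad_small r (P : @pou R) t : 0 < r -> ispou r K N P -> lo <= t <= hi ->
  enorm2 (pou_grad P (c t)) <= N%:R * (C * r `^ (1 + a) * (3 * K / r)).
Proof.
move=> r0 [tI rp sp cp sm] tt; have /andP[lt th] := tt; have [_ s0] := sm t lt th.
have -> : pou_grad P (c t) = \sum_k (gam (pou_t P k) - gam t) *: pou_g P k (c t).
  under [in RHS]eq_bigr do rewrite scalerBl.
  by rewrite sumrB -scaler_sumr s0 scaler0 subr0.
rewrite (le_trans (enorm2_sum _))//.
under eq_bigr => k _ do rewrite -(ger0_norm (enorm2_ge0 _)).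
have Kr : 0 <= 3 * K / r by apply: divr_ge0; [exact: mulr_ge0|exact: ltW].
have kk : 0 <= C * r `^ (1 + a) * (3 * K / r).
  by apply: mulr_ge0 => //; apply: mulr_ge0 => //; exact: powR_ge0.
apply: (sum_supp_le (P := fun k => heis_dist (c (pou_t P k)) (c t) <= r)) => //.
- move=> k; rewrite ger0_norm ?enorm2_ge0//.
  have [near|/sp[_ ->]] := boolP (heis_dist (c (pou_t P k)) (c t) <= r); last first.
    by rewrite scaler0 enorm20.
  rewrite enorm2Z; apply: ler_pM; rewrite ?enorm2_ge0//; last exact: reg_grad r0 (rp k).
  rewrite (le_trans (gam_dist (tI k) tt))// ler_wpM2l//.
  by apply: le_powR => //; [exact: ltW|exact: heis_dist_ge0].
- by move=> k /sp[_ ->]; rewrite scaler0 enorm20.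
Qed.

Lemma pou_base r (P : @pou R) : 0 < r -> ispou r K N P ->
  exists2 K' : R, 0 <= K' & reg r K' (pou_val P) (pou_grad P).
Proof.
move=> r0 [tI rp sp cp sm]; pose G := \sum_k `|gam (pou_t P k)|.
have G0 : 0 <= G by apply: sumr_ge0.
have GK : 0 <= G * K by exact: mulr_ge0.
exists ((2 * N)%:R * (G * K)); first exact: mulr_ge0.
apply: (reg_sum (S := fun k A => heis_dist (c (pou_t P k)) A <= r)) => //.
- move=> k; apply: reg_le (reg_scale _ (rp k)); apply: ler_wpM2r => //.
  by rewrite /G (bigD1 k)//= lerDl sumr_ge0.
- by move=> k A /sp[-> ->]; rewrite mulr0 scaler0.
Qed.

Lemma pou_step r (P P' : @pou R) : 0 < r -> ispou (r / 2) K N P -> ispou r K N P' ->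
  exists f G, reg r ((2 * (N * N))%:R * (4 * C * (18 * (4 * K * K))) * r `^ (1 + a)) f G /\
  forall t, lo <= t <= hi -> f (c t) = pou_val P (c t) - pou_val P' (c t) /\
    G (c t) = pou_grad P (c t) - pou_grad P' (c t).
Proof.
move=> r0 HP HP'; have r20 : 0 < r / 2 by rewrite divr_gt0.
have [tI rp sp cp sm] := HP; have [tI' rp' sp' cp' sm'] := HP'.
pose near (i : 'I_(pou_size P) * 'I_(pou_size P')) :=
  heis_dist (c (pou_t P i.1)) (c (pou_t P' i.2)) <= 2 * r.
(* Truncation makes every coefficient small and changes no term: if two centres are more than
   [2 * r] apart, one of the two partition functions vanishes at each point. *)
pose e i := if near i then gam (pou_t P i.1) - gam (pou_t P' i.2) else 0.
pose f i A := e i * (pou_f P i.1 A * pou_f P' i.2 A).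
pose G i A := e i *: (pou_f P i.1 A *: pou_g P' i.2 A + pou_f P' i.2 A *: pou_g P i.1 A).
pose S i A := (heis_dist (c (pou_t P i.1)) A <= r / 2) && (heis_dist (c (pou_t P' i.2)) A <= r).
have rr : 0 <= r `^ (1 + a) by exact: powR_ge0.
have e_le i : `|e i| <= 4 * C * r `^ (1 + a).
  rewrite /e; case: ifPn => [nr|_]; last first.
    by rewrite normr0; apply: mulr_ge0 => //; exact: mulr_ge0.
  rewrite (le_trans (gam_dist (tI _) (tI' _)))// -mulrA mulrCA ler_wpM2l//.
  rewrite (le_trans (le_powR (ltW ap) (heis_dist_ge0 _ _) nr))//.
  have r2 : 0 <= 2 * r by rewrite mulr_ge0// ltW.
  rewrite !powR1D// ?(ltW r0)//.
  have : (2 * r) `^ a <= 2 * r `^ a by apply: powRMl_le; [lra|exact: ltW|exact: ltW|exact: ltW].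
  move/(ler_wpM2l r2); set x := r `^ a; lra.
have far i A : ~~ near i -> (pou_f P i.1 A = 0 /\ pou_g P i.1 A = 0) \/ (pou_f P' i.2 A = 0 /\ pou_g P' i.2 A = 0).
  move=> nr; have [h1|/sp h1] := boolP (heis_dist (c (pou_t P i.1)) A <= r / 2); last by left.
  right; apply: sp'; apply: contra nr => h2; rewrite /near (le_trans (heis_dist_triangle A _ _))//.
  rewrite (heis_distC A); move: h1 h2 r0; lra.
have fE i A : f i A = (gam (pou_t P i.1) - gam (pou_t P' i.2)) * (pou_f P i.1 A * pou_f P' i.2 A).
  by rewrite /f /e; case: ifPn => // /(far _ A)[[-> _]|[-> _]]; rewrite ?mul0r ?mulr0.
have GE i A : G i A = (gam (pou_t P i.1) - gam (pou_t P' i.2)) *: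
    (pou_f P i.1 A *: pou_g P' i.2 A + pou_f P' i.2 A *: pou_g P i.1 A).
  rewrite /G /e; case: ifPn => // /(far _ A)[[-> ->]|[-> ->]].
    by rewrite !scale0r !scaler0 addr0 scaler0.
  by rewrite !scale0r !scaler0 addr0 scaler0.
have KK : 0 <= 18 * (4 * K * K) by rewrite !mulr_ge0.
exists (fun A => \sum_i f i A), (fun A => \sum_i G i A); split.
  rewrite -mulrA; apply: (reg_sum (S := S)).
  - by apply: mulr_ge0 => //; apply: mulr_ge0 => //; exact: mulr_ge0.
  - move=> i; have rm := reg_mul r0 (reg_coarsen r0 (rp i.1)) (rp' i.2).
    apply: reg_le (reg_scale (e i) rm).
    by rewrite [leRHS]mulrAC ler_wpM2r.
  - move=> i A; rewrite negb_and => /orP[/sp|/sp'] [h1 h2]; rewrite /f /G h1 h2.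
      by rewrite mul0r mulr0 scale0r !scaler0 addr0 scaler0.
    by rewrite !mulr0 scale0r !scaler0 addr0 scaler0.
  - move=> A; rewrite (_ : [set i | S i A]%SET =
        finset.setX [set k | (heis_dist (c (pou_t P k)) A <= r / 2)%R]%SET
          [set k | (heis_dist (c (pou_t P' k)) A <= r)%R]%SET).
      by rewrite cardsX leq_mul.
    by apply/setP => -[k j]; rewrite !inE.
move=> t /andP[lt th]; have [s1 s0] := sm t lt th; have [s1' s0'] := sm' t lt th.
split.
  under eq_bigr do rewrite fE.
  rewrite -(pair_bigA _ (fun k j => (gam (pou_t P k) - gam (pou_t P' j)) * (pou_f P k (c t) * pou_f P' j (c t))))/=.
  have inner k : \sum_j (gam (pou_t P k) - gam (pou_t P' j)) * (pou_f P k (c t) * pou_f P' j (c t)) =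
      gam (pou_t P k) * pou_f P k (c t) - pou_f P k (c t) * pou_val P' (c t).
    have -> : gam (pou_t P k) * pou_f P k (c t) = \sum_j gam (pou_t P k) * pou_f P k (c t) * pou_f P' j (c t).
      by rewrite -mulr_sumr s1' mulr1.
    rewrite /pou_val mulr_sumr -sumrB; apply: eq_bigr => j _; ring.
  under eq_bigr do rewrite inner.
  by rewrite sumrB -mulr_suml s1 mul1r.
under eq_bigr do rewrite GE.
rewrite -(pair_bigA _ (fun k j => (gam (pou_t P k) - gam (pou_t P' j)) *:
   (pou_f P k (c t) *: pou_g P' j (c t) + pou_f P' j (c t) *: pou_g P k (c t))))/=.
have inner k : \sum_j (gam (pou_t P k) - gam (pou_t P' j)) *:
   (pou_f P k (c t) *: pou_g P' j (c t) + pou_f P' j (c t) *: pou_g P k (c t)) =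
   gam (pou_t P k) *: pou_g P k (c t) - (pou_f P k (c t) *: pou_grad P' (c t) + pou_val P' (c t) *: pou_g P k (c t)).
  have e1 : \sum_j (gam (pou_t P k) * pou_f P k (c t)) *: pou_g P' j (c t) = 0.
    by rewrite -scaler_sumr s0' scaler0.
  have e2 : \sum_j pou_f P' j (c t) *: (gam (pou_t P k) *: pou_g P k (c t)) = gam (pou_t P k) *: pou_g P k (c t).
    by rewrite -scaler_suml s1' scale1r.
  transitivity (\sum_j ((gam (pou_t P k) * pou_f P k (c t)) *: pou_g P' j (c t) +
      pou_f P' j (c t) *: (gam (pou_t P k) *: pou_g P k (c t)) -
      (pou_f P k (c t) *: (gam (pou_t P' j) *: pou_g P' j (c t)) +
       (gam (pou_t P' j) * pou_f P' j (c t)) *: pou_g P k (c t)))).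
    apply: eq_bigr => j _.
    move: (pou_g P k (c t)) (pou_g P' j (c t)) => [u1 u2] [v1 v2].
    move: (gam _) (gam _) (pou_f _ _ _) (pou_f _ _ _) => x y z w.
    by congr (_, _); rewrite /= /GRing.scale/=; ring.
  rewrite sumrB !big_split/= e1 e2 add0r /pou_grad /pou_val -scaler_sumr -scaler_suml.
  by [].
under eq_bigr do rewrite inner.
rewrite sumrB big_split/= -scaler_suml -scaler_sumr s1 s0 scale1r scaler0 addr0.
by [].
Qed.

End WhitneyExtension.

(** * The extension theorem *)

Section WhitneyTheorem.
Context {R : realType}.

Lemma taylor_rem_sum (I : finType) (f : I -> heis R -> R) (G : I -> heis R -> R * R) A B :
  taylor_rem (fun A => \sum_i f i A) (fun A => \sum_i G i A) A B = \sum_i taylor_rem (f i) (G i) A B.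
Proof. by rewrite /taylor_rem dot_suml !sumrB. Qed.

Lemma small_eventually (k b : R) : 0 <= k -> 0 < b -> forall e : R, 0 < e ->
  \forall n \near \oo, k * scale n `^ b <= e.
Proof.
move=> k0 b0 e e0; have [d d0 Hd] := powR_small b0 k0 e0.
by apply: filterS (scale_small d0) => n; apply: Hd; exact/ltW/scale_gt0.
Qed.

(** The prescribed gradient on the curve is zero, which is why a Taylor condition on the data
    reduces to a bound on differences of [gam]. Only boundedness of the partial sums is shown; the
    ultralimit supplies [f] and [G], and the remainder estimate, uniform in the number of terms,
    survives. On the curve the sum telescopes to the average at the last scale. *)
Theorem whitney_extension (a C lo hi : R) (c : R -> heis R) (gam : R -> R) :
  0 < a -> a < 1 -> 0 <= C -> lo <= hi ->
  (forall t t', lo <= t -> t <= t' -> t' <= hi ->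
     (t' - t) / 2 <= heis_dist (c t) (c t') ^+ 2) ->
  (forall t t', lo <= t -> t <= t' -> t' <= hi ->
     heis_dist (c t) (c t') ^+ 2 <= 2 * (t' - t)) ->
  (forall t t', lo <= t <= hi -> lo <= t' <= hi ->
     `|gam t - gam t'| <= C * heis_dist (c t) (c t') `^ (1 + a)) ->
  exists (f : heis R -> R) (G : heis R -> R * R) (M : R), [/\ 0 <= M,
    forall A B, `|taylor_rem f G A B| <= M * heis_dist A B `^ (1 + a) &
    forall t, lo <= t <= hi -> f (c t) = gam t /\ G (c t) = 0].
Proof.
move=> a0 a1 C0 lohi dge dle gd.
have ap : 0 < 1 + a by rewrite addr_gt0.
have [K [N [K0 HP]]] := pou_exists lohi dge dle.
have [P PP] := choice (fun n => HP (scale n) (scale_gt0 n)).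
pose K5 : R := (2 * (N * N))%:R * (4 * C * (18 * (4 * K * K))).
have K50 : 0 <= K5 by rewrite !mulr_ge0.
have ex n : exists S : (heis R -> R) * (heis R -> R * R), reg (scale n) (K5 * scale n `^ (1 + a)) S.1 S.2 /\
  forall t, lo <= t <= hi -> S.1 (c t) = pou_val gam (P n.+1) (c t) - pou_val gam (P n) (c t) /\
    S.2 (c t) = pou_grad gam (P n.+1) (c t) - pou_grad gam (P n) (c t).
  have PS := PP n.+1; rewrite scaleS in PS.
  have [f [G H]] := pou_step a0 a1 C0 gd K0 (scale_gt0 n) PS (PP n).
  by exists (f, G).
have [S HS] := choice ex.
have [K6 K60 rbase] := pou_base gam K0 (scale_gt0 0) (PP 0%N).
rewrite /scale expr0 in rbase.
have [Cs Cs0 sums] := sum_scales a0 a1.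
pose Phi M A := pou_val gam (P 0%N) A + \sum_(n < M) (S n).1 A.
pose GPhi M A := pou_grad gam (P 0%N) A + \sum_(n < M) (S n).2 A.
have rS n : reg (scale n) (K5 * scale n `^ (1 + a)) (S n).1 (S n).2 by have [] := HS n.
have inv1 n : 1 <= 1 / scale n :> R by rewrite ler_pdivlMr ?scale_gt0// mul1r scale_le1.
have inv2 n : 1 / scale n <= (1 / scale n) ^+ 2 :> R.
  by rewrite expr2 ler_peMl// (le_trans ler01).
have pw n : 0 <= scale n `^ (1 + a) :> R by exact: powR_ge0.
have kp n : 0 <= K5 * scale n `^ (1 + a) by exact: mulr_ge0.
(* All scales are at most 1, so uniform bounds are the case [d = 1] of the summation lemma. *)
have bndf M A : `|Phi M A| <= K6 + K5 * Cs.
  rewrite (le_trans (ler_normD _ _))// lerD//; first by have [h _] := rbase.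
  rewrite (le_trans (ler_norm_sum _ _ _))//.
  have := sums 1 K5 (fun n => `|(S n).1 A|) M ler01 K50; rewrite powR1 mulr1; apply.
  - move=> n; have [h _] := rS n; rewrite (le_trans (h A))// mulrA ler_peMr//.
    by rewrite (le_trans (inv1 n)).
  - by move=> n; have [h _] := rS n; rewrite (le_trans (h A))// mulrA ler_peMr.
have bndG M A : enorm2 (GPhi M A) <= 3 * K6 + 3 * K5 * Cs.
  rewrite (le_trans (enorm2D _ _))// lerD//.
    by have := reg_grad A ltr01 rbase; rewrite divr1.
  rewrite (le_trans (enorm2_sum _))//.
  have gS n : enorm2 ((S n).2 A) <= 3 * K5 * (scale n `^ (1 + a) * (1 / scale n)).
    have h := reg_grad A (scale_gt0 n) (rS n); rewrite (le_trans h)//.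
    by rewrite le_eqVlt; apply/orP; left; apply/eqP; ring.
  have K530 : 0 <= 3 * K5 by exact: mulr_ge0.
  have := sums 1 (3 * K5) (fun n => enorm2 ((S n).2 A)) M ler01 K530; rewrite powR1 mulr1; apply=> // n.
  by rewrite (le_trans (gS n))// !ler_wpM2l.
have bndT M A B : `|taylor_rem (Phi M) (GPhi M) A B| <= (7 * K6 * Cs + 7 * K5 * Cs) * heis_dist A B `^ (1 + a).
  have -> : taylor_rem (Phi M) (GPhi M) A B = taylor_rem (pou_val gam (P 0%N)) (pou_grad gam (P 0%N)) A B
     + \sum_(n < M) taylor_rem (S n).1 (S n).2 A B.
    rewrite -(taylor_rem_sum (fun n : 'I_M => (S n).1) (fun n : 'I_M => (S n).2)).
    by rewrite /taylor_rem /Phi /GPhi dotDl; ring.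
  have d0 := heis_dist_ge0 A B; set d := heis_dist A B in d0 *.
  rewrite (le_trans (ler_normD _ _))// mulrDl lerD//.
    (* The average at scale 1 is treated as a series with one term: this interpolates its linear and
       quadratic bounds to the power [1 + a]. *)
    pose x n := if n is 0%N then `|taylor_rem (pou_val gam (P 0%N)) (pou_grad gam (P 0%N)) A B| else 0.
    have K67 : 0 <= 7 * K6 by exact: mulr_ge0.
    have := sums d (7 * K6) x 1%N d0 K67; rewrite big_ord1 /=; apply=> -[|n] /=.
    - rewrite /scale expr0 powR1 mul1r; have [_ h] := rbase; rewrite (le_trans (h A B))//.
      by rewrite ler_wpM2r ?sqr_ge0// ler_peMl//; lra.
    - by apply: mulr_ge0 => //; apply: mulr_ge0 => //; exact: sqr_ge0.
    - by rewrite /scale expr0 powR1 mul1r; exact: reg_taylor_lin ltr01 rbase.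
    - apply: mulr_ge0 => //; apply: mulr_ge0 => //; apply: divr_ge0 => //; exact/ltW/scale_gt0.
  rewrite (le_trans (ler_norm_sum _ _ _))//.
  have K57 : 0 <= 7 * K5 by exact: mulr_ge0.
  apply: (sums d (7 * K5) (fun n => `|taylor_rem (S n).1 (S n).2 A B|) M d0 K57) => n.
    have [_ h] := rS n; rewrite (le_trans (h A B))// -/d mulrA.
    by rewrite ler_wpM2r ?sqr_ge0// ler_wpM2r// ler_peMl//; lra.
  have h := reg_taylor_lin A B (scale_gt0 n) (rS n); rewrite (le_trans h)// -/d.
  by rewrite le_eqVlt; apply/orP; left; apply/eqP; ring.
have [U [UU Uoo]] := nat_ultrafilter.
have PU : ProperFilter U by exact: ultra_proper.
have [f Hf] := choice (fun A => ultra_bounded_cvg UU (fun M => bndf M A)).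
have exG A : exists g : R * R, GPhi M A @[M --> U] --> g.
  have [x Hx] := ultra_bounded_cvg UU (fun M => le_trans (enorm2_ge1 _) (bndG M A)).
  have [y Hy] := ultra_bounded_cvg UU (fun M => le_trans (enorm2_ge2 _) (bndG M A)).
  exists (x, y).
  have -> : (fun M => GPhi M A) = (fun M => ((GPhi M A).1, (GPhi M A).2)).
    by apply/funext => M; case: (GPhi M A).
  exact: (@cvg_pair _ _ _ U (nbhs x) (nbhs y)).
have [G HG] := choice exG.
exists f, G, (7 * K6 * Cs + 7 * K5 * Cs); split.
- by apply: addr_ge0; rewrite !mulr_ge0.
- move=> A B; have lim : `|taylor_rem (Phi M) (GPhi M) A B| @[M --> U] --> `|taylor_rem f G A B|.
    apply: cvg_norm; apply: cvgB; first by apply: cvgB; exact: Hf.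
    have h1 := cvg_fst2 (HG A); have h2 := cvg_snd2 (HG A).
    by apply: cvgD; apply: cvgM => //; exact: cvg_cst.
  by apply: (cvgr_to_le lim); apply: filterE => M.
- move=> t tt.
  have tel M : Phi M (c t) = pou_val gam (P M) (c t) /\ GPhi M (c t) = pou_grad gam (P M) (c t).
    elim: M => [|M [IH1 IH2]]; first by rewrite /Phi /GPhi !big_ord0 !addr0.
    have [h1 h2] := (HS M).2 t tt.
    rewrite /Phi /GPhi !big_ord_recr/= !addrA -/(Phi M (c t)) -/(GPhi M (c t)) IH1 IH2 h1 h2.
    by split; rewrite addrC subrK.
  split.
    apply/eqP; rewrite -subr_eq0 -normr_le0; apply/ler_addgt0Pr => e e0; rewrite add0r.
    have lim : `|Phi M (c t) - gam t| @[M --> U] --> `|f (c t) - gam t|.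
      by apply: cvg_norm; apply: cvgB; [exact: Hf|exact: cvg_cst].
    apply: (cvgr_to_le lim).
    have k0 : 0 <= N%:R * (C * K) by rewrite !mulr_ge0.
    apply: filterS (Uoo _ (small_eventually k0 ap e0)) => M hM.
    have [-> _] := tel M; rewrite (le_trans (pou_val_close a0 C0 gd K0 (scale_gt0 M) (PP M) tt))//.
    by rewrite (le_trans _ hM)// le_eqVlt; apply/orP; left; apply/eqP; ring.
  apply: enorm2_eq0; apply/ler_addgt0Pr => e e0; rewrite add0r.
  have lim : enorm2 (GPhi M (c t)) @[M --> U] --> enorm2 (G (c t)) by exact: cvg_enorm2.
  apply: (cvgr_to_le lim).
  have k0 : 0 <= N%:R * (C * (3 * K)) by rewrite !mulr_ge0.
  apply: filterS (Uoo _ (small_eventually k0 a0 e0)) => M hM.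
  have [_ ->] := tel M; rewrite (le_trans (pou_grad_small a0 C0 gd K0 (scale_gt0 M) (PP M) tt))//.
  rewrite (le_trans _ hM)// le_eqVlt; apply/orP; left; apply/eqP.
  by rewrite powR1D ?(ltW (scale_gt0 M))//; field; rewrite gt_eqF// scale_gt0.
Qed.

(** The Taylor estimate already determines the regularity of [G]: the expansions at [A] and [B] are
    compared at a point at horizontal distance [heis_dist A B] from [B]. Three remainders occur,
    with constants 1, 1 and 4, the last one over a doubled distance. *)
Lemma taylor_grad_holder (a M : R) (f : heis R -> R) (G : heis R -> R * R) : 0 < a -> a < 1 -> 0 <= M ->
  (forall A B, `|taylor_rem f G A B| <= M * heis_dist A B `^ (1 + a)) ->
  forall A B, enorm2 (G A - G B) <= 6 * M * heis_dist A B `^ a.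
Proof.
move=> a0 a1 M0 H A B; set r := heis_dist A B.
have [r0|r0] := leP r 0.
  rewrite (heis_dist_eq0 r0) subrr enorm20 mulr_ge0 ?powR_ge0//; exact: mulr_ge0.
have rp := ltW r0; have ap : 0 <= 1 + a by rewrite addr_ge0// ltW.
rewrite -(ler_pM2l r0).
have -> : r * (6 * M * r `^ a) = 6 * (M * r `^ (1 + a)) by rewrite powR1D//; ring.
apply: enorm2_test => // v vr; set X := heis_mul B (v, 0).
have e1 := H B X; rewrite taylor_rem_hor heis_dist_mul_hor vr -/X in e1.
have e2 := H A B; rewrite -/r in e2.
have e3 : `|taylor_rem f G A X| <= 4 * (M * r `^ (1 + a)).
  rewrite (le_trans (H A X))// mulrCA ler_wpM2l//.
  have dX : heis_dist A X <= 2 * r.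
    by rewrite (le_trans (heis_dist_triangle B _ _))// heis_dist_mul_hor vr -/r mulr2n mulrDl mul1r.
  rewrite (le_trans (le_powR ap (heis_dist_ge0 _ _) dX))// !powR1D// ?mulr_ge0//.
  have r2 : 0 <= 2 * r by rewrite mulr_ge0.
  have : (2 * r) `^ a <= 2 * r `^ a by apply: powRMl_le; [lra|exact: ltW|exact: ltW|].
  by move/(ler_wpM2l r2); set x := r `^ a; lra.
have -> : dot (G A - G B) v = (f X - f B - dot (G B) v) + taylor_rem f G A B - taylor_rem f G A X.
  rewrite /taylor_rem (_ : X.1 - A.1 = (B.1 - A.1) + v).
    by rewrite dotDr /dot /=; ring.
  by rewrite heis_mul_fst addrAC.
move: e1 e2 e3; rewrite !ler_norml; set w := M * _; lra.
Qed.

End WhitneyTheorem.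

(** * Maps vanishing on a vertical lift *)

Section Defining.
Context {R : realType}.

Definition hlin (u v : R * R) (A : heis R) : R * R := (dot u A.1, dot v A.1).

Lemma hlin_hom (u v : R * R) : horizontal_hom (hlin u v).
Proof.
split.
- move=> A; have h : B @[B --> A] --> A by exact: cvg_id.
  have h1 := cvg_fst2 h.
  have hd w : dot w B.1 @[B --> A] --> dot w A.1.
    by apply: cvgD; apply: cvgM; (try exact: cvg_cst); [exact: cvg_fst2 h1|exact: cvg_snd2 h1].
  exact: (@cvg_pair _ _ _ (nbhs A) (nbhs (dot u A.1)) (nbhs (dot v A.1))).
- by move=> A B; rewrite /hlin heis_mul_fst !dotDr.
- move=> t A _; rewrite /hlin (_ : (heis_dil t A).1 = t *: A.1); last by case: A.
  by rewrite !dotZr.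
Qed.

(** [Dh] is picked by [xget], so it can be computed only once the differential is known to be
    unique; by homogeneity a single short horizontal vector in each direction decides. *)
Lemma is_hdiff_unique (F : heis R -> R * R) A L1 L2 :
  is_hdiff F A L1 -> is_hdiff F A L2 -> L1 = L2.
Proof.
move=> [h1 H1] [h2 H2]; apply/funext => B.
rewrite (hom_fst h1) (hom_fst h2); set v := B.1.
apply/eqP; rewrite -subr_eq0; apply/eqP/enorm2_eq0/ler_addgt0Pr => e e0; rewrite add0r.
have k0 : 0 < enorm2 v + 1 by rewrite ltr_wpDl// enorm2_ge0.
have e1 : 0 < e / 2 / (enorm2 v + 1) by rewrite divr_gt0 ?divr_gt0.
have cv : ((h *: v, 0) : heis R) @[h --> (0 : R)] --> (0 : heis R) by exact: cvg_hor0.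
have n1 := cv _ (H1 _ e1); have n2 := cv _ (H2 _ e1).
rewrite !nbhs_simpl/= in n1 n2.
have [/= d d0 Hd] := filterI n1 n2.
have [hp hd] : 0 < d / 2 /\ d / 2 < d by move: d0; lra.
have [] := Hd (d / 2); first by rewrite /ball_/= sub0r normrN gtr0_norm.
rewrite /= rho_hor enorm2Z gtr0_norm// !hom_horZ//.
set X := F _ - F A => b1 b2.
rewrite -(ler_pM2l hp).
have -> : d / 2 * enorm2 (L1 (v, 0) - L2 (v, 0)) =
   enorm2 ((X - (d / 2) *: L2 (v, 0)) - (X - (d / 2) *: L1 (v, 0))).
  rewrite -[d / 2 in LHS](gtr0_norm hp) -enorm2Z scalerBr; congr enorm2.
  by rewrite opprB [RHS]addrC subrKA.
rewrite (le_trans (enorm2B _ _))// (le_trans (lerD b2 b1))//.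
have ev : e / 2 / (enorm2 v + 1) * enorm2 v <= e / 2.
  by rewrite mulrAC ler_pdivrMr// ler_wpM2l ?lerDl// divr_ge0// ltW.
move: (ler_wpM2l (ltW hp) ev); set q := e / 2 / _; lra.
Qed.

(** A converse to [heis_taylor]: a uniform expansion with Hoelder coefficients makes [F]
    differentiable everywhere, with those coefficients as its differential. *)
Lemma C1H_holder_taylor (a M : R) (F : heis R -> R * R) (u v : heis R -> R * R) :
  0 < a -> 0 <= M ->
  (forall A B, enorm2 (F B - F A - hlin (u A) (v A) (B.1 - A.1, 0)) <= M * heis_dist A B `^ (1 + a)) ->
  (forall A B, enorm2 (u A - u B) <= M * heis_dist A B `^ a) ->
  (forall A B, enorm2 (v A - v B) <= M * heis_dist A B `^ a) ->
  C1H_holder a F /\ forall A, Dh F A = hlin (u A) (v A).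
Proof.
move=> a0 M0 HF Hu Hv.
have hdif A : is_hdiff F A (hlin (u A) (v A)).
  split; first exact: hlin_hom.
  move=> e e0; have [d d0 Hd] := powR_small a0 M0 e0.
  apply: filterS (nbhs_heis_dist (0 : heis R) d0) => B /= dB.
  have rB : rho_oo B = heis_dist A (heis_mul A B).
    by rewrite heis_distE zeta_mul heis_mul_fst addrC addKr.
  have r0 : heis_dist 0 B = rho_oo B.
    by rewrite heis_distE /rho_oo subr0 /zeta /wedge /= !mul0r !subr0 mulr0 addr0.
  have := HF A (heis_mul A B); rewrite heis_mul_fst [A.1 + _]addrC addrK -rB.
  rewrite -(hom_fst (hlin_hom _ _)) => /le_trans; apply.
  have r_ge0 : 0 <= rho_oo B by rewrite rB heis_dist_ge0.
  rewrite powR1D// mulrCA mulrC ler_wpM2r//.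
  by apply: Hd => //; rewrite -r0.
have DhE A : Dh F A = hlin (u A) (v A).
  apply: is_hdiff_unique (hdif A); apply: Dh_hdiff; by exists (hlin (u A) (v A)).
have hd A B : hom_dist (Dh F A) (Dh F B) <= 2 * M * heis_dist A B `^ a.
  rewrite !DhE; apply: hom_dist_le; try exact: hlin_hom.
    by apply: mulr_ge0; [exact: mulr_ge0|exact: powR_ge0].
  move=> w; rewrite (le_trans (enorm2_le_norms _))//=.
  have e1 : dot (u A) w - dot (u B) w = dot (u A - u B) w by rewrite /dot /=; ring.
  have e2 : dot (v A) w - dot (v B) w = dot (v A - v B) w by rewrite /dot /=; ring.
  rewrite e1 e2 (le_trans (lerD (dot_le _ _) (dot_le _ _)))// -mulrDl ler_wpM2r ?enorm2_ge0//.
  by have := Hu A B; have := Hv A B; set q := _ `^ a; lra.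
split; [split; [split|]|] => //.
- by move=> A; exists (hlin (u A) (v A)).
- move=> A; apply/cvgrPdist_le => e e0.
  have M2 : 0 <= 2 * M by rewrite mulr_ge0.
  have [d d0 Hd] := powR_small a0 M2 e0.
  apply: filterS (nbhs_heis_dist A d0) => B /= dB.
  rewrite sub0r normrN ger0_norm; last first.
    by rewrite !DhE; apply: hom_dist_ge0; exact: hlin_hom.
  by rewrite (le_trans (hd B A))// heis_distC Hd// heis_dist_ge0.
- by exists (2 * M).
Qed.

Theorem vertical_lift_level (a : R) (a0 : 0 < a) (a1 : a < 1) (T : R) (g : R -> R * R) :
  0 < T -> holder_curve ((1 + a) / 2) T g ->
  forall z0 : R, exists2 d : R, 0 < d &
    forall u v : R, 0 <= u -> u < v -> v <= T -> v - u < d ->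
      exists2 F : heis R -> R * R, C1H_holder a F &
        forall t : R, t \in `[u, v] ->
          F (vertical_lift g z0 t) = 0 /\ set_surj setT setT (Dh F (vertical_lift g z0 t)).
Proof.
move=> T0 [C0 HC0] z0; pose C := Num.max C0 0.
have C_ge0 : 0 <= C by rewrite le_max lexx orbT.
have Hg t t' : 0 <= t -> t <= t' -> t' <= T ->
    enorm2 (g t' - g t) <= C * (t' - t) `^ ((1 + a) / 2).
  move=> t0 tt' t'T; have := HC0 t t'; rewrite !in_itv/= t0 t'T (le_trans tt' t'T) (le_trans t0 tt').
  move=> /(_ isT isT) /le_trans; apply; rewrite ger0_norm ?subr_ge0//.
  by rewrite ler_wpM2r ?powR_ge0// le_max lexx.
have [C' C'0 vc] := vertical_lift_vcurve z0 a0 C_ge0 (ltW T0) Hg.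
have e2 : 0 < 2^-1 :> R by rewrite invr_gt0.
have [d1 d10 H1] := powR_small a0 C'0 e2.
have [d2 d20 H2] := powR_small a0 (sqr_ge0 C') ltr01.
(* [d1] keeps the error on [zeta] below half of the increment, and [d2] the squared horizontal
   displacement below the increment. Together they give the two-sided comparison of the squared
   distance with [t' - t] required by the extension theorem. *)
exists (Num.min d1 d2); first by rewrite lt_min d10.
move=> u v u0 uv vT; rewrite lt_min => /andP[/ltW uvd1 /ltW uvd2].
set c := vertical_lift g z0 in vc *.
have vc' : vcurve a C' u v c by exact: vcurve_sub vc.
have vu0 : 0 <= v - u by rewrite subr_ge0 ltW.
have small1 := H1 _ vu0 uvd1; have small2 := H2 _ vu0 uvd2.
have half := vcurve_zeta_half a0 C'0 small1 vc'.
have dge t t' : u <= t -> t <= t' -> t' <= v -> (t' - t) / 2 <= heis_dist (c t) (c t') ^+ 2.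
  move=> ut tt' t'v; rewrite (le_trans _ (heis_dist_ver _ _))//.
  have := half t t' ut tt' t'v; rewrite ler_distlC => /andP[h1 h2].
  by have := ler_norm (zeta (c t) (c t')); move: h1 h2; lra.
have dle t t' : u <= t -> t <= t' -> t' <= v -> heis_dist (c t) (c t') ^+ 2 <= 2 * (t' - t).
  move=> ut tt' t'v; have s0 : 0 <= t' - t by rewrite subr_ge0.
  have s2 : 0 <= 2 * (t' - t) by rewrite mulr_ge0.
  rewrite -[leRHS]sqr_sqrtr// ler_pXn2r// ?nnegrE ?heis_dist_ge0 ?sqrtr_ge0//.
  apply: heis_dist_le; rewrite ?sqrtr_ge0// ?sqr_sqrtr//.
    rewrite -(ler_pXn2r (ltn0Sn 1)) ?nnegrE ?enorm2_ge0 ?sqrtr_ge0// [leRHS]sqr_sqrtr//.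
    have [h _] := vc' t t' ut tt' t'v.
    rewrite (@le_trans _ _ ((C' * (t' - t) `^ ((1 + a) / 2)) ^+ 2))//.
      have k0 : 0 <= C' * (t' - t) `^ ((1 + a) / 2) by rewrite mulr_ge0// powR_ge0.
      by rewrite ler_pXn2r// ?nnegrE ?enorm2_ge0.
    rewrite expr2 mulrACA powR_half_mul// powR1D// -expr2 mulrCA.
    rewrite (@le_trans _ _ ((t' - t) * 1))//; last by move: s0; lra.
    rewrite ler_wpM2l// (le_trans _ small2)// ler_wpM2l ?sqr_ge0//.
    by apply: le_powR => //; [exact: ltW|exact: lerB].
  have := half t t' ut tt' t'v; rewrite !ler_norml; move: s0; lra.
have gdist t t' : u <= t <= v -> u <= t' <= v ->
    enorm2 (g t - g t') <= 2 * C * heis_dist (c t) (c t') `^ (1 + a).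
  have main s s' : u <= s -> s <= s' -> s' <= v ->
      enorm2 (g s' - g s) <= 2 * C * heis_dist (c s) (c s') `^ (1 + a).
    move=> us ss' s'v; rewrite (le_trans (Hg _ _ (le_trans u0 us) ss' (le_trans s'v vT)))//.
    rewrite -mulrA mulrCA ler_wpM2l//.
    have s0 : 0 <= s' - s by rewrite subr_ge0.
    have b0 : 0 <= (1 + a) / 2 by rewrite divr_ge0// addr_ge0// ltW.
    have -> : heis_dist (c s) (c s') `^ (1 + a) = (heis_dist (c s) (c s') ^+ 2) `^ ((1 + a) / 2).
      by rewrite -powR_mulrn ?heis_dist_ge0// -powRrM; congr (_ `^ _); field.
    have h := dge s s' us ss' s'v.
    have h' : s' - s <= 2 * heis_dist (c s) (c s') ^+ 2 by move: h; lra.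
    rewrite (le_trans (le_powR b0 s0 h'))//; apply: powRMl_le => //; rewrite ?sqr_ge0//; move: a1; lra.
  move=> /andP[ut tv] /andP[ut' t'v]; have [tt'|/ltW tt'] := leP t t'.
    by rewrite enorm2_subC; exact: main.
  by rewrite heis_distC; exact: main.
have C20 : 0 <= 2 * C by rewrite mulr_ge0.
have uv' := ltW uv.
have [f1 [G1 [M1 [M10 T1 E1]]]] := @whitney_extension R a (2 * C) u v c (fun t => (g t).1) a0 a1 C20 uv' dge dle
  (fun t t' tt tt' => le_trans (enorm2_ge1 (g t - g t')) (gdist t t' tt tt')).
have [f2 [G2 [M2 [M20 T2 E2]]]] := @whitney_extension R a (2 * C) u v c (fun t => (g t).2) a0 a1 C20 uv' dge dle
  (fun t t' tt tt' => le_trans (enorm2_ge2 (g t - g t')) (gdist t t' tt tt')).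
pose F (A : heis R) : R * R := (A.1.1 - f1 A, A.1.2 - f2 A).
pose e_1 : R * R := (1, 0); pose e_2 : R * R := (0, 1).
have [CF DF] : C1H_holder a F /\ forall A, Dh F A = hlin (e_1 - G1 A) (e_2 - G2 A).
  apply: (@C1H_holder_taylor a (6 * (M1 + M2))) => //.
  - by apply: mulr_ge0 => //; exact: addr_ge0.
  - move=> A B.
    have -> : F B - F A - hlin (e_1 - G1 A) (e_2 - G2 A) (B.1 - A.1, 0) =
      (- taylor_rem f1 G1 A B, - taylor_rem f2 G2 A B).
      rewrite /F /hlin /taylor_rem /dot /e_1 /e_2 /=; congr (_, _); rewrite /=; ring.
    rewrite (le_trans (enorm2_le_norms _))//= !normrN (le_trans (lerD (T1 A B) (T2 A B)))//.
    rewrite -mulrDl ler_wpM2r ?powR_ge0//; move: M10 M20; lra.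
  - move=> A B; rewrite opprB [X in enorm2 X]addrC subrKA enorm2_subC.
    rewrite (le_trans (taylor_grad_holder a0 a1 M10 T1 A B))// ler_wpM2r ?powR_ge0//; move: M10 M20; lra.
  - move=> A B; rewrite opprB [X in enorm2 X]addrC subrKA enorm2_subC.
    rewrite (le_trans (taylor_grad_holder a0 a1 M20 T2 A B))// ler_wpM2r ?powR_ge0//; move: M10 M20; lra.
exists F => // t; rewrite in_itv/= => tt.
have [h1 h2] := E1 t tt; have [h3 h4] := E2 t tt; split.
  by rewrite /F h1 h3 /c /vertical_lift /= !subrr.
rewrite DF h2 h4 !subr0 => -[x y] _; exists (x, y, 0) => //.
by rewrite /hlin /dot /e_1 /e_2 /= !mul1r !mul0r addr0 add0r.
Qed.

End Defining.

Theorem mainTheorem13 (R : realType) (alpha : R) (alpha_gt0 : 0 < alpha)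
    (alpha_lt1 : alpha < 1) :
  (forall (F : heis R -> R * R) (p : heis R),
     C1H_holder alpha F -> set_surj setT setT (Dh F p) ->
     (forall V : set (heis R), nbhs p V ->
        exists K : set (heis R),
          [/\ compact K, nbhs p K, K `<=` V & simple_arc (level_in F p K)]) /\
     (exists2 U : set (heis R), nbhs p U &
        forall K : set (heis R), compact K -> nbhs p K -> K `<=` U ->
          simple_arc (level_in F p K) ->
          exists (T : R) (g : R -> R * R) (z0 : R),
            [/\ 0 < T, holder_curve ((1 + alpha) / 2) T g &
                arc_param 0 T (vertical_lift g z0) (level_in F p K)])) /\
  (forall (T : R) (g : R -> R * R),
     0 < T -> holder_curve ((1 + alpha) / 2) T g ->
     forall z0 : R,
       exists2 d : R, 0 < d &
         forall a b : R, 0 <= a -> a < b -> b <= T -> b - a < d ->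
           exists2 F : heis R -> R * R, C1H_holder alpha F &
             forall t : R, t \in `[a, b] ->
               F (vertical_lift g z0 t) = 0 /\
               set_surj setT setT (Dh F (vertical_lift g z0 t))).
Proof.
split; last by move=> T g T0 hg z0; exact: vertical_lift_level.
by move=> F p CF sF; exact: (@level_curve R alpha alpha_gt0 alpha_lt1 F p CF sF).
Qed.
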